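(* In the setting described in the context (conforming $\mathcal{Q}^p$ finite elements with $p\ge 1$ on quadrilateral/hexahedral meshes in dimension $d\in\{2,3\}$, Gauss-Lobatto-Legendre nodal basis, admissible hierarchy), assume that the geometry maps from the reference element to the fine elements are multilinear, and let the coarse polynomial degree satisfy $1\le p'\le p$. Let $R=\omega D^{-1}$ be the damped Jacobi smoother with $0<\omega<2/\rho(D^{-1}A)$, let $V^c=\sum_{i=1}^J\Pi_iV_i^c\subset V$, let $i_c:V^c\to V$ be the inclusion, $A_c=i_c'Ai_c$, and let $$E=(I-RA)(I-i_cA_c^{-1}i_c'A)$$ be the two-level error propagation operator. Let $c^D>0$ be such that $\|v\|^2_{\bar R^{-1}}\le c^D\|v\|_D^2$ for all $v\in V$, where $\bar R=R+R'-R'AR$ and $R'$ is the adjoint of $R$. Then there is a constant $C>0$ independent of $p$, $p'$, $h$ and $H$ such that $$\|E\|_A^2\le 1-\frac{C}{p^{2d+8}\,\frac{H^3}{h^3}\,\bigl(1+{p'}^{-2}+L^2p^d\bigr)\bigl(1+L^2\tfrac{H}{h}\bigr)\,c^D},$$ where $L=\max_{i=1,\dots,J}l_i$ and $\|\cdot\|_A$ is the operator norm induced by the energy norm $\|v\|_A^2=A(v,v)$ on $V$.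
   Context: **Mesh and space.** $\Omega\subset\mathbb{R}^d$, $d\in\{2,3\}$, is an open, bounded, simply connected Lipschitz domain; $\mathcal{T}_h=\{\tau_1,\dots,\tau_N\}$ is a shape-regular, geometrically conforming, quasi-uniform mesh of disjoint open quadrilaterals/hexahedra with $\bigcup\bar\tau_i=\bar\Omega$ and $h=\max_i\mathrm{diam}(\tau_i)$. $V$ is the space of continuous functions on $\bar\Omega$ vanishing on $\partial\Omega$ whose restriction to each $\tau_i$ belongs to $\mathcal{Q}^p(\tau_i)$ (tensor-product polynomials of degree $p$ in each variable), $p\ge1$. The basis is the tensor-product Lagrange basis with Gauss-Lobatto-Legendre (GLL) nodes on each element; the nodes are called support points. $A(u,v)=\int_\Omega\nabla u\cdot\nabla v\,dx$; $A$ also denotes the corresponding operator/stiffness matrix on $V$, and $D=\mathrm{diag}(A)$ its diagonal in the nodal basis, $\|v\|_D^2=(Dv,v)$. **Agglomerates.** $B_1,\dots,B_J$ are axis-aligned bounding boxes (produced by an R-tree clustering of the mesh cells or of the support points). The set of all support points (including those on $\partial\Omega$) is a disjoint union of sets $\mathcal{P}_i=\{p^i_1,\dots,p^i_{l_i}\}\subset B_i$, $i=1,\dots,J$ (points owned by $B_i$). $\Omega_i$ is the union of all elements $\tau_j$ with $\mathcal{P}_i\cap\bar\tau_j\ne\emptyset$; $H_i=\mathrm{diam}(\Omega_i)$, $H=\max_iH_i$. $\Omega_{i,h}$ is the union of the elements $\tau_j\subset\Omega_i$ not all of whose support points lie in $\mathcal{P}_i$, and $\Omega_i^\circ=\Omega_i\setminus\Omega_{i,h}$.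 **Local spaces.** $V_i=\mathrm{span}\{\phi^i_j:\ j=1,\dots,l_i\}$, where $\phi^i_j$ is the nodal basis function (no boundary condition imposed) equal to $1$ at $p^i_j$ and $0$ at all other support points. $\Pi_i:V_i\to V$ is nodal interpolation into $V$ (it keeps the values at support points off $\partial\Omega$ and sets the values on $\partial\Omega$ to zero). $I_h^{V_i}v=\sum_{j=1}^{l_i}v(p^i_j)\phi^i_j$. Local coarse space: $V_i^c=\{I_h^{V_i}q:\ q\in\mathcal{Q}^{p'}(B_i)\}$, with $\mathcal{Q}^{p'}(B_i)$ the polynomials of degree at most $p'$ in each variable. **Standing assumptions (admissible hierarchy)**, for a fixed constant $\kappa\ge1$ and all $i$: (1) the aspect ratio of $B_i$ is at most $\kappa$; $\Omega_i^\circ$ is connected, occupies a nondegenerate portion of $B_i$ (measure at least $\kappa^{-1}|B_i|$), and satisfies the Poincaré inequality and polynomial approximation estimates (approximation of $v\in H^1(\Omega_i^\circ)$ in $L^2(\Omega_i^\circ)$ by polynomials of total degree at most $q$, with error at most $\kappa H_iq^{-1}|v|_{H^1(\Omega_i^\circ)}$ for $q\ge1$, and $\kappa H_i|v|_{H^1(\Omega_i^\circ)}$ for constants). (2) $\Omega_{i,h}$ consists of at most $\kappa$ layers of fine cells, hence has thickness $O(h)$, and each point lies in at most $\kappa$ of the sets $\Omega_{i,h}$. (3) $\partial\Omega_{i,h}$ is uniformly shape-regular and its $(d-1)$-dimensional measure is between $\kappa^{-1}H^{d-1}$ and $\kappa H^{d-1}$. (4) $p'\le p$ and the points $\mathcal{P}_i$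 are uniformly unisolvent and stable for interpolation from $\mathcal{Q}^{p'}(B_i)$: $\|q\|_{L^\infty(B_i)}\le\kappa\max_{x\in\mathcal{P}_i}|q(x)|$ for $q\in\mathcal{Q}^{p'}(B_i)$. The constant $C$ may depend only on $d$, $\Omega$, the shape-regularity and quasi-uniformity constants of the meshes, and $\kappa$. *)

(* Defs.v *)
From HB Require Import structures.
From mathcomp Require Import all_boot all_order all_algebra finmap.
From mathcomp Require Import complex polyrcf.
From mathcomp Require Import all_classical all_reals all_analysis.

Set Implicit Arguments.
Unset Strict Implicit.
Unset Printing Implicit Defensive.

Import Order.TTheory GRing.Theory Num.Theory.
Import numFieldNormedType.Exports.

Local Open Scope classical_set_scope.
Local Open Scope ring_scope.

(** The library norm on ['rV[R]_d] is the sup norm; it is used only for the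
    topology.  Lengths and diameters are Euclidean. *)

Definition dotv (R : realType) (d : nat) (x y : 'rV[R]_d) : R :=
  \sum_(k < d) x 0 k * y 0 k.

Definition enorm (R : realType) (d : nat) (x : 'rV[R]_d) : R :=
  Num.sqrt (dotv x x).

Definition diam (R : realType) (d : nat) (D : set 'rV[R]_d) : R :=
  sup [set enorm (z.1 - z.2) | z in D `*` D].

Definition eball (R : realType) (d : nat) (x : 'rV[R]_d) (r : R) :
    set 'rV[R]_d := [set y | enorm (y - x) <= r].

Definition bdry (R : realType) (d : nat) (D : set 'rV[R]_d) : set 'rV[R]_d :=
  closure D `\` interior D.

(** Lebesgue measure on R^d, as a measure on the iterated product
    [((unit * R) * ...) * R]; [leb_pt] identifies the points of that product
    with row vectors. *)

Record leb_space (R : realType) (n : nat) := LebSpace {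
  leb_disp : measure_display;
  leb_type : measurableType leb_disp;
  leb_mu : {measure set leb_type -> \bar R};
  leb_pt : leb_type -> 'rV[R]_n }.

Fixpoint lebesgueRd (R : realType) (n : nat) : leb_space R n :=
  match n with
  | 0 => LebSpace [the {measure set unit -> \bar R} of dirac tt] (fun=> 0)
  | n'.+1 =>
    let M := lebesgueRd R n' in
    LebSpace
      [the {measure set _ -> \bar R} of (leb_mu M \x @lebesgue_measure R)%E]
      (fun z => row_mx (const_mx z.2 : 'rV[R]_1) (leb_pt z.1) : 'rV[R]_(1 + n'))
  end.

Definition leb_meas (R : realType) (d : nat) (D : set 'rV[R]_d) : \bar R :=
  leb_mu (lebesgueRd R d) (leb_pt (l := lebesgueRd R d) @^-1` D).

Definition leb_int (R : realType) (d : nat) (D : set 'rV[R]_d)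
    (f : 'rV[R]_d -> R) : R :=
  (\int[leb_mu (lebesgueRd R d)]_(t in leb_pt (l := lebesgueRd R d) @^-1` D)
     f (leb_pt t))%R.

Definition sq_integrable (R : realType) (d : nat) (D : set 'rV[R]_d)
    (f : 'rV[R]_d -> R) : Prop :=
  let DD := leb_pt (l := lebesgueRd R d) @^-1` D in
  measurable_fun DD (fun t => f (leb_pt t)) /\
  (\int[leb_mu (lebesgueRd R d)]_(t in DD) ((f (leb_pt t)) ^+ 2)%:E < +oo)%E.

Definition l2norm (R : realType) (d : nat) (D : set 'rV[R]_d)
    (f : 'rV[R]_d -> R) : R :=
  Num.sqrt (leb_int D (fun x => f x ^+ 2)).

Definition partial (R : realType) (d : nat) (k : 'I_d) (f : 'rV[R]_d -> R)
    (x : 'rV[R]_d) : R :=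
  'D_(delta_mx 0 k) f x.

Fixpoint Ck (R : realType) (d : nat) (m : nat) (f : 'rV[R]_d -> R) : Prop :=
  match m with
  | 0 => continuous f
  | m'.+1 => continuous f /\
      forall k : 'I_d, (forall x, derivable f x (delta_mx 0 k)) /\
                       Ck m' (partial k f)
  end.

Definition test_fun (R : realType) (d : nat) (D : set 'rV[R]_d)
    (f : 'rV[R]_d -> R) : Prop :=
  (forall m, Ck m f) /\
  exists K : set 'rV[R]_d,
    [/\ compact K, K `<=` D & forall x, ~ K x -> f x = 0].

(** [v] is in H^1(D), with weak gradient [g]. *)
Definition H1_grad (R : realType) (d : nat) (D : set 'rV[R]_d)
    (v : 'rV[R]_d -> R) (g : 'I_d -> 'rV[R]_d -> R) : Prop :=
  [/\ sq_integrable D v, forall k, sq_integrable D (g k) &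
      forall f k, test_fun D f ->
        leb_int D (fun x => v x * partial k f x) =
        - leb_int D (fun x => g k x * f x)].

Definition H1_semi (R : realType) (d : nat) (D : set 'rV[R]_d)
    (g : 'I_d -> 'rV[R]_d -> R) : R :=
  Num.sqrt (leb_int D (fun x => \sum_k g k x ^+ 2)).

(** [omega_s / 2^s], with [omega_s] the volume of the unit ball of R^s, for
    s = 1, 2: the normalisation for which the s-dimensional Hausdorff measure
    is length (s = 1) or area (s = 2). *)
Definition hausdorff_coef (R : realType) (s : nat) : R :=
  if s == 1%N then 1 else pi / 4.

Definition hausdorff_pre (R : realType) (d s : nat) (delta : R)
    (D : set 'rV[R]_d) : \bar R :=
  ereal_inf
    [set (\sum_(0 <= k <oo) (hausdorff_coef R s * diam (U k) ^+ s)%:E)%E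
    | U in [set U : nat -> set 'rV[R]_d |
            D `<=` \bigcup_k U k /\
            forall k x y, U k x -> U k y -> enorm (x - y) <= delta]].

Definition hausdorff (R : realType) (d s : nat) (D : set 'rV[R]_d) : \bar R :=
  ereal_sup [set hausdorff_pre s delta D | delta in [set delta : R | 0 < delta]].

(** Uniform shape-regularity of an s-dimensional surface, at all scales up to
    its diameter: Ahlfors regularity of dimension s with constant kappa. *)
Definition ahlfors_regular (R : realType) (d s : nat) (kappa : R)
    (S : set 'rV[R]_d) : Prop :=
  forall (x : 'rV[R]_d) (r : R), S x -> 0 < r <= diam S ->
    ((kappa^-1 * r ^+ s)%:E
       <= hausdorff s (S `&` eball x r))%E /\
    (hausdorff s (S `&` eball x r)
       <= (kappa * r ^+ s)%:E)%E.

(** Near each boundary point, in the direction of some unit vector [e], the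
    domain is the epigraph of a Lipschitz function [g] of the variables
    orthogonal to [e] (encoded as a function constant along [e]). *)
Definition lipschitz_domain (R : realType) (d : nat) (D : set 'rV[R]_d) : Prop :=
  forall x0, bdry D x0 ->
  exists (r : R) (e : 'rV[R]_d) (M : R) (g : 'rV[R]_d -> R),
  [/\ 0 < r, enorm e = 1,
      forall x y, `|g x - g y| <= M * enorm (x - y),
      forall x t, g (x + t *: e) = g x &
      forall x, enorm (x - x0) < r -> (D x <-> g x < dotv x e)].

Definition unit_itv (R : realType) : set R := [set t | 0 <= t <= 1].

Definition simply_connected (R : realType) (d : nat) (D : set 'rV[R]_d) : Prop :=
  D !=set0 /\ connected D /\
  forall c : R -> 'rV[R]_d,
    {within @unit_itv R, continuous c} -> c @` @unit_itv R `<=` D ->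
    c 0 = c 1 ->
    exists G : R * R -> 'rV[R]_d,
    [/\ {within @unit_itv R `*` @unit_itv R, continuous G},
        G @` (@unit_itv R `*` @unit_itv R) `<=` D,
        forall t, unit_itv t -> G (0, t) = c t /\ G (1, t) = c 0 &
        forall s, unit_itv s -> G (s, 0) = c 0 /\ G (s, 1) = c 0].

Definition bounded_dom (R : realType) (d : nat) (D : set 'rV[R]_d) : Prop :=
  exists M : R, forall x, D x -> enorm x <= M.

Definition admissible_domain (R : realType) (d : nat) (D : set 'rV[R]_d) : Prop :=
  [/\ open D, bounded_dom D, simply_connected D & lipschitz_domain D].

Definition monom (R : realType) (d m : nat) (a : {ffun 'I_d -> 'I_m}) :
    'rV[R]_d -> R := fun x => \prod_k x 0 k ^+ a k.

(** Degree at most p in each variable. *)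
Definition isQ (R : realType) (d p : nat) (q : 'rV[R]_d -> R) : Prop :=
  exists c : {ffun 'I_d -> 'I_p.+1} -> R,
    forall x, q x = \sum_a c a * monom a x.

(** Total degree at most p. *)
Definition isP (R : realType) (d p : nat) (q : 'rV[R]_d -> R) : Prop :=
  exists c : {ffun 'I_d -> 'I_p.+1} -> R,
    forall x, q x = \sum_(a : {ffun 'I_d -> 'I_p.+1} | (\sum_k a k <= p)%N) c a * monom a x.

(** Rodrigues' formula. *)
Definition legendre (R : realType) (p : nat) : {poly R} :=
  (2 ^+ p * p`!%:R)^-1 *: (('X^2 - 1) ^+ p)^`(p).

(** The p+1 GLL points on [-1, 1], in increasing order: -1, 1, and the zeros of
    the derivative of the Legendre polynomial of degree p. *)
Definition gll (R : realType) (p : nat) : seq R :=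
  rootsR ((1 - 'X^2) * (legendre R p)^`()).

Definition gll_pt (R : realType) (d p : nat) (a : {ffun 'I_d -> 'I_p.+1}) :
    'rV[R]_d := \row_k (gll R p)`_(a k).

Definition ref_cell (R : realType) (d : nat) : set 'rV[R]_d :=
  [set x | forall k, -1 < x 0 k < 1].

Definition ref_cellc (R : realType) (d : nat) : set 'rV[R]_d :=
  [set x | forall k, -1 <= x 0 k <= 1].

Definition sgnb (R : realType) (b : bool) : R := if b then 1 else -1.

(** The closed face of the reference cell on which the k-th coordinate is fixed
    to the sign [b] whenever [f k = Some b], and its vertices. *)
Definition ref_face (R : realType) (d : nat) (f : {ffun 'I_d -> option bool}) :
    set 'rV[R]_d :=
  [set x | ref_cellc x /\ forall k b, f k = Some b -> x 0 k = sgnb R b].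

Definition ref_face_vertices (R : realType) (d : nat)
    (f : {ffun 'I_d -> option bool}) : set 'rV[R]_d :=
  [set x | ref_face f x /\ forall k, exists b, x 0 k = sgnb R b].

Definition face_dim (d : nat) (f : {ffun 'I_d -> option bool}) : nat :=
  #|[set k | f k == None]|.

(** The mesh cells are the images of the open reference cell under the geometry
    maps. *)
Record mesh (R : realType) (d : nat) := Mesh {
  ncell : nat;
  geo : 'I_ncell -> 'rV[R]_d -> 'rV[R]_d }.

Definition cell (R : realType) (d : nat) (T : mesh R d) (j : 'I_(ncell T)) :
    set 'rV[R]_d := geo j @` @ref_cell R d.

Definition mesh_size (R : realType) (d : nat) (T : mesh R d) : R :=
  \big[Num.max/0]_(j < ncell T) diam (cell j).

Definition multilinear_geo (R : realType) (d : nat) (T : mesh R d) : Prop :=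
  forall (j : 'I_(ncell T)) (k : 'I_d), isQ 1 (fun x => geo j x 0 k).

(** Two closed cells are disjoint or share exactly a common face (vertex, edge,
    quadrilateral) of both. *)
Definition conforming (R : realType) (d : nat) (T : mesh R d) : Prop :=
  forall i j : 'I_(ncell T), i != j ->
    closure (cell i) `&` closure (cell j) = set0 \/
    exists f g : {ffun 'I_d -> option bool},
    [/\ face_dim f = face_dim g, (face_dim f < d)%N,
        closure (cell i) `&` closure (cell j) = geo i @` @ref_face R d f,
        closure (cell i) `&` closure (cell j) = geo j @` @ref_face R d g &
        geo i @` @ref_face_vertices R d f = geo j @` @ref_face_vertices R d g].

(** Uniform bounds on the singular values of the Jacobian of the geometry map,
    relative to the cell diameter. *)
Definition shape_regular (R : realType) (d : nat) (sigma : R) (T : mesh R d) :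
    Prop :=
  forall (j : 'I_(ncell T)) (x v : 'rV[R]_d), ref_cellc x ->
    sigma^-1 * diam (cell j) * enorm v <= enorm ('D_v (geo j) x)
      <= sigma * diam (cell j) * enorm v.

Definition quasi_uniform (R : realType) (d : nat) (gamma : R) (T : mesh R d) :
    Prop :=
  forall j : 'I_(ncell T), mesh_size T <= gamma * diam (cell j).

Definition admissible_mesh (R : realType) (d : nat) (Omega : set 'rV[R]_d)
    (sigma gamma : R) (T : mesh R d) : Prop :=
  [/\ forall j : 'I_(ncell T),
        {in @ref_cellc R d &, injective (geo j)},
      forall i j : 'I_(ncell T), i != j -> cell i `&` cell j = set0,
      \bigcup_(j in [set: 'I_(ncell T)]) closure (cell j) = closure Omega,
      conforming T &
      shape_regular sigma T /\ quasi_uniform gamma T].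

Section FiniteElements.
Variables (R : realType) (d : nat) (Omega : set 'rV[R]_d) (T : mesh R d).
Variable p : nat.

(** Continuous mapped Q^p elements on the closure of Omega (extended by 0 to
    R^d), without boundary condition. *)
Definition fe_space : set ('rV[R]_d -> R) :=
  [set u | [/\ {within closure Omega, continuous u},
               forall x, ~ closure Omega x -> u x = 0 &
               forall j : 'I_(ncell T), exists q, isQ p q /\
                 forall x, ref_cell x -> u (geo j x) = q x]].

Definition V_space : set ('rV[R]_d -> R) :=
  [set u | fe_space u /\ forall x, bdry Omega x -> u x = 0].

Definition support_pts : {fset 'rV[R]_d} :=
  [fset geo z.1 (gll_pt R z.2)
  | z in [set: 'I_(ncell T) * {ffun 'I_d -> 'I_p.+1}]%SET]%fset.

(** Support points off the boundary, i.e. the degrees of freedom of [V_space]. *)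
Definition interior_pts : {fset 'rV[R]_d} :=
  [fset x in support_pts | `[< ~ bdry Omega x >]]%fset.

Definition ndof : nat := #|` interior_pts |.

Definition dof (k : 'I_ndof) : 'rV[R]_d := (interior_pts : seq _)`_k.

(** The nodal basis function of a support point, no boundary condition
    imposed. *)
Definition phi (x : 'rV[R]_d) : 'rV[R]_d -> R :=
  get [set u | [/\ fe_space u, u x = 1 &
                   forall y, y \in support_pts -> y != x -> u y = 0]].

Definition coords (v : 'rV[R]_d -> R) : 'cV[R]_ndof := \col_k v (dof k).

Definition realize (c : 'cV[R]_ndof) : 'rV[R]_d -> R :=
  fun x => \sum_k c k 0 * phi (dof k) x.

(** Finite element functions are smooth inside the cells, and the cells cover
    Omega up to a null set; hence this is the integral over Omega of the scalar
    product of the (weak) gradients. *)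
Definition energy (u v : 'rV[R]_d -> R) : R :=
  leb_int (\bigcup_(j in [set: 'I_(ncell T)]) cell j)
    (fun x => \sum_k partial k u x * partial k v x).

Definition energy_norm (v : 'rV[R]_d -> R) : R := Num.sqrt (energy v v).

(** The norm, induced by the energy norm, of the operator on [V_space] with
    matrix [M] in the nodal basis. *)
Definition energy_opnorm (M : 'M[R]_ndof) : R :=
  sup [set energy_norm (realize (M *m coords v))
      | v in [set v | V_space v /\ energy_norm v <= 1]].

Definition stiffness : 'M[R]_ndof :=
  \matrix_(k, l) energy (phi (dof l)) (phi (dof k)).

Definition diag_stiffness : 'M[R]_ndof :=
  diag_mx (\row_k stiffness k k).

(** The quadratic form v |-> (M v, v) on [V_space]. *)
Definition qform (M : 'M[R]_ndof) (v : 'rV[R]_d -> R) : R :=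
  ((coords v)^T *m M *m coords v) 0 0.

Definition interpV (w : 'rV[R]_d -> R) : 'rV[R]_d -> R := realize (coords w).

End FiniteElements.

Definition spectral_radius (R : realType) (n : nat) (M : 'M[R]_n) : R :=
  sup [set ComplexField.Normc.normc z | z in
       [set z : R[i] | eigenvalue (map_mx (real_complex R) M) z]].

Record hierarchy (R : realType) (d : nat) := Hierarchy {
  nbox : nat;
  box_lo : 'I_nbox -> 'rV[R]_d;
  box_hi : 'I_nbox -> 'rV[R]_d;
  owned : 'I_nbox -> {fset 'rV[R]_d} }.

Section Agglomerates.
Variables (R : realType) (d : nat) (Omega : set 'rV[R]_d) (T : mesh R d).
Variables (p : nat) (B : hierarchy R d).

Definition box (i : 'I_(nbox B)) : set 'rV[R]_d :=
  [set x | forall k, box_lo i 0 k <= x 0 k <= box_hi i 0 k].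

Definition box_vol (i : 'I_(nbox B)) : R :=
  \prod_k (box_hi i 0 k - box_lo i 0 k).

Definition owns_support_pts : Prop :=
  [/\ forall i (x : 'rV[R]_d), x \in owned i -> box i x,
      forall i j (x : 'rV[R]_d), x \in owned i -> x \in @owned R d B j -> i = j &
      forall x, x \in support_pts T p <-> exists i : 'I_(nbox B), x \in owned i].

(** The open region covered by a set of cells (interfaces between its cells
    included). *)
Definition region (S : set 'I_(ncell T)) : set 'rV[R]_d :=
  interior (\bigcup_(j in S) closure (cell j)).

Definition agg_cells (i : 'I_(nbox B)) : set 'I_(ncell T) :=
  [set j | exists2 x, x \in owned i & closure (cell j) x].

Definition layer_cells (i : 'I_(nbox B)) : set 'I_(ncell T) :=
  [set j | agg_cells i j /\
     exists a : {ffun 'I_d -> 'I_p.+1}, geo j (gll_pt R a) \notin owned i].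

Definition core_cells (i : 'I_(nbox B)) : set 'I_(ncell T) :=
  agg_cells i `\` layer_cells i.

Definition agg i := region (agg_cells i).
Definition agg_layer i := region (layer_cells i).
Definition agg_core i := region (core_cells i).

Definition agg_size : R := \big[Num.max/0]_(i < nbox B) diam (agg i).

Definition max_owned : nat := \max_(i < nbox B) #|` owned i |.

(** The core and m layers of cells of the agglomerate around it; cells are
    neighbours when their closures meet. *)
Fixpoint layered_cells (i : 'I_(nbox B)) (m : nat) : set 'I_(ncell T) :=
  match m with
  | 0 => core_cells i
  | m'.+1 => [set j | agg_cells i j /\
      exists2 k, layered_cells i m' k &
        closure (cell j) `&` closure (cell k) !=set0]
  end.

Definition poincare (kappa H : R) (D : set 'rV[R]_d) : Prop :=
  forall v g, H1_grad D v g ->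
    l2norm D (fun x => v x - leb_int D v / fine (leb_meas D))
      <= kappa * H * H1_semi D g.

Definition poly_approx (kappa H : R) (D : set 'rV[R]_d) : Prop :=
  forall v g, H1_grad D v g ->
    (exists c : R, l2norm D (fun x => v x - c) <= kappa * H * H1_semi D g) /\
    forall r : nat, (1 <= r)%N -> exists2 q, isP r q &
      l2norm D (fun x => v x - q x) <= kappa * H * r%:R^-1 * H1_semi D g.

Definition proper_box (kappa : R) (i : 'I_(nbox B)) : Prop :=
  (forall k, box_lo i 0 k < box_hi i 0 k) /\
  forall k l, box_hi i 0 k - box_lo i 0 k
                <= kappa * (box_hi i 0 l - box_lo i 0 l).

Definition good_core (kappa : R) (i : 'I_(nbox B)) : Prop :=
  [/\ connected (agg_core i),
      ((kappa^-1 * box_vol i)%:E <= leb_meas (agg_core i))%E,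
      poincare kappa (diam (agg i)) (agg_core i) &
      poly_approx kappa (diam (agg i)) (agg_core i)].

Definition thin_layer (kappa : R) (i : 'I_(nbox B)) : Prop :=
  exists2 m : nat, m%:R <= kappa & layer_cells i `<=` layered_cells i m.

Definition bounded_overlap (kappa : R) : Prop :=
  forall x, #|[set i | `[< agg_layer i x >]]%SET|%:R <= kappa.

Definition regular_layer_bdry (kappa : R) (i : 'I_(nbox B)) : Prop :=
  [/\ ahlfors_regular d.-1 kappa (bdry (agg_layer i)),
      ((kappa^-1 * agg_size ^+ d.-1)%:E
         <= hausdorff d.-1 (bdry (agg_layer i)))%E &
      (hausdorff d.-1 (bdry (agg_layer i))
         <= (kappa * agg_size ^+ d.-1)%:E)%E].

Definition stable_sampling (kappa : R) (p' : nat) (i : 'I_(nbox B)) : Prop :=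
  forall q, isQ p' q -> forall x, box i x ->
    `|q x| <= kappa * \big[Num.max/0]_(y <- owned i) `|q y|.

Definition admissible_hierarchy (kappa : R) (p' : nat) : Prop :=
  [/\ owns_support_pts, bounded_overlap kappa, (p' <= p)%N &
      forall i, [/\ proper_box kappa i, good_core kappa i, thin_layer kappa i,
                    regular_layer_bdry kappa i & stable_sampling kappa p' i]].

(** Nodal interpolation into the span of the basis functions of the points
    owned by the i-th box. *)
Definition interp_loc (i : 'I_(nbox B)) (q : 'rV[R]_d -> R) : 'rV[R]_d -> R :=
  fun x => \sum_(y <- owned i) q y * phi Omega T p y x.

Definition coarse_loc (p' : nat) (i : 'I_(nbox B)) : set ('rV[R]_d -> R) :=
  [set interp_loc i q | q in isQ p'].

Definition coarse_space (p' : nat) : set ('rV[R]_d -> R) :=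
  [set v | exists w : 'I_(nbox B) -> 'rV[R]_d -> R,
     (forall i, coarse_loc p' i (w i)) /\
     v = (fun x => \sum_i interpV Omega T p (w i) x)].

(** [ic] is the matrix of the inclusion of the coarse space, with respect to
    some basis of the coarse space and the nodal basis. *)
Definition coarse_inclusion (p' r : nat) (ic : 'M[R]_(ndof Omega T p, r)) :
    Prop :=
  \rank ic = r /\
  [set realize (ic *m y) | y in [set: 'cV[R]_r]] = coarse_space p'.

End Agglomerates.

(** [A] and [S] are the matrices of the operator and of the smoother in the
    nodal basis, so that adjoints with respect to the Euclidean inner product
    are transposes. *)

Definition symmetrized (R : realType) (n : nat) (A S : 'M[R]_n) : 'M[R]_n :=
  S + S^T - S^T *m A *m S.

Definition two_level (R : realType) (n r : nat) (A S : 'M[R]_n)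
    (ic : 'M[R]_(n, r)) : 'M[R]_n :=
  let Ac := ic^T *m A *m ic in
  (1%:M - S *m A) *m (1%:M - ic *m invmx Ac *m ic^T *m A).

(* Main.v *)
Require Import Defs.
From HB Require Import structures.
From mathcomp Require Import all_boot all_order all_algebra finmap.
From mathcomp Require Import complex polyrcf.
From mathcomp Require Import all_classical all_reals all_analysis.
From mathcomp Require Import ring lra.

Set Implicit Arguments.
Unset Strict Implicit.
Unset Printing Implicit Defensive.

Import Order.TTheory GRing.Theory Num.Theory.
Import numFieldNormedType.Exports.
Local Open Scope classical_set_scope.
Local Open Scope ring_scope.

(** It suffices to approximate a finite element function [v] by coarse functions that are constant on the
    points owned by each box.  If [w] is the [A]-orthogonal complement of the coarse space in [v] and [v_c] such
    a coarse function, then [|w|_A^2 = (A w, w - v_c)], and Cauchy-Schwarz in the [Rbar] inner product bounds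
    this by [(Rbar A w, A w)^(1/2) (cD)^(1/2) |w - v_c|_D]; so [|w - v_c|_D^2 <= K |w|_A^2] gives
    [|E v|_A^2 = |w|_A^2 - (Rbar A w, A w) <= (1 - 1 / (cD K)) |v|_A^2].

    For the last estimate, the diagonal entries are at most [C p^4 h^(d-2)] by Markov's inequality and
    Fejer's bound [\sum_i l_i^2 <= 1] for the GLL basis, and the oscillation of [v] over a cell satisfies
    [osc^2 h^(d-2) <= C p^(2d) |v|_{H^1(cell)}^2], because the gradient stays comparable to its maximum on a cube
    of side of order [h / p^2].  The cells of an agglomerate, at most [C L] of them, are linked by paths of
    neighbours (the core by connectedness, the layers by definition), so the oscillations add up to
    [K = C L^2 p^(2d+4)].

    That the nodal basis lies in [V] needs two geometric facts.  The parametrisations of a common face by two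
    cells agree up to a signed permutation of the coordinates, so nodal values glue continuously.  And a basis
    function of a node inside [Omega] vanishes on the boundary: the tangent cones of the cells around a point of
    an open face depend continuously on the point, so if they fill the space at one point of the face they do so
    at each, which the exterior cone of a Lipschitz domain excludes at a boundary point. *)

(** * Polynomials in one variable *)

(** [phi] is defined by choice, so nothing is known about it until one function with the required
    nodal values has been built; gluing across common faces therefore has to be settled before any
    estimate. Membership in [V_space] matters because the smoothing hypothesis is stated for that
    space only, and because positive definiteness of the stiffness matrix comes from following a ray
    to the boundary, where the function must vanish.

    The geometry maps have no explicit inverse. Its regularity is extracted from Taylor's formula
    and the singular value bounds, with radii measured in the reference cell, so that the constants
    depend on [d], [sigma] and [gamma] only.

    Cutting a piecewise constant off at the boundary is free: the norm of [D] sees only the nodes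
    that are degrees of freedom. The power [h^(d-2)] of the diagonal entries cancels against the
    same power in the oscillation estimate, so neither [h] nor [H] occurs in [K]. The claimed
    denominator is at least a constant times [cD K], since [L] and [p] are at least 1 and [H / h] is
    at least [1 / gamma]. *)

Section Lagrange.
Variables (F : fieldType) (n : nat) (x : 'I_n -> F).

Definition lag (i : 'I_n) : {poly F} :=
  \prod_(j | j != i) ((x i - x j)^-1 *: ('X - (x j)%:P)).

Lemma size_lag i : (size (lag i) <= n)%N.
Proof.
apply: leq_trans (size_poly_prod_leq _ _) _ => /=.
rewrite leq_subLR.
have h : (\sum_(j < n | j != i) size ((x i - x j)^-1 *: ('X - (x j)%:P)) <=
   \sum_(j < n | j != i) 2)%N.
  by apply: leq_sum => j _; rewrite (leq_trans (size_scale_leq _ _)) ?size_XsubC.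
have hc : #|(fun j : 'I_n => j != i)| = n.-1.
  by rewrite -[in RHS](card_ord n) -(cardC1 i); apply: eq_card.
have n0 : (0 < n)%N by apply: leq_trans (ltn_ord i).
apply: leq_ltn_trans h _; rewrite sum_nat_const hc muln2 -addnn ltn_add2l.
by rewrite prednK.
Qed.

Hypothesis x_inj : injective x.

Lemma lag_node i j : (lag i).[x j] = (i == j)%:R.
Proof.
rewrite /lag horner_prod; case: eqVneq => [<-|ij].
  rewrite big1// => l li; rewrite hornerZ hornerXsubC mulVf//.
  by rewrite subr_eq0 (inj_eq x_inj) eq_sym.
rewrite (bigD1 j) 1?eq_sym//= hornerZ hornerXsubC subrr mulr0 mul0r//.
Qed.

Lemma lag_interp (q : {poly F}) : (size q <= n)%N ->
  q = \sum_i q.[x i] *: lag i.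
Proof.
move=> sq; apply/eqP; rewrite -subr_eq0; apply/eqP.
apply: (@roots_geq_poly_eq0 _ _ (codom x)).
- apply/allP => _ /codomP[j ->]; rewrite rootE hornerD hornerN horner_sum.
  rewrite (bigD1 j)//= big1 => [|i ij].
    by rewrite hornerZ lag_node eqxx mulr1 addr0 subrr.
  by rewrite hornerZ lag_node (negPf ij) mulr0.
- by rewrite map_inj_uniq ?enum_uniq.
- rewrite size_codom card_ord (leq_trans (size_polyD _ _))// geq_max sq size_polyN.
  apply: (leq_trans (size_sum _ _ _)); apply/bigmax_leqP => i _.
  by rewrite (leq_trans (size_scale_leq _ _))// size_lag.
Qed.

End Lagrange.

(** * Markov's inequality from Chebyshev polynomials *)

Section Markov.
Variable R : realType.
Implicit Types (P : {poly R}).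

(** Consecutive Chebyshev polynomials of the first kind, carried as a pair so that the two-term
    recurrence becomes structural. *)
Fixpoint cheb2 (n : nat) : {poly R} * {poly R} :=
  if n is m.+1 then
    let: (a, b) := cheb2 m in (b, 2 *: 'X * b - a)
  else (1, 'X).

Definition cheb n := (cheb2 n).1.

Lemma chebSS n : cheb n.+2 = 2 *: 'X * cheb n.+1 - cheb n.
Proof. by rewrite /cheb /=; case: (cheb2 n). Qed.

Lemma cheb_ind (Q : nat -> Prop) :
  Q 0%N -> Q 1%N -> (forall n, Q n -> Q n.+1 -> Q n.+2) -> forall n, Q n.
Proof.
move=> h0 h1 h2 n; suff: Q n /\ Q n.+1 by case.
by elim: n => [//|n [ih1 ih2]]; split=> //; apply: h2.
Qed.

Lemma cheb_cos n (t : R) : (cheb n).[cos t] = cos (t *+ n).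
Proof.
elim/cheb_ind: n => [||n h0 h1].
- by rewrite hornerE cos0.
- by rewrite hornerE.
rewrite chebSS !hornerE h0 h1.
have -> : t *+ n.+2 = t *+ n.+1 + t by rewrite mulrSr.
have -> : t *+ n = t *+ n.+1 - t by rewrite mulrSr addrK.
by rewrite cosB cosD; ring.
Qed.

Lemma cheb1 n : (cheb n).[1] = 1.
Proof.
elim/cheb_ind: n => [||n h0 h1]; [by rewrite hornerE..|].
by rewrite chebSS !hornerE h0 h1; ring.
Qed.

Lemma size_cheb n : (size (cheb n) <= n.+1)%N.
Proof.
elim/cheb_ind: n => [||n h0 h1]; [by rewrite size_polyC oner_eq0|by rewrite size_polyX|].
rewrite chebSS.
rewrite (leq_trans (size_polyD _ _))// geq_max size_polyN; apply/andP; split.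
  rewrite -scalerAl (leq_trans (size_scale_leq _ _))//.
  by rewrite (leq_trans (size_polyMleq _ _))// size_polyX.
by rewrite (leq_trans h0)// ltnW.
Qed.

Lemma deriv_cheb1 n : (cheb n)^`().[1] = n%:R ^+ 2.
Proof.
elim/cheb_ind: n => [||n h0 h1].
- by rewrite derivC hornerE expr0n.
- by rewrite derivX hornerE expr1n.
rewrite chebSS derivB derivM derivZ derivX !hornerE h0 h1 cheb1.
by rewrite -addn2 -addn1 !natrD; ring.
Qed.

(** The product rule mixes values and derivatives, so both signs are carried through the induction
    at once. *)
Lemma deriv_prod_ge0 (I : finType) (A : pred I) (c y : I -> R) :
  (forall i, A i -> 0 <= c i) -> (forall i, A i -> y i <= 1) ->
  0 <= (\prod_(i | A i) (c i *: ('X - (y i)%:P))).[1] /\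
  0 <= ((\prod_(i | A i) (c i *: ('X - (y i)%:P)))^`()).[1].
Proof.
move=> hc hy; elim/big_ind: _ => [|P Q [P0 P1] [Q0 Q1]|i Ai].
- by rewrite derivC !hornerE.
- by rewrite derivM !hornerE; split; [exact: mulr_ge0|apply: addr_ge0; exact: mulr_ge0].
- rewrite derivZ derivXsubC !hornerE; split; last exact: hc.
  by rewrite mulr_ge0 ?hc// subr_ge0 hy.
Qed.

(** Lagrange interpolation at the extrema of the Chebyshev polynomial [T] of degree [p]. The
    derivatives at 1 of the basis polynomials have the same signs as the values of [T] at the nodes,
    so their absolute values add up to [T'(1) = p^2], while each value of [P] is at most [M]. *)
Lemma markov_end p P (M : R) : (size P <= p.+1)%N ->
  (forall x : R, -1 <= x <= 1 -> `|P.[x]| <= M) -> `|P^`().[1]| <= p%:R ^+ 2 * M.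
Proof.
case: p => [|p] sP PM.
  have -> : P^`() = 0 by rewrite (size1_polyC sP) derivC.
  by rewrite horner0 normr0 expr0n mul0r.
pose n := p.+1.
(* The angles decrease with [j], so that the nodes [y j] increase. *)
pose th (j : 'I_n.+1) : R := pi * (1 - j%:R / n%:R).
pose y j := cos (th j).
have n0 : n%:R != 0 :> R by rewrite pnatr_eq0.
have th_in j : 0 <= th j <= pi.
  have : j%:R / n%:R <= 1 :> R.
    by rewrite ler_pdivrMr ?mul1r ?ltr0n// ler_nat -ltnS.
  have : 0 <= j%:R / n%:R :> R by rewrite divr_ge0.
  have := pi_ge0 R; rewrite /th; set a := _ / _; set b := pi => h1 h2 h3.
  by apply/andP; split; nra.
have y_lt (i j : 'I_n.+1) : (i < j)%N -> y i < y j.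
  move=> ij; rewrite ltr_cos ?in_itv//= /th ltr_pM2l ?pi_gt0//.
  by rewrite ltrD2l ltrN2 ltr_pM2r ?ltr_nat// invr_gt0 ltr0n.
have y_inj : injective y.
  move=> i j yij; apply/val_inj; case: (ltngtP i j) => // /y_lt; rewrite yij ltxx//.
have y_le j : y j <= 1 by exact: cos_le1.
have y_in j : -1 <= y j <= 1 by rewrite y_le cos_geN1.
have chy j : (cheb n).[y j] = (-1) ^+ (n - j).
  rewrite cheb_cos; have -> : th j *+ n = pi *+ (n - j).
    have jn : (j <= n)%N by rewrite -ltnS.
    rewrite -mulr_natr -[RHS]mulr_natr /th (natrB _ jn).
    by rewrite -mulrA mulrBl mul1r mulfVK.
  by elim: (n - j)%N => [|k ih]; rewrite ?cos0// mulrSr cosDpi ih exprSr mulrN1.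
(* Of the factors [y j - y l], exactly the [n - j] with [j < l] are negative. Distributing the sign
   over them leaves linear factors with nonnegative slopes and roots at most 1. *)
have sgn (j : 'I_n.+1) : (-1) ^+ (n - j) = \prod_(l | l != j) (if (j < l)%N then -1 else 1) :> R.
  rewrite -big_mkcondr/= prodr_const; congr (_ ^+ _).
  have -> : #|[pred l | l != j & (j < l)%N]| = #|[pred l : 'I_n.+1 | (j < l)%N]|.
    by apply: eq_card => l; rewrite !inE; apply: andb_idl => jl; apply: contraTN jl => /eqP->; rewrite ltnn.
  rewrite -sum1_card big_mkcond/= -(big_mkord xpredT (fun l => if (j < l)%N then 1%N else 0%N)).
  have jn : (j.+1 <= n.+1)%N by [].
  rewrite (@big_cat_nat _ _ _ j.+1)//= big_nat big1 ?add0n => [|l]; last by case/andP=> _; rewrite ltnS leqNgt => /negPf->.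
  rewrite big_nat (eq_bigr (fun=> 1%N)) => [|l /andP[-> _]//].
  by rewrite -big_nat sum_nat_const_nat muln1 subSS.
have pos (j : 'I_n.+1) : 0 <= ((-1) ^+ (n - j) *: lag y j)^`().[1].
  have -> : (-1) ^+ (n - j) *: lag y j =
    \prod_(l | l != j) (((if (j < l)%N then -1 else 1) * (y j - y l)^-1) *: ('X - (y l)%:P)).
    rewrite sgn /lag -mul_polyC rmorph_prod -big_split/=.
    by apply: eq_bigr => l _; rewrite mul_polyC scalerA.
  apply: (proj2 (deriv_prod_ge0 _ _)) => l lj //.
  case: (ltngtP j l) lj => [jl _|lj _|/val_inj->]; last by rewrite eqxx.
    by rewrite mulN1r -invrN opprB invr_ge0 subr_ge0 ltW// y_lt.
  by rewrite mul1r invr_ge0 subr_ge0 ltW// y_lt.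
have dT : p.+1%:R ^+ 2 = \sum_(j < n.+1) ((-1) ^+ (n - j) *: lag y j)^`().[1].
  rewrite -deriv_cheb1 [X in X^`()](lag_interp y_inj (size_cheb n)) raddf_sum horner_sum.
  by apply: eq_bigr => j _; rewrite chy.
rewrite dT [P](lag_interp y_inj sP) raddf_sum horner_sum mulr_suml.
apply: le_trans (ler_norm_sum _ _ _) _; apply: ler_sum => j _.
rewrite -(ger0_norm (pos j)) derivZ !hornerZ !normrM normrX normrN1 expr1n mul1r mulrC.
rewrite [X in `|X.[1]|]derivZ hornerZ normrM mulrC.
by rewrite mulrC; apply: ler_wpM2r => //; apply: PM.
Qed.

(** For [x >= 0] the endpoint bound is applied to [P] composed with the affine map of [[-1, 1]] onto
    [[-1, x]], whose slope [(x + 1) / 2] is at least [1 / 2]; this is the factor 2. Negative [x]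
    follow by reflection. *)
Lemma markov p P (M : R) : (size P <= p.+1)%N ->
  (forall x : R, -1 <= x <= 1 -> `|P.[x]| <= M) ->
  forall x : R, -1 <= x <= 1 -> `|P^`().[x]| <= 2 * p%:R ^+ 2 * M.
Proof.
wlog pos : P / forall Q : {poly R}, (size Q <= p.+1)%N ->
  (forall x : R, -1 <= x <= 1 -> `|Q.[x]| <= M) ->
  forall x : R, 0 <= x <= 1 -> `|Q^`().[x]| <= 2 * p%:R ^+ 2 * M.
  apply=> // Q sQ QM x /andP[x0 x1].
  pose a := (x + 1) / 2; pose L := a *: 'X + (x - a)%:P.
  have sL : (size L <= 2)%N.
    rewrite (leq_trans (size_polyD _ _))// geq_max (leq_trans (size_scale_leq _ _)) ?size_polyX//=.
    by rewrite (leq_trans (size_polyC_leq1 _)).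
  have : `|(Q \Po L)^`().[1]| <= p%:R ^+ 2 * M.
    apply: markov_end.
      apply: leq_trans (size_comp_poly_leq _ _) _; rewrite ltnS.
      have s1 : ((size L).-1 <= 1)%N by move: sL; case: (size L).
      have s2 : ((size Q).-1 <= p)%N by move: sQ; case: (size Q).
      by rewrite -[p]muln1 leq_mul.
    move=> s /andP[s0 s1]; rewrite horner_comp; apply: QM; rewrite /L hornerD hornerZ hornerX hornerC.
    have a0 : 0 <= a by rewrite /a; lra.
    have h1 : 0 <= a * (s + 1) by apply: mulr_ge0 => //; lra.
    have h2 : 0 <= a * (1 - s) by apply: mulr_ge0 => //; lra.
    by move: h1 h2; rewrite /a => h1 h2; apply/andP; split; lra.
  rewrite deriv_comp hornerM horner_comp.
  have -> : L.[1] = x by rewrite /L hornerD hornerZ hornerX hornerC; ring.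
  have -> : L^`().[1] = a by rewrite /L derivD derivZ derivX derivC !hornerE.
  have a0 : 1 / 2 <= a by rewrite /a; lra.
  rewrite normrM (ger0_norm (_ : 0 <= a)) => [h|]; last by lra.
  by have := normr_ge0 Q^`().[x]; nra.
move=> sP PM x /andP[x0 x1]; have [x2|x2] := leP 0 x.
  by apply: pos => //; rewrite x2.
have := pos (P \Po - 'X); rewrite deriv_comp => h.
have {h} := h _ _ (- x).
rewrite hornerM horner_comp derivN derivX !hornerN hornerX hornerC opprK mulrN1 normrN.
apply.
- apply: leq_trans (size_comp_poly_leq _ _) _; rewrite size_polyN size_polyX muln1.
  by case: (size P) sP.
- move=> z /andP[z0 z1]; rewrite horner_comp hornerN hornerX; apply: PM.
  by apply/andP; split; lra.
- by apply/andP; split; lra.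
Qed.

End Markov.

(** * Gauss-Lobatto-Legendre nodes and Fejer's bound *)

Section GaussLobattoLegendre.
Variable R : realType.
Implicit Types (P : {poly R}) (s : seq R).

Lemma rolle_seq P a s : path <%R a s -> all (root P) (a :: s) ->
  exists t : seq R, [/\ size t = size s, sorted <%R t, all (root P^`()) t &
    forall x, x \in t -> a < x < last a s].
Proof.
elim: s a => [|b s IH] a /=; first by exists [::].
move=> /andP[ab pbs] /andP[ra /[dup] rbs /andP[rb _]].
have [t [st ts rt tin]] := IH b pbs rbs.
have [c] := poly_rolle ab (etrans (rootP ra) (esym (rootP rb))).
rewrite in_itv /= => /andP[ac cb] c0.
have bl : b <= last b s.
  have := pbs; rewrite (path_sortedE lt_trans) => /andP[/allP h _].
  by case: s {pbs rbs IH st ts rt tin} h => //= d s' h; rewrite ltW// h ?mem_last.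
exists (c :: t); split=> //=; first by rewrite st.
- rewrite (path_sortedE lt_trans) ts andbT; apply/allP => x /tin /andP[bx _].
  exact: lt_trans bx.
- by rewrite rt andbT; apply/rootP.
- move=> x; rewrite inE => /orP[/eqP->|/tin /andP[bx xl]].
    by rewrite ac (lt_le_trans cb).
  by rewrite xl andbT (lt_trans ac)// (lt_trans cb).
Qed.

Let u p : {poly R} := ('X^2 - 1) ^+ p.

Lemma deriv_u p n x : x ^+ 2 = 1 -> (n < p)%N -> root ((u p)^`(n)) x.
Proof.
move=> x1 np.
suff [q ->] : exists q : {poly R}, (u p)^`(n) = q * ('X^2 - 1) ^+ (p - n).
  by rewrite rootE hornerM horner_exp hornerD hornerXn hornerN hornerC x1 subrr expr0n subn_eq0 leqNgt np mulr0.
elim: n np => [|n IH] np; first by exists 1; rewrite subn0 mul1r.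
have [q e] := IH (ltnW np).
rewrite derivnS e -(subnSK (ltnW np)) derivM deriv_exp.
rewrite derivB derivXn derivC subr0 /=.
exists (q^`() * ('X^2 - 1) + q * ('X^1 *+ 2 *+ (p - n.+1).+1)).
by rewrite exprS; ring.
Qed.

Lemma size_u p : size (u p) = (2 * p).+1.
Proof.
have s2 : size ('X^2 - 1 : {poly R}) = 3%N by rewrite size_XnsubC.
by rewrite /u my_size_exp ?s2// -size_poly_eq0 s2.
Qed.

(** Below order [p] the derivatives still vanish at both endpoints, so with these each use of
    Rolle's theorem turns [n] interior roots into [n + 1]. *)
Lemma deriv_u_roots p n : (n <= p)%N -> exists s : seq R,
  [/\ size s = n, sorted <%R s, all (root ((u p)^`(n))) s & forall x, x \in s -> -1 < x < 1].
Proof.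
elim: n => [|n IH] np; first by exists [::].
have [s [ss sts rs ins]] := IH (ltnW np).
have [|| t [st tt rt tin]] := @rolle_seq ((u p)^`(n)) (-1) (rcons s 1).
- rewrite (path_sortedE lt_trans) all_rcons -andbA; apply/and3P; split.
  + by lra.
  + by apply/allP => x /ins /andP[].
  + rewrite (sorted_pairwise lt_trans) pairwise_rcons -(sorted_pairwise lt_trans) sts andbT.
    by apply/allP => x /ins /andP[].
- by rewrite /= all_rcons rs !deriv_u ?expr1n// sqrrN expr1n.
exists t; split=> //; first by rewrite st size_rcons ss.
by move=> x /tin; rewrite last_rcons.
Qed.

Lemma legendre_neq0 p : (2 ^+ p * p`!%:R)^-1 != 0 :> R.
Proof. by rewrite invr_eq0 mulf_neq0 ?expf_neq0 ?pnatr_eq0// -lt0n fact_gt0. Qed.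

Lemma size_legendre p : size (legendre R p) = p.+1.
Proof.
rewrite /legendre size_scale ?legendre_neq0//.
rewrite -[RHS]/((p.+1).-1.+1).
have := size_u p; rewrite /u => su.
have cf : ((('X^2 - 1) ^+ p)^`(p) : {poly R})`_p != 0.
  rewrite coef_derivn addnn -mul2n -[(2 * p)%N]/((2 * p).+1.-1) -su -lead_coefE.
  rewrite mulrn_eq0 negb_or lead_coef_eq0 -size_poly_eq0 su /=.
  by rewrite -lt0n ffact_gt0 mul2n -addnn leq_addr.
apply/anti_leq/andP; split.
  apply/leq_sizeP => j pj; rewrite coef_derivn nth_default ?mul0rn// su.
  by rewrite mul2n -addnn -addnS leq_add2l.
rewrite ltnNge; apply: contra cf => h; by rewrite nth_default.
Qed.

(** Legendre's equation in divergence form. With [u = (X^2 - 1)^p] it is the relation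
    [(X^2 - 1) u' = 2 p X u] differentiated [p + 1] times. *)
Lemma deriv_neg_legendre_ode p :
  ((1 - 'X^2) * (legendre R p)^`())^`() = - (p * p.+1)%:R *: legendre R p.
Proof.
pose U n := (u p)^`(n).
have e0 : ('X^2 - 1) * U 1%N = 'X * U 0%N *+ (2 * p).
  rewrite /U /u derivn1 derivn0 deriv_exp derivB derivXn derivC subr0.
  clear U; case: p => [|p]; first by rewrite muln0 !mulr0n mulr0.
  have -> : 'X^(2.-1) = 'X :> {poly R} by [].
  by rewrite (exprS _ p) mulrnA !mulrnAr !mulrnAl mulrnAr mulrCA.
have dU n : (U n)^`() = U n.+1 by rewrite /U derivnS.
have dw : ('X^2 - 1)^`() = 'X *+ 2 :> {poly R} by rewrite derivB derivXn derivC subr0.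
(* The identity [e0] differentiated [n + 1] times. *)
have e n : ('X^2 - 1) * U n.+2 + 'X * U n.+1 *+ (2 * n.+1) + U n *+ (n.+1 * n)
    = ('X * U n.+1 + U n *+ n.+1) *+ (2 * p).
  elim: n => [|n IH].
    have := congr1 (@deriv _) e0; rewrite derivM derivMn derivM dw derivX !dU mul1r.
    move: (U 0%N) (U 1%N) (U 2%N) => a b c.
    by rewrite muln1 muln0 mulr0n mulr1n addr0 (addrC ('X * b)) => <-; rewrite addrC mulrnAl.
  have := congr1 (@deriv _) IH.
  rewrite derivD derivD derivM dw derivMn derivM derivX !dU mul1r derivMn dU.
  rewrite derivMn derivD derivM derivX mul1r !dU derivMn dU.
  move: (U n.+1) (U n.+2) (U n.+3) => a b c.
  move: ('X^2 - 1 : {poly R}) ('X : {poly R}) => w x h.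
  apply/eqP; rewrite -subr_eq0; move/eqP: h; rewrite -subr_eq0 => /eqP h.
  by rewrite -[X in _ == X]h; apply/eqP; ring.
have ep := e p.
rewrite /legendre derivZ -scalerAr derivZ scalerA [in RHS]mulrC -[RHS]scalerA.
congr (_ *: _).
rewrite derivM derivB derivXn derivC sub0r -!derivnS -/(U p) -/(U p.+1) -/(U p.+2).
move: ep; move: (U p) (U p.+1) (U p.+2) => a b c ep.
have -> : 'X^(2.-1) = 'X :> {poly R} by [].
rewrite scaleNr scaler_nat -(opprB 'X^2).
move: ('X : {poly R}) ep => x ep.
have -> : - (x ^+ 2 - 1) * c = - ((x * b + a *+ p.+1) *+ (2 * p)
   - x * b *+ (2 * p.+1) - a *+ (p.+1 * p)) by rewrite -ep; ring.
by ring.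
Qed.

Section Nodes.
Variable p : nat.
Hypothesis p0 : (0 < p)%N.
Let P := legendre R p.
Let w : {poly R} := (1 - 'X^2) * P^`().

Let size_dP : size P^`() = p.
Proof.
by rewrite polyorder.size_deriv size_legendre.
Qed.

Let dP_neq0 : P^`() != 0.
Proof. by rewrite -size_poly_eq0 size_dP -lt0n. Qed.

Let size_q : size (1 - 'X^2 : {poly R}) = 3%N.
Proof. by rewrite -opprB size_polyN size_XnsubC. Qed.

Let size_w : size w = p.+2.
Proof. by rewrite size_mul// -?size_poly_eq0 size_q// size_dP addSn. Qed.

(** The Legendre polynomial has [p] roots inside the interval, so its derivative has [p - 1];
    together with the endpoints they exhaust the degree [p + 1] of [w], and [rootsR] finds nothing
    else. *)
Lemma gll_rcons : exists t : seq R, [/\ gll R p = -1 :: rcons t 1, size t = p.-1,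
  all (root (legendre R p)^`()) t & forall x, x \in t -> -1 < x < 1] /\
  sorted <%R (-1 :: rcons t 1).
Proof.
have [s [ss sts rs ins]] := deriv_u_roots (leqnn p).
have [t [st tt rt tin]] : exists t : seq R, [/\ size t = p.-1, sorted <%R t,
    all (root P^`()) t & forall x, x \in t -> -1 < x < 1].
  case: s ss sts rs ins => [p00|a s ss pa rs ins]; first by move: p0; rewrite -p00.
  have [t [h1 h2 h3 h4]] := rolle_seq pa rs.
  exists t; split=> //; first by rewrite h1 -ss.
    apply: sub_all h3 => x; rewrite /P /legendre derivZ !rootE hornerZ => /eqP ->.
    by rewrite mulr0.
  move=> x /h4 /andP[ax xl]; apply/andP; split.
    by apply: lt_trans ax; have /ins/andP[] : a \in a :: s by rewrite mem_head.
  by apply: lt_trans xl _; have /ins/andP[] := mem_last a s.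
have srt : sorted <%R (-1 :: rcons t 1).
  rewrite /= (path_sortedE lt_trans) all_rcons -andbA; apply/and3P; split.
  + by lra.
  + by apply/allP => x /tin /andP[].
  + rewrite (sorted_pairwise lt_trans) pairwise_rcons -(sorted_pairwise lt_trans) tt andbT.
    by apply/allP => x /tin /andP[].
exists t; split=> //; split=> //.
have w0 : w != 0 by rewrite -size_poly_eq0 size_w.
have rw : all (root w) (-1 :: rcons t 1).
  apply/allP => x; rewrite inE mem_rcons inE /w rootM => /or3P[/eqP->|/eqP->|xt].
  - by rewrite rootE hornerD hornerN hornerXn hornerC sqrrN expr1n subrr eqxx.
  - by rewrite rootE hornerD hornerN hornerXn hornerC expr1n subrr eqxx.
  - by rewrite (allP rt)// orbT.
have uq : uniq (-1 :: rcons t 1) by exact: lt_sorted_uniq.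
apply: (irr_sorted_eq lt_trans ltxx) => //; first exact: sorted_roots.
move=> x; rewrite -roots_on_rootsR// in_itv/=.
apply/idP/idP => [rx|]; last exact: (allP rw).
apply: contraT => nx.
have := @max_poly_roots _ w (x :: -1 :: rcons t 1) w0.
have h1 : all (root w) (x :: -1 :: rcons t 1) by apply/andP.
have h2 : uniq (x :: -1 :: rcons t 1) by rewrite cons_uniq nx uq.
by move=> /(_ h1 h2); rewrite size_w /= size_rcons st prednK// ltnn.
Qed.

Lemma size_gll : size (gll R p) = p.+1.
Proof. by have [t [[-> st _ _] _]] := gll_rcons; rewrite /= size_rcons st prednK. Qed.

Lemma sorted_gll : sorted <%R (gll R p).
Proof. by have [t [[-> ]]] := gll_rcons. Qed.

Definition glln (i : 'I_p.+1) : R := (gll R p)`_i.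

Lemma glln_inj : injective glln.
Proof.
move=> i j /eqP; rewrite nth_uniq ?size_gll ?ltn_ord ?(lt_sorted_uniq sorted_gll)//.
by move/eqP/val_inj.
Qed.

Lemma glln_itv i : -1 <= glln i <= 1.
Proof.
have [t [[e st _ tin] _]] := gll_rcons.
have : glln i \in gll R p by rewrite mem_nth// size_gll.
rewrite e inE mem_rcons inE => /or3P[/eqP->|/eqP->|/tin/andP[a b]]; last by rewrite !ltW.
- by apply/andP; split; lra.
- by apply/andP; split; lra.
Qed.

Lemma glln0 : glln ord0 = -1.
Proof. by rewrite /glln; have [t [[-> _ _ _] _]] := gll_rcons. Qed.

Lemma glln_max : glln ord_max = 1.
Proof.
rewrite /glln; have [t [[-> st _ _] _]] := gll_rcons.
have -> : nat_of_ord (@ord_max p) = (p.-1).+1 by rewrite prednK.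
by rewrite /= nth_rcons st ltnn eqxx.
Qed.

Lemma glln_root i : root w (glln i).
Proof.
have w0 : w != 0 by rewrite -size_poly_eq0 size_w.
have : glln i \in gll R p by rewrite mem_nth// size_gll.
by rewrite /gll -/P -/w -roots_on_rootsR// => /andP[].
Qed.

Lemma legendre_comp_oppX : legendre R p \Po - 'X = (-1) ^+ p *: legendre R p.
Proof.
have h n (q : {poly R}) : (q \Po - 'X)^`(n) = (-1) ^+ n *: (q^`(n) \Po - 'X).
  elim: n => [|n IH]; first by rewrite expr0 scale1r.
  rewrite derivnS IH derivZ deriv_comp derivN derivX mulrN1 exprSr -scalerA scaleN1r.
  by rewrite derivnS.
have e : ('X^2 - 1 : {poly R}) ^+ p \Po - 'X = ('X^2 - 1) ^+ p.
  by rewrite rmorphXn /= rmorphB /= rmorphXn /= comp_polyX sqrrN comp_polyC.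
have := h p (('X^2 - 1) ^+ p).
rewrite e => e2; rewrite /legendre comp_polyZ [in RHS]e2.
by rewrite !scalerA -mulrA [_ * (-1) ^+ p]mulrC !mulrA -expr2 sqrr_sign mul1r.
Qed.

(** Parity of the Legendre polynomial makes the nodes symmetric about 0. This lets two cells that
    run through a common face in opposite directions share their nodes. *)
Lemma glln_rev i : glln (rev_ord i) = - glln i.
Proof.
have w0 : w != 0 by rewrite -size_poly_eq0 size_w.
have dsym x : P^`().[- x] = 0 <-> P^`().[x] = 0.
  have e : P \Po - 'X = (-1) ^+ p *: P by exact: legendre_comp_oppX.
  move: P e => Q e.
  have := congr1 (@deriv _) e; rewrite deriv_comp derivN derivX mulrN1 derivZ.
  move/(congr1 (fun q => q.[x])); rewrite hornerN horner_comp hornerN hornerX hornerZ => e2.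
  split=> h; move: e2; rewrite h ?oppr0 ?mulr0.
    by move/esym/eqP; rewrite mulf_eq0 signr_eq0/= => /eqP.
  by move/eqP; rewrite oppr_eq0 => /eqP.
have rsym x : root w (- x) = root w x.
  rewrite /w !rootM; congr (_ || _).
    by rewrite !rootE !hornerD !hornerN !hornerXn !hornerC sqrrN.
  by apply/rootP/rootP => /dsym.
have e : [seq - x | x <- rev (gll R p)] = gll R p.
  apply: (irr_sorted_eq lt_trans ltxx); last 2 first.
  - exact: sorted_gll.
  - move=> x; rewrite -[x in LHS]opprK mem_map; last exact: oppr_inj.
    by rewrite mem_rev /gll -/P -/w -!roots_on_rootsR// !in_itv/= rsym.
  rewrite sorted_map rev_sorted; apply: sub_sorted sorted_gll => x y /= xy.
  by rewrite ltrN2.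
rewrite /glln -{1}e (nth_map 0) ?size_rev ?size_gll ?ltn_ord//.
rewrite nth_rev ?size_gll ?ltn_ord// subSS /=.
by rewrite subSS subKn// -ltnS.
Qed.

Definition lgll (i : 'I_p.+1) : {poly R} := lag glln i.

Lemma size_lgll i : (size (lgll i) <= p.+1)%N.
Proof. exact: size_lag. Qed.

Lemma lgll_node i j : (lgll i).[glln j] = (i == j)%:R.
Proof. exact: lag_node glln_inj _ _. Qed.

Lemma lgll_interp (q : {poly R}) : (size q <= p.+1)%N ->
  q = \sum_i q.[glln i] *: lgll i.
Proof. exact: lag_interp glln_inj _. Qed.

Let w_factor i : exists2 k, k != 0 & w = k *: (('X - (glln i)%:P) * lgll i).
Proof.
have w0 : w != 0 by rewrite -size_poly_eq0 size_w.
have e : w = lead_coef w *: \prod_(j < p.+1) ('X - (glln j)%:P).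
  rewrite [LHS](@all_roots_prod_XsubC _ w (codom glln)).
  - by rewrite /codom big_image.
  - by rewrite size_w size_codom card_ord.
  - by apply/allP => _ /codomP[j ->]; exact: glln_root.
  - by rewrite uniq_rootsE map_inj_uniq ?enum_uniq//; exact: glln_inj.
pose k := \prod_(j | j != i) (glln i - glln j)^-1.
have k0 : k != 0.
  apply/prodf_neq0 => j ji; rewrite invr_eq0 subr_eq0 (inj_eq glln_inj) eq_sym//.
exists (lead_coef w * k^-1); first by rewrite mulf_neq0 ?invr_eq0// lead_coef_eq0.
rewrite {1}e -scalerA; congr (_ *: _).
rewrite (bigD1 i)//= /lgll /lag scaler_prod -/k -scalerAr scalerA mulVf// scale1r//.
Qed.

(* Both sides of [1 - \sum_i l_i^2 = k (1 - X^2) P'^2] have degree [2p] and the same zeros: at an interior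
   node [l_i] has a critical point, because [w'' = - p (p + 1) P'] vanishes there. *)
Lemma lgll_sum_sqr_le1 x : -1 <= x <= 1 -> \sum_i (lgll i).[x] ^+ 2 <= 1.
Proof.
pose f : {poly R} := 1 - \sum_i lgll i ^+ 2.
have f_node j : f.[glln j] = 0.
  rewrite /f hornerD hornerN hornerC horner_sum (bigD1 j)//= big1 => [|i ij].
    by rewrite horner_exp lgll_node eqxx expr1n addr0 subrr.
  by rewrite horner_exp lgll_node (negPf ij) expr0n.
have df_node j : root P^`() (glln j) -> f^`().[glln j] = 0.
  move=> /rootP rj; rewrite /f derivB derivC sub0r raddf_sum hornerN horner_sum.
  rewrite (bigD1 j)//= big1 => [|i ij]; last first.
    by rewrite [X in X.[_]]deriv_exp hornerMn hornerM expr1 lgll_node (negPf ij) mulr0 mul0rn.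
  rewrite [X in X.[_]]deriv_exp hornerMn hornerM expr1 lgll_node eqxx mulr1 addr0.
  have [k k0 wk] := w_factor j.
  have := deriv_neg_legendre_ode p; rewrite -/P -/w => dw.
  have := congr1 (fun q => q^`().[glln j]) dw.
  have -> : w^`()^`().[glln j] = k * ((lgll j)^`().[glln j] + (lgll j)^`().[glln j]).
    rewrite wk !derivZ derivM derivXsubC mul1r derivD derivM derivXsubC mul1r.
    by rewrite !hornerZ !hornerD hornerM hornerXsubC subrr mul0r addr0.
  rewrite derivZ hornerZ rj mulr0.
  move/eqP; rewrite mulf_eq0 (negPf k0)/= -mulr2n mulrn_eq0/= => /eqP->.
  by rewrite mul0rn oppr0.
have w0 : w != 0 by rewrite -size_poly_eq0 size_w.
have [g fg] : exists g, f = g * w.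
  apply/dvdpP; have [k k0 wk] := w_factor ord0.
  have e : w = lead_coef w *: \prod_(z <- codom glln) ('X - z%:P).
    apply: all_roots_prod_XsubC.
    - by rewrite size_w size_codom card_ord.
    - by apply/allP => _ /codomP[j ->]; exact: glln_root.
    - by rewrite uniq_rootsE map_inj_uniq ?enum_uniq//; exact: glln_inj.
  rewrite e dvdpZl ?lead_coef_eq0//; apply: uniq_roots_dvdp.
    by apply/allP => _ /codomP[j ->]; apply/rootP; exact: f_node.
  by rewrite uniq_rootsE map_inj_uniq ?enum_uniq//; exact: glln_inj.
have [t [[te st rt tin] ts]] := gll_rcons.
have tu : uniq t.
  by move: ts => /lt_sorted_uniq; rewrite /= rcons_uniq => /and3P[].
have eP : P^`() = lead_coef P^`() *: \prod_(z <- t) ('X - z%:P).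
  apply: all_roots_prod_XsubC => //; last by rewrite uniq_rootsE.
  by rewrite st size_dP prednK.
(* At an interior node [w] vanishes with derivative [k != 0], so [f' = g' w + g w' = 0] forces [g]
   to vanish there as well. *)
have [k' gk] : exists k', g = k' * P^`().
  apply/dvdpP; rewrite eP dvdpZl ?lead_coef_eq0//; apply: uniq_roots_dvdp; last by rewrite uniq_rootsE.
  apply/allP => z zt.
  have : z \in gll R p by rewrite te inE mem_rcons inE zt !orbT.
  move=> /(nthP 0)[m]; rewrite size_gll => mp zm.
  pose j := Ordinal mp; have zj : glln j = z by rewrite /glln.
  have := df_node j; rewrite zj fg derivM hornerD (hornerM g^`() w) (hornerM g w^`()) => /(_ (allP rt _ zt)).
  have [k k0 wk] := w_factor j.
  have -> : w.[z] = 0 by rewrite wk hornerZ hornerM hornerXsubC zj subrr mul0r mulr0.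
  have -> : w^`().[z] = k.
    rewrite wk derivZ derivM derivXsubC mul1r hornerZ hornerD hornerM hornerXsubC.
    by rewrite -zj subrr mul0r addr0 lgll_node eqxx mulr1.
  rewrite mulr0 add0r.
  by move/eqP; rewrite mulf_eq0 (negPf k0) orbF.
have sf : (size f <= (2 * p).+1)%N.
  rewrite (leq_trans (size_polyD _ _))// geq_max size_polyC oner_eq0 size_polyN /=.
  apply: leq_trans (size_sum _ _ _) _; apply/bigmax_leqP => i _.
  apply: leq_trans (size_polyMleq _ _) _; have := size_lgll i.
  by case: (size (lgll i)) => [|m]//= mp; rewrite addnS mul2n -addnn ltnS leq_add.
have fe : f = k' * (P^`() * w) by rewrite fg gk mulrA.
have sPw : size (P^`() * w) = (2 * p).+1.
  by rewrite size_mul// size_dP size_w addnS addnS /= mul2n -addnn.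
have sk : (size k' <= 1)%N.
  have [->|k0] := eqVneq k' 0; first by rewrite size_poly0.
  move: sf; rewrite fe size_mul// -?size_poly_eq0 ?sPw// addnS /=.
  by rewrite -[(2 * p).+1]add1n leq_add2r.
have cf : f`_(2 * p) = - \sum_i (lgll i)`_p ^+ 2.
  rewrite coefB coefC muln_eq0 /= (gtn_eqF p0) sub0r coef_sum; congr (- _).
  apply: eq_bigr => i _; rewrite expr2 coefM.
  have pp : (p < (p + p).+1)%N by rewrite ltnS leq_addr.
  rewrite mul2n -addnn (bigD1 (Ordinal pp))//= addnK big1 ?addr0 => [|j jp].
    by rewrite expr2.
  have s0 m : (p < m)%N -> (lgll i)`_m = 0.
    by move=> pm; rewrite nth_default// (leq_trans (size_lgll i)).
  have [pj|jp'] := ltnP p j; first by rewrite s0 ?mul0r.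
  rewrite [X in _ * X]s0 ?mulr0// ltn_subRL ltn_add2r ltn_neqAle jp' andbT.
  by apply: contra jp => /eqP jp; apply/eqP/val_inj.
(* The sign is read off the coefficient of degree [2 p]: minus a sum of squares in [f], minus a
   square in [P' w]. *)
have kpos : 0 <= k'`_0.
  have lw : lead_coef (P^`() * w) = - lead_coef P^`() ^+ 2.
    rewrite !lead_coefM -opprB lead_coefN lead_coefXnsubC// mulN1r mulrN expr2 //.
  have : f`_(2 * p) <= 0 by rewrite cf oppr_le0 sumr_ge0// => i _; rewrite sqr_ge0.
  rewrite fe {1}(size1_polyC sk) coefCM -[(2 * p)%N]/((2 * p).+1.-1) -sPw -lead_coefE lw.
  rewrite mulrN oppr_le0 pmulr_lge0// lt_neqAle sqr_ge0 andbT eq_sym.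
  by rewrite expf_eq0 /= lead_coef_eq0.
move=> /andP[x0 x1]; rewrite -subr_ge0.
have -> : 1 - \sum_i (lgll i).[x] ^+ 2 = f.[x].
  rewrite /f hornerD hornerN hornerC horner_sum; congr (_ - _); apply: eq_bigr => i _.
  by rewrite horner_exp.
rewrite fe (size1_polyC sk) !hornerM hornerC mulr_ge0//.
rewrite mulrCA -expr2 mulr_ge0 ?sqr_ge0//.
by rewrite hornerD hornerN hornerXn hornerC; nra.
Qed.

Lemma lgll_le1 i x : -1 <= x <= 1 -> `|(lgll i).[x]| <= 1.
Proof.
move=> /lgll_sum_sqr_le1; rewrite (bigD1 i)//= => h.
rewrite -(@expr_le1 _ 2)// real_normK ?num_real//.
by apply: le_trans h; rewrite lerDl sumr_ge0// => j _; rewrite sqr_ge0.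
Qed.

End Nodes.

End GaussLobattoLegendre.

(** * Polynomials in several variables *)

Section RowVectors.
Variables (R : realType) (d : nat).
Implicit Types x y v : 'rV[R]_d.

Definition unitv (k : 'I_d) : 'rV[R]_d := delta_mx 0 k.

Lemma coord_unitv x k t j : (x + t *: unitv k) 0 j = x 0 j + (if j == k then t else 0).
Proof. by rewrite !mxE eqxx/=; case: eqP => _; rewrite ?mulr1 ?mulr0. Qed.

Lemma coord_norm x k : `|x 0 k| <= `|x|.
Proof.
rewrite [leRHS]/Num.Def.normr/= mx_normrE.
exact: (le_bigmax _ (fun ij : 'I_1 * 'I_d => `|x ij.1 ij.2|) (0, k)).
Qed.

Lemma norm_rV_le x (M : R) : 0 <= M -> (forall k, `|x 0 k| <= M) -> `|x| <= M.
Proof.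
move=> M0 h; rewrite [leLHS]/Num.Def.normr/= mx_normrE.
by apply: bigmax_le => // -[i j] _ /=; rewrite (ord1 i).
Qed.

Lemma norm_rV_lt x (M : R) : 0 < M -> (forall k, `|x 0 k| < M) -> `|x| < M.
Proof.
move=> M0 h; rewrite [ltLHS]/Num.Def.normr/= mx_normrE.
by apply: bigmax_lt => // -[i j] _ /=; rewrite (ord1 i).
Qed.

Lemma dotv_ge0 x : 0 <= dotv x x.
Proof. by apply: sumr_ge0 => k _; rewrite -expr2 sqr_ge0. Qed.

Lemma enorm_sqr x : enorm x ^+ 2 = dotv x x.
Proof. by rewrite /enorm sqr_sqrtr// dotv_ge0. Qed.

Lemma enorm_ge0 x : 0 <= enorm x. Proof. exact: sqrtr_ge0. Qed.

Lemma coord_enorm x k : `|x 0 k| <= enorm x.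
Proof.
rewrite -sqrtr_sqr; apply: ler_wsqrtr; rewrite /dotv (bigD1 k)//= expr2.
by rewrite lerDl sumr_ge0// => j _; rewrite -expr2 sqr_ge0.
Qed.

Lemma norm_le_enorm x : `|x| <= enorm x.
Proof. by apply: norm_rV_le => [|k]; [exact: enorm_ge0|exact: coord_enorm]. Qed.

Lemma enorm_le_norm x : enorm x <= d%:R * `|x|.
Proof.
have [d0|d0] := posnP d.
  rewrite /enorm /dotv big1 ?sqrtr0 ?mulr_ge0// => k.
  by have := ltn_ord k; rewrite [X in (_ < X)%N]d0.
rewrite -(@ler_pXn2r _ 2)// ?nnegrE ?enorm_ge0 ?mulr_ge0//.
rewrite enorm_sqr exprMn.
apply: (@le_trans _ _ (\sum_(k < d) `|x| ^+ 2)).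
  apply: ler_sum => k _; rewrite -expr2 -real_normK ?num_real//.
  by rewrite ler_pXn2r ?nnegrE ?coord_norm.
rewrite sumr_const card_ord -[X in X <= _]mulr_natl ler_wpM2r ?sqr_ge0//.
by rewrite -natrX ler_nat -[X in (X <= _)%N]expn1 leq_pexp2l.
Qed.

Lemma enorm_eq0 x : (enorm x == 0) = (x == 0).
Proof.
apply/eqP/eqP => [e|->]; last first.
  by rewrite /enorm /dotv big1 ?sqrtr0// => k _; rewrite mxE mul0r.
by apply/eqP; rewrite -normr_eq0 eq_le normr_ge0 andbT -e norm_le_enorm.
Qed.

Lemma dotvC x y : dotv x y = dotv y x.
Proof. by apply: eq_bigr => k _; rewrite mulrC. Qed.

Lemma dotvDl x y v : dotv (x + y) v = dotv x v + dotv y v.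
Proof. by rewrite /dotv -big_split; apply: eq_bigr => k _; rewrite mxE mulrDl. Qed.

Lemma dotvZl a x v : dotv (a *: x) v = a * dotv x v.
Proof. by rewrite /dotv mulr_sumr; apply: eq_bigr => k _; rewrite mxE mulrA. Qed.

Lemma dotvDr x y v : dotv v (x + y) = dotv v x + dotv v y.
Proof. by rewrite !(dotvC v) dotvDl. Qed.

Lemma dotvZr a x v : dotv v (a *: x) = a * dotv v x.
Proof. by rewrite !(dotvC v) dotvZl. Qed.

Lemma dotvNl x v : dotv (- x) v = - dotv x v.
Proof. by rewrite -scaleN1r dotvZl mulN1r. Qed.

Lemma enormN x : enorm (- x) = enorm x.
Proof. by rewrite /enorm dotvNl dotvC dotvNl opprK. Qed.

Lemma enormZ a x : enorm (a *: x) = `|a| * enorm x.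
Proof.
by rewrite /enorm dotvZl dotvZr mulrA -expr2 sqrtrM ?sqr_ge0// sqrtr_sqr.
Qed.

Lemma dotv_le x y : `|dotv x y| <= enorm x * enorm y.
Proof.
rewrite -(@ler_pXn2r _ 2)// ?nnegrE ?mulr_ge0 ?enorm_ge0//.
rewrite exprMn !enorm_sqr real_normK ?num_real//.
have [->|y0] := eqVneq y 0.
  by rewrite dotvC -(scale0r 0) !dotvZl !mul0r expr0n mulr0.
have yy : 0 < dotv y y.
  by rewrite lt_neqAle dotv_ge0 andbT eq_sym -enorm_sqr expf_eq0 enorm_eq0 y0.
have := dotv_ge0 (dotv y y *: x - dotv x y *: y).
rewrite dotvDl !dotvDr -!scaleNr !(dotvZl, dotvZr) (dotvC y x) => h.
rewrite -subr_ge0 -(pmulr_rge0 _ yy); apply: le_trans h _.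
by rewrite le_eqVlt; apply/orP; left; apply/eqP; ring.
Qed.

Lemma enormD x y : enorm (x + y) <= enorm x + enorm y.
Proof.
rewrite -(@ler_pXn2r _ 2)// ?nnegrE ?addr_ge0 ?enorm_ge0//.
rewrite sqrrD !enorm_sqr dotvDl !dotvDr (dotvC y x).
have := le_trans (ler_norm _) (dotv_le x y).
move: (dotv x y) (dotv x x) (dotv y y) (enorm x * enorm y) => a b c e h.
by rewrite mulr2n; lra.
Qed.

Lemma enorm_unitv k : enorm (unitv k) = 1.
Proof.
rewrite /enorm /dotv (bigD1 k)//= big1 => [|j jk]; last by rewrite !mxE (negPf jk) andbF mul0r.
by rewrite !mxE !eqxx mulr1 addr0 sqrtr1.
Qed.

End RowVectors.

(** * Functions that are polynomial along coordinate lines *)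

Section LinePolynomials.
Variables (R : realType) (d : nat).
Implicit Types (f g : 'rV[R]_d -> R) (x y v : 'rV[R]_d).

(** Enough for partial derivatives to exist and to obey the usual rules, without differentiability
    in several variables. *)
Definition lpoly f := forall (k : 'I_d) x, exists P : {poly R}, forall t, f (x + t *: unitv R k) = P.[t].

Lemma partial_line k f x (P : {poly R}) :
  (forall t, f (x + t *: unitv R k) = P.[t]) ->
  forall s, derivable f (x + s *: unitv R k) (delta_mx 0 k) /\
    partial k f (x + s *: unitv R k) = P^`().[s].
Proof.
move=> fP s.
have e : (fun h : R => h^-1 *: ((f \o shift (x + s *: unitv R k)) (h *: (delta_mx 0 k)) - f (x + s *: unitv R k)))
   = (fun h : R => h^-1 *: ((horner P \o shift s) (h *: 1) - P.[s])).
  apply/funext => h /=; rewrite fP addrCA -scalerDl -/(unitv R k) fP.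
  by rewrite [h *: 1]mulr1.
rewrite /partial /derivable /derive e; split; first exact: (@derivable_horner R P s).
by rewrite derive.derivE derive1E.
Qed.

Lemma lpoly_derivable k f x : lpoly f -> derivable f x (delta_mx 0 k).
Proof.
move=> /(_ k x)[P fP]; have [] := partial_line fP 0.
by rewrite scale0r addr0.
Qed.

Lemma lpoly_cst (a : R) : lpoly (fun=> a).
Proof. by move=> k x; exists a%:P => t; rewrite hornerC. Qed.

Lemma lpoly_coord j : lpoly (fun x => x 0 j).
Proof.
move=> k x; exists (if j == k then 'X + (x 0 j)%:P else (x 0 j)%:P) => t.
by rewrite coord_unitv; case: eqP => _; rewrite ?hornerD ?hornerX hornerC ?addr0 1?addrC.
Qed.

Lemma lpolyD f g : lpoly f -> lpoly g -> lpoly (fun x => f x + g x).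
Proof.
move=> hf hg k x; have [P fP] := hf k x; have [Q gQ] := hg k x.
by exists (P + Q) => t; rewrite hornerD fP gQ.
Qed.

Lemma lpolyM f g : lpoly f -> lpoly g -> lpoly (fun x => f x * g x).
Proof.
move=> hf hg k x; have [P fP] := hf k x; have [Q gQ] := hg k x.
by exists (P * Q) => t; rewrite hornerM fP gQ.
Qed.

Lemma lpoly_sum (I : finType) (F : I -> 'rV[R]_d -> R) :
  (forall i, lpoly (F i)) -> lpoly (fun x => \sum_i F i x).
Proof.
move=> h k x; exists (\sum_i sval (cid (h i k x))) => t.
by rewrite horner_sum; apply: eq_bigr => i _; case: cid => P /= ->.
Qed.

Lemma partialD k f g x : lpoly f -> lpoly g ->
  partial k (fun y => f y + g y) x = partial k f x + partial k g x.
Proof. by move=> hf hg; rewrite /partial deriveD//; exact: lpoly_derivable. Qed.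

Lemma partialZ k f (a : R) x : lpoly f ->
  partial k (fun y => a * f y) x = a * partial k f x.
Proof. by move=> hf; rewrite /partial deriveZ//; exact: lpoly_derivable. Qed.

Lemma partial_cst k (a : R) x : partial k (fun=> a) x = 0.
Proof. exact: derive_cst. Qed.

Lemma partial_coord k j x : partial k (fun x => x 0 j) x = (j == k)%:R.
Proof.
have [|_ ] := @partial_line k (fun x => x 0 j) x (if j == k then 'X + (x 0 j)%:P else (x 0 j)%:P) _ 0.
  by move=> t; rewrite coord_unitv; case: eqP => _; rewrite ?hornerD ?hornerX hornerC ?addr0 1?addrC.
by rewrite scale0r addr0 => ->; case: eqP => _; rewrite ?derivD ?derivX derivC ?addr0 ?hornerC.
Qed.

Lemma partial_sum (I : finType) (F : I -> 'rV[R]_d -> R) k x :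
  (forall i, lpoly (F i)) -> partial k (fun x => \sum_i F i x) x = \sum_i partial k (F i) x.
Proof.
move=> h; pose P i := sval (cid (h i k x)).
have FP i t : F i (x + t *: unitv R k) = (P i).[t] by rewrite /P; case: cid.
have := @partial_line k (fun x => \sum_i F i x) x (\sum_i P i).
move=> /(_ _ 0)[t|_]; first by rewrite horner_sum; apply: eq_bigr.
rewrite scale0r addr0 => ->; rewrite raddf_sum horner_sum; apply: eq_bigr => i _.
by have [_] := partial_line (FP i) 0; rewrite scale0r addr0.
Qed.

(* One coordinate is changed at a time, so that only points of the box occur. *)
Lemma lipschitz_partial f (lo hi : 'rV[R]_d) (M : 'I_d -> R) x y : lpoly f ->
  (forall z : 'rV[R]_d, (forall k, lo 0 k <= z 0 k <= hi 0 k) -> forall k, `|partial k f z| <= M k) ->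
  (forall k, lo 0 k <= x 0 k <= hi 0 k) -> (forall k, lo 0 k <= y 0 k <= hi 0 k) ->
  `|f x - f y| <= \sum_k M k * `|x 0 k - y 0 k|.
Proof.
move=> lf pM xK yK.
pose z (m : nat) : 'rV[R]_d := \row_k (if (k < m)%N then y 0 k else x 0 k).
have z0 : z 0%N = x by apply/rowP => k; rewrite mxE.
have zd : z d = y by apply/rowP => k; rewrite mxE ltn_ord.
have zK m k : lo 0 k <= z m 0 k <= hi 0 k by rewrite mxE; case: ifP.
have -> : f x - f y = \sum_(k < d) (f (z k) - f (z k.+1)).
  rewrite -(big_mkord xpredT (fun k => f (z k) - f (z k.+1))).
  rewrite -[LHS]opprK opprB -z0 -zd -(telescope_sumr (fun k => f (z k)))// -sumrN.
  by apply: eq_bigr => k _; rewrite opprB.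
apply: le_trans (ler_norm_sum _ _ _) _; apply: ler_sum => k _.
pose x0 := z k - z k 0 k *: unitv R k.
have ezk : z k = x0 + x 0 k *: unitv R k.
  by rewrite /x0 [z k 0 k]mxE ltnn subrK.
have eline t j : (x0 + t *: unitv R k) 0 j = if j == k then t else z k 0 j.
  rewrite /x0 -addrA -scaleNr -scalerDl coord_unitv; case: eqP => [->|_]; last by rewrite addr0.
  by rewrite addrA subrr add0r.
have ezk1 : z k.+1 = x0 + y 0 k *: unitv R k.
  apply/rowP => j; rewrite eline !mxE ltnS leq_eqVlt.
  have -> : (nat_of_ord j == k) = (j == k) by [].
  by case: eqP => [->|].
have [P fP] := lf k x0.
rewrite ezk ezk1 !fP.

have key (a b : R) : lo 0 k <= a <= hi 0 k -> lo 0 k <= b <= hi 0 k -> a < b ->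
    `|P.[b] - P.[a]| <= M k * `|b - a|.
  move=> aK bK ab; have [c + ->] := poly_mvt P ab.
  rewrite in_itv /= normrM => /andP[ac cb]; apply: ler_wpM2r => //.
  have [_ <-] := partial_line fP c; apply: pM => j; rewrite eline; case: eqP => [->|_]; last exact: zK.
  by case/andP: aK => aK _; case/andP: bK => _ bK; rewrite (le_trans aK (ltW ac)) (le_trans (ltW cb) bK).
have [ab|ab|->] := ltgtP (x 0 k) (y 0 k).
- by rewrite distrC (distrC (x 0 k)) key.
- exact: key.
- by rewrite !subrr normr0 mulr0.
Qed.

End LinePolynomials.

Section TensorPolynomials.
Variables (R : realType) (d : nat).
Implicit Types (f g q : 'rV[R]_d -> R) (x y v : 'rV[R]_d).

Lemma isQ_prod p (P : 'I_d -> {poly R}) : (forall k, size (P k) <= p.+1)%N ->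
  isQ p (fun x => \prod_k (P k).[x 0 k]).
Proof.
move=> sP; exists (fun a : {ffun 'I_d -> 'I_p.+1} => \prod_k (P k)`_(a k)) => x.
transitivity (\prod_(k < d) \sum_(i < p.+1) (P k)`_i * x 0 k ^+ i).
  by apply: eq_bigr => k _; rewrite (horner_coef_wide _ (sP k)).
rewrite bigA_distr_bigA /=; apply: eq_bigr => a _.
by rewrite big_split.
Qed.

Lemma isQ_sum p (I : finType) (F : I -> 'rV[R]_d -> R) :
  (forall i, isQ p (F i)) -> isQ p (fun x => \sum_i F i x).
Proof.
move=> h; exists (fun a => \sum_i sval (cid (h i)) a) => x.
under eq_bigr do rewrite (svalP (cid (h _))).
rewrite exchange_big; apply: eq_bigr => a _; by rewrite mulr_suml.
Qed.

Lemma isQ_scale p q (c : R) : isQ p q -> isQ p (fun x => c * q x).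
Proof.
move=> [w h]; exists (fun a => c * w a) => x.
by rewrite h mulr_sumr; apply: eq_bigr => a _; rewrite mulrA.
Qed.

Lemma isQ_cst p (c : R) : isQ p (fun _ : 'rV[R]_d => c).
Proof.
rewrite (_ : (fun _ => c) = fun x : 'rV[R]_d => c * \prod_(k < d) (1 : {poly R}).[x 0 k]).
  by apply: isQ_scale; apply: (@isQ_prod p (fun=> 1)) => k; rewrite size_polyC oner_eq0.
by apply/funext => x; rewrite big1 ?mulr1// => k _; rewrite hornerC.
Qed.

Section Fixed.
Variables (p : nat) (q : 'rV[R]_d -> R).
Hypothesis hq : isQ p q.

Lemma isQ_line k x : exists2 P : {poly R}, (size P <= p.+1)%N &
  forall t, q (x + t *: unitv R k) = P.[t].
Proof.
have [c qc] := hq.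
exists (\sum_a (c a * \prod_(j | j != k) x 0 j ^+ a j) *: ('X + (x 0 k)%:P) ^+ a k).
  apply: (leq_trans (size_sum _ _ _)); apply/bigmax_leqP => a _.
  rewrite (leq_trans (size_scale_leq _ _))//.
  by rewrite -[(x 0 k)%:P]opprK -polyCN size_exp_XsubC.
move=> t; rewrite qc horner_sum; apply: eq_bigr => a _.
rewrite hornerZ horner_exp hornerD hornerX hornerC -mulrA; congr (_ * _).
rewrite /monom (bigD1 k)//= mulrC coord_unitv eqxx (addrC t); congr (_ * _).
by apply: eq_bigr => j jk; rewrite coord_unitv (negPf jk) addr0.
Qed.

Lemma isQ_lpoly : lpoly q.
Proof. by move=> k x; have [P _ h] := isQ_line k x; exists P. Qed.

Lemma isQ_partial k : isQ p (partial k q).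
Proof.
have [c qc] := hq.
have mQ (a : {ffun 'I_d -> 'I_p.+1}) : isQ p (monom (R := R) a).
  have := @isQ_prod p (fun k => 'X^(a k)).
  rewrite (_ : (fun x => _) = monom (R := R) a); last first.
    by apply/funext => x; apply: eq_bigr => j _; rewrite hornerXn.
  by apply=> j; rewrite size_polyXn ltn_ord.

have mL (a : {ffun 'I_d -> 'I_p.+1}) : lpoly (monom (R := R) a).
  move=> j x; exists ((\prod_(i | i != j) x 0 i ^+ a i) *: ('X + (x 0 j)%:P) ^+ a j) => t.
  rewrite hornerZ horner_exp hornerD hornerX hornerC mulrC.
  rewrite /monom (bigD1 j)//= coord_unitv eqxx (addrC t); congr (_ * _).
  by apply: eq_bigr => i ij; rewrite coord_unitv (negPf ij) addr0.
have -> : partial k q = (fun x => \sum_a c a * partial k (monom (R := R) a) x).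
  apply/funext => x; rewrite (_ : q = fun x => \sum_a c a * monom a x); last exact/funext.
  rewrite partial_sum => [|a]; last by apply: lpolyM => //; exact: lpoly_cst.
  by apply: eq_bigr => a _; rewrite partialZ.
apply: isQ_sum => a; apply: isQ_scale.
have := @isQ_prod p (fun j => if j == k then ('X^(a k))^`() else 'X^(a j)).
rewrite (_ : (fun x => _) = partial k (monom (R := R) a)); last first.
  apply/funext => x.
  have [|_] := @partial_line R d k (monom (R := R) a) x ((\prod_(i | i != k) x 0 i ^+ a i) *: ('X + (x 0 k)%:P) ^+ a k) _ 0.
    move=> t; rewrite hornerZ horner_exp hornerD hornerX hornerC mulrC.
    rewrite /monom (bigD1 k)//= coord_unitv eqxx (addrC t); congr (_ * _).
    by apply: eq_bigr => i ij; rewrite coord_unitv (negPf ij) addr0.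
  rewrite scale0r addr0 => ->.
  rewrite derivZ hornerZ [X in _ = _ * X.[_]]deriv_exp derivD derivX derivC addr0 mul1r.
  rewrite [RHS]mulrC hornerMn.
  rewrite horner_exp hornerD hornerX hornerC add0r (bigD1 k)//= eqxx derivXn hornerMn hornerXn.
  by congr (_ * _); apply: eq_bigr => j jk; rewrite (negPf jk) hornerXn.
apply=> j; case: eqP => _; last by rewrite size_polyXn ltn_ord.
by rewrite polyorder.size_deriv size_polyXn /= ltnW ?ltn_ord.
Qed.

Lemma isQ_differentiable x : differentiable q x.
Proof.
have [c qc] := hq; rewrite (_ : q = fun x => \sum_a c a * monom a x); last exact/funext.
have hX (k : 'I_d) n : differentiable (fun x : 'rV[R]_d => x 0 k ^+ n) x.
  elim: n => [|n IH]; first by rewrite (_ : (fun _ => _) = cst 1).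
  rewrite (_ : (fun _ => _) = (fun x : 'rV[R]_d => x 0 k * x 0 k ^+ n)); last first.
    by apply/funext => y; rewrite exprS.
  by apply: differentiableM => //; exact: differentiable_coord.
have hm (a : {ffun 'I_d -> 'I_p.+1}) : differentiable (fun x => c a * monom a x) x.
  apply: differentiableM => //; rewrite /monom.
  elim: (index_enum _) => [|k s IH].
    by rewrite (_ : (fun _ => _) = cst 1)//; apply/funext => y; rewrite big_nil.
  rewrite (_ : (fun _ => _) = (fun x : 'rV[R]_d => x 0 k ^+ a k * \prod_(k <- s) x 0 k ^+ a k)).
    by apply: differentiableM.
  by apply/funext => y; rewrite big_cons.
elim: (index_enum _) => [|a s IH].
  by rewrite (_ : (fun _ => _) = cst 0)//; apply/funext => y; rewrite big_nil.
rewrite (_ : (fun _ => _) = (fun x : 'rV[R]_d => c a * monom a x + \sum_(a <- s) c a * monom a x)).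
  by apply: differentiableD.
by apply/funext => y; rewrite big_cons.
Qed.

Lemma isQ_continuous : continuous q.
Proof. by move=> x; apply: differentiable_continuous; exact: isQ_differentiable. Qed.

Lemma isQ_derive v x : derivable q x v /\ 'D_v q x = \sum_k v 0 k * partial k q x.
Proof.
have dq := isQ_differentiable x.
split; first exact: diff_derivable.
rewrite deriveE// {1}[v]row_sum_delta raddf_sum/=.
by apply: eq_bigr => k _; rewrite linearZ/= -deriveE.
Qed.

End Fixed.

Definition lgll_tensor p (a : {ffun 'I_d -> 'I_p.+1}) x : R := \prod_k (lgll R (a k)).[x 0 k].

Lemma isQ_lgll p (a : {ffun 'I_d -> 'I_p.+1}) : isQ p (lgll_tensor a).
Proof. by apply: isQ_prod => k; exact: size_lgll. Qed.

(** Monomials are products of one-variable powers, so one-dimensional interpolation applies in each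
    variable and the product of sums is expanded. *)
Lemma isQ_interp p q : (0 < p)%N -> isQ p q ->
  forall x, q x = \sum_(a : {ffun 'I_d -> 'I_p.+1}) q (gll_pt R a) * lgll_tensor a x.
Proof.
move=> p0 [c qc] x.
under eq_bigr do rewrite qc mulr_suml.
rewrite exchange_big qc; apply: eq_bigr => m _ /=.
under eq_bigr do rewrite -mulrA.
rewrite -mulr_sumr; congr (_ * _).
transitivity (\prod_(k < d) \sum_(i < p.+1) (glln R i) ^+ m k * (lgll R i).[x 0 k]).
  apply: eq_bigr => k _.
  have sX : (size ('X^(m k) : {poly R}) <= p.+1)%N by rewrite size_polyXn ltn_ord.
  have := congr1 (fun P => P.[x 0 k]) (lgll_interp p0 sX).
  rewrite hornerXn horner_sum => ->.
  by apply: eq_bigr => i _; rewrite hornerZ hornerXn.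
rewrite bigA_distr_bigA /=; apply: eq_bigr => a _.
rewrite big_split; congr (_ * _); rewrite /monom.
by apply: eq_bigr => k _; rewrite mxE.
Qed.

Lemma lgll_tensor_node p (a b : {ffun 'I_d -> 'I_p.+1}) : (0 < p)%N ->
  lgll_tensor a (gll_pt R b) = (a == b)%:R.
Proof.
move=> p0; rewrite /lgll_tensor; under eq_bigr do rewrite mxE -/(glln R _) (lgll_node _ p0).
have [->|ab] := eqVneq a b; first by rewrite big1// => k _; rewrite eqxx.
have [k /negPf abk] : exists k, a k != b k.
  by apply/existsP; rewrite -negb_forall; apply: contra ab => /forallP h; apply/eqP/ffunP => k; apply/eqP.
by rewrite (bigD1 k)//= abk mul0r.
Qed.

Lemma gll_pt_ref p (a : {ffun 'I_d -> 'I_p.+1}) : (0 < p)%N -> ref_cellc (gll_pt R a).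
Proof. by move=> p0 k; rewrite mxE; exact: glln_itv. Qed.

Lemma lgll_tensor_le1 p (a : {ffun 'I_d -> 'I_p.+1}) x : (0 < p)%N -> ref_cellc x ->
  `|lgll_tensor a x| <= 1.
Proof.
move=> p0 xr; rewrite /lgll_tensor normr_prod.
apply: (@le_trans _ _ (\prod_(k < d) 1)); last by rewrite big1.
by apply: ler_prod => k _; rewrite normr_ge0 lgll_le1.
Qed.

Lemma isQ_markov p q M : isQ p q -> (forall x, ref_cellc x -> `|q x| <= M) ->
  forall k x, ref_cellc x -> `|partial k q x| <= 2 * p%:R ^+ 2 * M.
Proof.
move=> hq qM k x xr.
have [P sP qP] := isQ_line hq k (x - x 0 k *: unitv R k).
have [_] := partial_line qP (x 0 k); rewrite subrK => ->.
apply: (markov sP) => // t tr; rewrite -qP; apply: qM => j.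
rewrite -addrA -scaleNr -scalerDl coord_unitv; case: eqP => [->|_]; last by rewrite addr0.
by rewrite addrA subrr add0r.
Qed.

End TensorPolynomials.

(** * The geometry map of a cell *)

Section Analysis.
Variables (R : realType) (d : nat).
Implicit Types (x y v : 'rV[R]_d).

Lemma box_compact (lo hi : 'I_d -> R) :
  compact [set x : 'rV[R]_d | forall k, lo k <= x 0 k <= hi k].
Proof.
have := @rV_compact R d (fun k => `[lo k, hi k]%classic) (fun k => @segment_compact R _ _).
congr compact; apply/seteqP; split => x /= h k; have := h k; rewrite in_itv/= ?(ord1 ord0)//.
Qed.

Lemma ref_cellc_compact : compact (@ref_cellc R d).
Proof. exact: (@box_compact (fun=> -1) (fun=> 1)). Qed.

Lemma rV_continuousP (V : normedModType R) (f : 'rV[R]_d -> V) :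
  continuous f <->
  (forall x e, 0 < e -> exists2 dl : R, 0 < dl & forall y, `|x - y| < dl -> `|f x - f y| < e).
Proof.
split=> [cf x e e0|h x].
  have /(@cvgrPdist_lt _ _ _ (nbhs x)) /(_ e e0) := cf x.
  move=> /nbhs_ballP[dl /= dl0 hd]; exists dl => // y xy; apply: hd.
  by rewrite -ball_normE.
apply/(@cvgrPdist_lt _ _ _ (nbhs x)) => e e0.
have [dl dl0 hd] := h x e e0.
have : nbhs x (ball x dl) by exact: nbhsx_ballx.
by apply: filterS => y; rewrite -ball_normE /=; exact: hd.
Qed.

Lemma continuous_rV (T : topologicalType) (F : T -> 'rV[R]_d) :
  (forall k, continuous (fun x : T => F x 0 k)) -> continuous F.
Proof.
move=> h x; apply/(@cvgrPdist_lt _ _ _ (nbhs x)) => e e0.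
have : \forall y \near x, forall k : 'I_d, `|F x 0 k - F y 0 k| < e.
  apply: filter_forall => k.
  exact: ((cvgrPdist_lt _ _).1 (h k x) e e0).
by apply: filterS => y hy; apply: norm_rV_lt => // k; rewrite !mxE; exact: hy.
Qed.

Lemma enorm_continuous : continuous (@enorm R d).
Proof.
apply/rV_continuousP => x e e0.
have d1 : 0 < d%:R + 1 :> R by rewrite ltr_wpDl.
exists (e / (d%:R + 1)); first by rewrite divr_gt0.
move=> y xy.
have h : enorm (x - y) < e.
  apply: le_lt_trans (enorm_le_norm _) _.
  apply: (@le_lt_trans _ _ ((d%:R + 1) * `|x - y|)).
    by rewrite ler_wpM2r// lerDl.
  by rewrite mulrC -ltr_pdivlMr.
rewrite ltr_norml; apply/andP; split.
  have := enormD (y - x) x; rewrite subrK -[y - x]opprB enormN; lra.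
have := enormD (x - y) y; rewrite subrK; lra.
Qed.

Lemma taylor_derivable (f : 'rV[R]_d -> R) x v (l K e : R) : 0 < e ->
  (forall t, `|t| < e -> `|f (x + t *: v) - f x - t * l| <= K * t ^+ 2) ->
  derivable f x v /\ 'D_v f x = l.
Proof.
move=> e0 h.
suff c : (fun h : R => h^-1 *: ((f \o shift x) (h *: v) - f x)) @ 0^' --> l.
  by split; [apply/cvg_ex; exists l|exact: cvg_lim].
apply/cvgrPdist_lt => eps eps0.
have K1 : 0 < `|K| + 1 by rewrite ltr_wpDl.
near=> t.
have t0 : t != 0 by near: t; exact: nbhs_dnbhs_neq.
have te : `|t| < e by near: t; exact: dnbhs0_lt.
have teps : `|t| < eps / (`|K| + 1) by near: t; apply: dnbhs0_lt; rewrite divr_gt0.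
rewrite /= (addrC _ x) distrC.
have -> : t^-1 *: (f (x + t *: v) - f x) - l = t^-1 * (f (x + t *: v) - f x - t * l).
  by rewrite mulrBr mulrA mulVf// mul1r.
rewrite normrM normfV ltr_pdivrMl ?normr_gt0//.
apply: le_lt_trans (h _ te) _.
apply: (@le_lt_trans _ _ (`|K| * `|t| ^+ 2)).
  by rewrite real_normK ?num_real// ler_wpM2r ?sqr_ge0// ler_norm.
rewrite expr2 mulrA mulrC ltr_pM2l ?normr_gt0//.
apply: (@le_lt_trans _ _ ((`|K| + 1) * `|t|)); first by rewrite ler_wpM2r// lerDl.
by rewrite mulrC -ltr_pdivlMr.
Unshelve. all: by end_near. Qed.

(** Subtracting the linear part at [x] leaves a function whose partial derivatives are increments of
    those of [q]; Markov's inequality, used for [q] and again for its partial derivatives, bounds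
    these increments by the distance. *)
Lemma isQ_taylor p (q : 'rV[R]_d -> R) M x y : isQ p q -> 0 <= M ->
  (forall z, ref_cellc z -> `|q z| <= M) -> ref_cellc x -> ref_cellc y ->
  `|q y - q x - \sum_k (y - x) 0 k * partial k q x| <=
     (2 * p%:R ^+ 2) ^+ 2 * M * d%:R ^+ 2 * `|y - x| ^+ 2.
Proof.
move=> hq M0 qM xr yr.
pose g z := q z + \sum_k (- partial k q x) * z 0 k.
have lq := isQ_lpoly hq.
have lc (a : R) k : lpoly (fun z : 'rV[R]_d => a * z 0 k).
  by apply: lpolyM; [exact: lpoly_cst|exact: lpoly_coord].
have lg : lpoly g by apply: lpolyD => //; apply: lpoly_sum.
have pg k z : partial k g z = partial k q z - partial k q x.
  rewrite partialD//; last exact: lpoly_sum.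
  rewrite partial_sum// (bigD1 k)//= partialZ ?partial_coord ?eqxx ?mulr1; last exact: lpoly_coord.
  rewrite big1 ?addr0// => j jk; rewrite partialZ ?partial_coord; last exact: lpoly_coord.
  by rewrite (negPf jk) mulr0.
have -> : q y - q x - \sum_k (y - x) 0 k * partial k q x = g y - g x.
  rewrite /g opprD addrACA; congr (_ + _).
  rewrite -sumrB -sumrN; apply: eq_bigr => k _; rewrite !mxE; ring.
pose lo : 'rV[R]_d := \row_k Num.min (x 0 k) (y 0 k).
pose hi : 'rV[R]_d := \row_k Num.max (x 0 k) (y 0 k).
pose L := 2 * p%:R ^+ 2 * (2 * p%:R ^+ 2 * M).
have L0 : 0 <= L by rewrite !mulr_ge0// ?exprn_ge0.
have box_r (z : 'rV[R]_d) : (forall k, lo 0 k <= z 0 k <= hi 0 k) -> ref_cellc z.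
  move=> h k; have := h k; have := xr k; have := yr k; rewrite !mxE.
  rewrite ge_min le_max => /andP[a1 a2] /andP[a3 a4] /andP[b1 b2].
  by case/orP: b1; case/orP: b2 => h1 h2; apply/andP; split; lra.
have box_d (z : 'rV[R]_d) : (forall k, lo 0 k <= z 0 k <= hi 0 k) -> forall k, `|z 0 k - x 0 k| <= `|y - x|.
  move=> h k; apply: le_trans (coord_norm _ k); rewrite !mxE.
  have := h k; rewrite !mxE ge_min le_max => /andP[b1 b2].
  rewrite ler_norml; have := ler_norm (y 0 k - x 0 k); have := ler_norm (- (y 0 k - x 0 k)).
  rewrite normrN; have := normr_ge0 (y 0 k - x 0 k).
  by case/orP: b1; case/orP: b2 => h1 h2 h3 h4 h5; apply/andP; split; lra.
have dp k (z : 'rV[R]_d) : (forall k, lo 0 k <= z 0 k <= hi 0 k) -> `|partial k q z - partial k q x| <= L * d%:R * `|y - x|.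
  move=> zb; have hpq := isQ_partial hq k.
  apply: (@le_trans _ _ (\sum_(j < d) L * `|z 0 j - x 0 j|)).
    apply: (lipschitz_partial (lo := const_mx (-1)) (hi := const_mx 1)).
    - exact: isQ_lpoly hpq.
    - move=> w hw j; have wr : ref_cellc w by move=> i; have := hw i; rewrite !mxE.
      apply: (isQ_markov hpq) => // u ur; exact: isQ_markov hq qM _ _ ur.
    - by move=> j; rewrite !mxE; exact: box_r zb j.
    - by move=> j; rewrite !mxE; exact: xr j.
  apply: (@le_trans _ _ (\sum_(j < d) L * `|y - x|)).
    by apply: ler_sum => j _; rewrite ler_wpM2l// box_d.
  by rewrite sumr_const card_ord -[X in X <= _]mulr_natr -mulrA (mulrC `|_|) mulrA.
have xb k : lo 0 k <= x 0 k <= hi 0 k by rewrite !mxE ge_min lexx le_max lexx.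
have yb k : lo 0 k <= y 0 k <= hi 0 k by rewrite !mxE ge_min lexx le_max lexx !orbT.
have := lipschitz_partial (M := fun=> L * d%:R * `|y - x|) lg _ yb xb.
move=> /(_ _)/le_trans; apply; first by move=> z zb k; rewrite pg dp.
apply: (@le_trans _ _ (\sum_(k < d) L * d%:R * `|y - x| * `|y - x|)).
  apply: ler_sum => k _; rewrite ler_wpM2l ?mulr_ge0//.
  by apply: le_trans (coord_norm _ k); rewrite !mxE.
rewrite sumr_const card_ord -[X in X <= _]mulr_natr /L.
by rewrite le_eqVlt; apply/orP; left; apply/eqP; ring.
Qed.

Lemma isQ_bounded p (q : 'rV[R]_d -> R) : isQ p q ->
  exists2 M, 0 <= M & forall z, ref_cellc z -> `|q z| <= M.
Proof.
move=> [c qc]; exists (\sum_a `|c a|); first exact: sumr_ge0.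
move=> z zr; rewrite qc; apply: le_trans (ler_norm_sum _ _ _) _; apply: ler_sum => a _.
rewrite normrM ler_piMr// /monom normr_prod.
apply: (@le_trans _ _ (\prod_(k < d) 1)); last by rewrite big1.
apply: ler_prod => k _; rewrite normr_ge0 normrX exprn_ile1//.
by rewrite ler_norml; exact: zr.
Qed.

Lemma ref_cellcS x : ref_cell x -> ref_cellc x.
Proof. by move=> xr k; have /andP[a b] := xr k; rewrite !ltW. Qed.

Lemma ref_cell_scale x t : ref_cellc x -> 0 <= t < 1 -> ref_cell (t *: x).
Proof.
move=> xr /andP[t0 t1] k; rewrite mxE; have /andP[z1 z2] := xr k.
by apply/andP; split; nra.
Qed.

End Analysis.

Section CellMap.
Variables (R : realType) (d : nat) (G : 'rV[R]_d -> 'rV[R]_d) (sigma dl : R).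
Hypothesis d0 : (0 < d)%N.
Hypothesis G_lin : forall k, isQ 1 (fun x => G x 0 k).
Hypothesis G_inj : {in @ref_cellc R d &, injective G}.
Hypothesis G_diam : forall x y, ref_cell x -> ref_cell y -> enorm (G x - G y) <= dl.
Hypothesis dl0 : 0 < dl.
Hypothesis sigma1 : 1 <= sigma.
Hypothesis G_reg : forall x v, ref_cellc x ->
  sigma^-1 * dl * enorm v <= enorm ('D_v G x) <= sigma * dl * enorm v.
Implicit Types (x y v w : 'rV[R]_d).

Definition jac x : 'M[R]_d := \matrix_(k, m) partial k (fun z => G z 0 m) x.

Lemma derive_jac x v : 'D_v G x = v *m jac x.
Proof.
rewrite derive_mx; last first.
  apply/derivable_mxP => i k; rewrite (ord1 i).
  by have [] := isQ_derive (G_lin k) v x.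
apply/rowP => m; rewrite !mxE.
have [_ ->] := isQ_derive (G_lin m) v x.
by apply: eq_bigr => k _; rewrite !mxE.
Qed.

Lemma jac_reg x v : ref_cellc x -> sigma^-1 * dl * enorm v <= enorm (v *m jac x) <= sigma * dl * enorm v.
Proof. by rewrite -derive_jac; exact: G_reg. Qed.

Let sigma0 : 0 < sigma. Proof. exact: lt_le_trans sigma1. Qed.

Lemma jac_unit x : ref_cellc x -> jac x \in unitmx.
Proof.
move=> xr; rewrite -row_free_unit; apply/row_freeP; apply: contrapT => nf.
have : ~~ row_free (jac x) by apply/negP => /row_freeP.
rewrite -kermx_eq0 => /rowV0Pn[v /sub_kermxP vJ v0].
have /andP[+ _] := jac_reg v xr; rewrite vJ.
rewrite (_ : enorm 0 = 0); last by apply/eqP; rewrite enorm_eq0.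
rewrite leNgt mulr_gt0//; first by rewrite mulr_gt0 ?invr_gt0.
by rewrite lt_neqAle enorm_ge0 andbT eq_sym enorm_eq0.
Qed.

Lemma G_continuous : continuous G.
Proof. by apply: continuous_rV => k; exact: isQ_continuous. Qed.

Lemma G_line x k t : G (x + t *: unitv R k) = G x + t *: (unitv R k *m jac x).
Proof.
apply/rowP => m; rewrite -derive_jac !mxE.
have [P sP GP] := isQ_line (G_lin m) k x.
rewrite GP; have := GP 0; rewrite scale0r addr0 => ->.
rewrite derive_jac -rowE !mxE.
have [_] := @partial_line _ _ k (fun z => G z 0 m) x P GP 0; rewrite scale0r addr0 => ->.
have -> : P = (P`_0)%:P + P`_1 *: 'X.
  apply/polyP => -[|[|i]]; rewrite coefD coefC coefZ coefX /= ?mulr0 ?mulr1 ?addr0 ?add0r//.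
  by rewrite nth_default// (leq_trans sP).
by rewrite derivD derivC derivZ derivX add0r !(hornerD, hornerC, hornerZ, hornerX); ring.
Qed.

(** Both parameters are shrunk towards 0 into the open cell, and the bound passes to the limit. *)
Lemma G_diamc x y : ref_cellc x -> ref_cellc y -> enorm (G x - G y) <= dl.
Proof.
move=> xr yr.
pose f (t : R) := enorm (G (t *: x) - G (t *: y)).
have cf : continuous f.
  have cs z : continuous (fun t : R => G (t *: z)).
    move=> t; apply: (@continuous_comp R 'rV[R]_d 'rV[R]_d (fun t => t *: z) G); last exact: G_continuous.
    exact: scalel_continuous.
  move=> t; apply: (@continuous_comp R 'rV[R]_d R (fun t => G (t *: x) - G (t *: y)) (@enorm R d)); last exact: enorm_continuous.
  by apply: (@continuousB R 'rV[R]_d R (fun t => G (t *: x)) (fun t => G (t *: y))); exact: cs.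
rewrite leNgt; apply/negP => h.
have f1 : f 1 > dl by rewrite /f !scale1r.
have : \forall t \near (1 : R), dl < f t.
  have := cf 1; move/cvgrPdist_lt => /(_ (f 1 - dl)); rewrite subr_gt0 => /(_ f1).
  by apply: filterS => t; rewrite ltr_norml => /andP[_]; lra.
move=> [e /= e0 he].
pose t := Num.max 0 (1 - e / 2).
have t01 : 0 <= t < 1 by rewrite /t le_max lexx/= gt_max ltr01/=; lra.
have := he t; rewrite /ball_/=.
have te : `|1 - t| < e.
  rewrite ger0_norm ?subr_ge0; last by case/andP: t01 => _ /ltW.
  have : 1 - e / 2 <= t by rewrite /t le_max lexx orbT.
  lra.
by move=> /(_ te); rewrite ltNge G_diam//; exact: ref_cell_scale.
Qed.

(** The constant of the quadratic Taylor remainder relative to the cell diameter: 4 from two uses of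
    Markov's inequality in degree one, [d^2] from two sums over coordinates, one more [d] from
    passing to the Euclidean norm. Locked so that it stays an atom in arithmetic. *)
Definition K0 : R := locked (4 * d%:R ^+ 3).

Lemma K0E : K0 = 4 * d%:R ^+ 3. Proof. by rewrite /K0 -lock. Qed.

Lemma K0_ge1 : 1 <= K0.
Proof.
have h : 1 <= d%:R :> R by rewrite ler1n.
have h3 : 1 <= d%:R ^+ 3 :> R by rewrite exprn_ege1.
rewrite K0E; lra.
Qed.

Lemma K0_gt0 : 0 < K0. Proof. exact: lt_le_trans ltr01 K0_ge1. Qed.

Lemma G_taylor x y : ref_cellc x -> ref_cellc y ->
  enorm (G y - G x - (y - x) *m jac x) <= K0 * dl * `|y - x| ^+ 2.
Proof.
move=> xr yr; apply: le_trans (enorm_le_norm _) _.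
have -> : K0 * dl * `|y - x| ^+ 2 = d%:R * (4 * dl * d%:R ^+ 2 * `|y - x| ^+ 2).
  by rewrite K0E; ring.
apply: ler_wpM2l => //; apply: norm_rV_le => [|m]; first by rewrite !mulr_ge0// ltW.
pose g z := G z 0 m + - G x 0 m.
have hg : isQ 1 g.
  have := @isQ_sum R d 1 bool (fun b z => if b then G z 0 m else - G x 0 m).
  rewrite (_ : (fun z => \sum_b _) = g); last by apply/funext => z; rewrite big_bool.
  by apply=> -[]; [exact: G_lin|exact: isQ_cst].
have := isQ_taylor hg (ltW dl0) _ xr yr; rewrite expr1n mulr1 => /(_ _).
rewrite (_ : (2 : R) ^+ 2 = 4); last by ring.
rewrite (_ : g y - g x - _ = (G y - G x - (y - x) *m jac x) 0 m).
  apply=> z zr; apply: le_trans (G_diamc zr xr).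
  by apply: le_trans (coord_enorm _ m); rewrite !mxE.
have -> : g x = 0 by rewrite /g subrr.
rewrite subr0 !mxE /g; congr (_ - _).
apply: eq_bigr => k _; rewrite !mxE; congr (_ * _).
rewrite partialD ?partial_cst ?addr0//; [exact: isQ_lpoly (G_lin m)|exact: lpoly_cst].
Qed.

(** For [r] up to this radius the remainder [K0 dl r^2] is at most half of the lower bound
    [dl r / sigma] of the linear part. It is a length in the reference cell, hence independent of
    [dl]. *)
Definition rho0 : R := (2 * K0 * sigma)^-1.

Lemma rho0_gt0 : 0 < rho0.
Proof. by rewrite invr_gt0 !mulr_gt0// K0_gt0. Qed.

Lemma G_lower x y : ref_cellc x -> ref_cellc y -> `|y - x| <= rho0 ->
  dl / (2 * sigma) * `|y - x| <= enorm (G y - G x).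
Proof.
move=> xr yr xy.
have /andP[h1 _] := jac_reg (y - x) xr.
have h2 := G_taylor xr yr.
have h3 := enormD (G y - G x) (- (G y - G x - (y - x) *m jac x)).
rewrite subKr enormN in h3.
have h4 := norm_le_enorm (y - x).
have h5 : K0 * dl * `|y - x| ^+ 2 <= dl / (2 * sigma) * `|y - x|.
  rewrite expr2 mulrA ler_wpM2r//.
  apply: (@le_trans _ _ (K0 * dl * rho0)).
    by rewrite ler_wpM2l ?mulr_ge0 ?(ltW K0_gt0)// ltW.
  rewrite /rho0 le_eqVlt; apply/orP; left; apply/eqP.
  field; rewrite gt_eqF//= gt_eqF// K0_gt0//.
have h6 : dl / (2 * sigma) * `|y - x| + dl / (2 * sigma) * `|y - x| <= sigma^-1 * dl * enorm (y - x).
  apply: (@le_trans _ _ (sigma^-1 * dl * `|y - x|)).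
    rewrite le_eqVlt; apply/orP; left; apply/eqP; field; rewrite gt_eqF//.
  by rewrite ler_wpM2l// mulr_ge0 ?invr_ge0 ?ltW.
lra.
Qed.

(* At a minimum of [|G x - y|] in the interior of the cube, the derivatives of [G] are orthogonal to
   [G x - y]; they span R^d. *)
Lemma G_cover xi rho y : 0 < rho <= rho0 ->
  (forall z, `|z - xi| <= rho -> ref_cellc z) ->
  enorm (y - G xi) < dl * rho / (4 * sigma) ->
  exists2 x, `|x - xi| < rho & G x = y.
Proof.
move=> /andP[rho_gt0 rho_le] ballr ylt.
pose f x := enorm (G x - y).
have cf : continuous f.
  move=> z; apply: (@continuous_comp 'rV[R]_d 'rV[R]_d R (fun z => G z - y) (@enorm R d)); last exact: enorm_continuous.
  by apply: (@continuousB R 'rV[R]_d 'rV[R]_d G (fun=> y)); [exact: G_continuous|exact: cst_continuous].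
pose K := [set x : 'rV[R]_d | forall k, xi 0 k - rho <= x 0 k <= xi 0 k + rho].
have KP z : K z <-> `|z - xi| <= rho.
  split=> [h|h k].
    apply: norm_rV_le => [|k]; first exact: ltW.
    by have := h k; rewrite !mxE ler_norml => /andP[a b]; apply/andP; split; lra.
  have := le_trans (coord_norm _ k) h; rewrite !mxE ler_norml => /andP[a b].
  by apply/andP; split; lra.
have Kxi : K xi by apply/KP; rewrite subrr normr0 ltW.
have [x0 x0K x0min] := @compact_EVT_min _ _ f K (ex_intro _ xi Kxi)
   (@box_compact _ _ (fun k => xi 0 k - rho) (fun k => xi 0 k + rho)) (continuous_subspaceT cf).
have {}x0K : `|x0 - xi| <= rho by apply/KP; rewrite inE in x0K.
have {}x0min z : `|z - xi| <= rho -> f x0 <= f z by move=> /KP zK; apply: x0min; rewrite inE.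
have xir : ref_cellc xi by apply: ballr; rewrite subrr normr0 ltW.
have x0r : ref_cellc x0 by exact: ballr.
(* A minimiser at distance [rho] from [xi] would be mapped at least [dl rho / (2 sigma)] away from
   [G xi], twice the bound on the distance of [y], and [xi] itself would do better. *)
have x0lt : `|x0 - xi| < rho.
  rewrite lt_neqAle x0K andbT; apply/eqP => e.
  have h1 := G_lower xir x0r; rewrite e in h1; have {}h1 := h1 rho_le.
  have h2 := enormD (G x0 - y) (y - G xi); rewrite addrA subrK in h2.
  have h3 : f x0 <= f xi by apply: x0min; rewrite subrr normr0 ltW.
  rewrite /f -[X in _ <= enorm X]opprB enormN in h3.
  have h4 : dl / (2 * sigma) * rho = dl * rho / (4 * sigma) + dl * rho / (4 * sigma).
    by field; rewrite gt_eqF.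
  lra.
exists x0 => //.
pose w := G x0 - y.
pose D k := unitv R k *m jac x0.
(* [G] is affine along coordinate lines, so the squared distance to [y] is an exact quadratic in [t]
   with its minimum at [t = 0]; the linear coefficient vanishes. *)
have orth k : dotv w (D k) = 0.
  have quad (a b eps : R) : 0 < eps -> (forall t, `|t| <= eps -> 0 <= 2 * t * b + t ^+ 2 * a) -> b = 0.
    move=> eps0 h; apply/eqP; apply: contraT => b0.
    have nb : 0 < `|b| by rewrite normr_gt0.
    have na : 0 < `|a| + 1 by rewrite ltr_wpDl.
    pose s := Num.min (eps / `|b|) (`|a| + 1)^-1.
    have s0 : 0 < s by rewrite lt_min divr_gt0//= invr_gt0.
    have s1 : s * `|b| <= eps by rewrite -ler_pdivlMr// ge_min lexx.
    have s2 : s * (`|a| + 1) <= 1 by rewrite -ler_pdivlMr// div1r ge_min lexx orbT.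
    have := h (- b * s); rewrite normrM normrN (gtr0_norm s0) mulrC => /(_ s1).
    have s3 : s * a <= 1.
      by apply: le_trans s2; apply: ler_wpM2l; [exact: ltW|have := ler_norm a; lra].
    have b2 : 0 < b ^+ 2 by rewrite exprn_even_gt0.
    have : 0 < b ^+ 2 * s by rewrite mulr_gt0.
    have -> : 2 * (- b * s) * b + (- b * s) ^+ 2 * a = - (b ^+ 2 * s) * (2 - s * a) by ring.
    move=> h1 h2; exfalso; nra.
  apply: (quad (dotv (D k) (D k)) _ (rho - `|x0 - xi|)); first by rewrite subr_gt0.
  move=> t ht.
  have hb : `|x0 + t *: unitv R k - xi| <= rho.
    rewrite addrAC; apply: le_trans (ler_normD _ _) _.
    have : `|t *: unitv R k| <= `|t|.
      by rewrite normrZ ler_piMr// (le_trans (norm_le_enorm _))// enorm_unitv.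
    lra.
  have := x0min _ hb; rewrite /f G_line -addrAC -/w -/(D k).
  rewrite -(@ler_pXn2r _ 2)// ?nnegrE ?enorm_ge0// !enorm_sqr.
  by clearbody w; rewrite dotvDl !dotvDr !dotvZl !dotvZr (dotvC (D k)); lra.
have w0 : w *m (jac x0)^T = 0.
  apply/rowP => k; rewrite [RHS]mxE -(orth k) mxE /dotv; apply: eq_bigr => m _.
  by rewrite /D -rowE !mxE.
apply/eqP; rewrite -subr_eq0 -/w.
have JT : (jac x0)^T \in unitmx by rewrite unitmx_tr jac_unit.
by rewrite -(mulmxK JT w) w0 mul0mx.
Qed.

Lemma ref_cell_nbhs x : ref_cell x -> exists2 e : R, 0 < e & forall z, `|z - x| <= e -> ref_cell z.
Proof.
move=> xr.
pose e := (1 - `|x|) / 2.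
have x1 : `|x| < 1 by apply: norm_rV_lt => // k; rewrite ltr_norml; exact: xr.
have e0 : 0 < e by rewrite divr_gt0// subr_gt0.
exists e => // z zx k.
have h := le_trans (coord_norm (z - x) k) zx; have h2 := coord_norm x k.
rewrite !mxE in h; rewrite -ltr_norml.
have := ler_normD (z 0 k - x 0 k) (x 0 k); rewrite subrK => h3.
move: e0 h; rewrite /e => e0 h; lra.
Qed.

Lemma G_cover_small x : ref_cell x -> exists2 e : R, 0 < e & forall y, enorm (y - G x) < e ->
  exists2 z, ref_cell z & G z = y /\ `|z - x| <= 8 * sigma / dl * enorm (y - G x).
Proof.
move=> xr; have [e e0 er] := ref_cell_nbhs xr.
pose m := Num.min e rho0; have m0 : 0 < m by rewrite lt_min e0 rho0_gt0.
have s8 : 0 < 8 * sigma / dl by rewrite divr_gt0 ?mulr_gt0.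
exists (m / (8 * sigma / dl)); first by rewrite divr_gt0.
move=> y; rewrite ltr_pdivlMr// => ye.
have [->|yx] := eqVneq y (G x).
  by exists x => //; split=> //; rewrite !subrr normr0 mulr_ge0 ?enorm_ge0// ltW.
(* A radius proportional to the distance of [y] is what makes the inverse Lipschitz; the factor 8
   makes the covered radius twice that distance. *)
pose rho := 8 * sigma / dl * enorm (y - G x).
have en : 0 < enorm (y - G x) by rewrite lt_neqAle enorm_ge0 andbT eq_sym enorm_eq0 subr_eq0.
have rho_gt0 : 0 < rho by rewrite mulr_gt0.
have rm : rho < m by rewrite /rho mulrC.
have := rm; rewrite lt_min => /andP[re r0].
have c1 : 0 < rho <= rho0 by rewrite rho_gt0 ltW.
have c2 z : `|z - x| <= rho -> ref_cellc z.
  by move=> zx; apply: ref_cellcS; apply: er; rewrite (le_trans zx)// ltW.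
have c3 : enorm (y - G x) < dl * rho / (4 * sigma).
  have -> : dl * rho / (4 * sigma) = 2 * enorm (y - G x).
    by rewrite /rho; field; rewrite !gt_eqF.
  lra.
have [z zx zy] := G_cover c1 c2 c3.
exists z; last by split=> //; exact: ltW.
by apply: er; rewrite ltW// (lt_trans zx).
Qed.

(** The inverse of [G] enters only through its Lipschitz bound: with it, the preimage of
    [G x + t e_k] is [x + t w + O(t^2)], and Taylor's formula for [q] then leaves a quadratic
    remainder for [u]. *)
Lemma chain_rule p (q u : 'rV[R]_d -> R) x k : isQ p q ->
  (forall z, ref_cell z -> u (G z) = q z) -> ref_cell x ->
  derivable u (G x) (delta_mx 0 k) /\
  partial k u (G x) = \sum_l (unitv R k *m invmx (jac x)) 0 l * partial l q x.
Proof.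
move=> hq uq xr.
have xrc := ref_cellcS xr.
have [M M0 qM] := isQ_bounded hq.
have [e e0 cov] := G_cover_small xr.
pose w := unitv R k *m invmx (jac x).
pose C := 8 * sigma / dl.
have C0 : 0 < C by rewrite divr_gt0 ?mulr_gt0.
pose N := \sum_l `|partial l q x|.
have N0 : 0 <= N by apply: sumr_ge0.
pose Kq := (2 * p%:R ^+ 2) ^+ 2 * M * d%:R ^+ 2.
have Kq0 : 0 <= Kq by rewrite /Kq !mulr_ge0// ?sqr_ge0.
apply: (@taylor_derivable R d u (G x) (unitv R k) _ (Kq * C ^+ 2 + sigma / dl * (K0 * dl * C ^+ 2) * N) e) => // t te.
have et : enorm (G x + t *: unitv R k - G x) = `|t|.
  by rewrite addrC addKr enormZ enorm_unitv mulr1.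
have [|z zr [zy zx]] := cov (G x + t *: unitv R k); first by rewrite et.
rewrite et -/C in zx.
have zx2 : `|z - x| ^+ 2 <= C ^+ 2 * t ^+ 2.
  rewrite -[t ^+ 2]real_normK ?num_real// -exprMn ler_pXn2r ?nnegrE//; exact: mulr_ge0 (ltW C0) _.
have zrc := ref_cellcS zr.
have h1 := G_taylor xrc zrc; rewrite zy (addrC (G x)) addrK in h1.
have h2 : enorm (z - x - t *: w) <= sigma / dl * (K0 * dl * (C ^+ 2 * t ^+ 2)).
  have /andP[+ _] := jac_reg (z - x - t *: w) xrc.
  rewrite mulmxBl -scalemxAl mulmxKV ?jac_unit// -[X in _ <= X]enormN opprB => h3.
  have h4 : enorm (t *: unitv R k - (z - x) *m jac x) <= K0 * dl * (C ^+ 2 * t ^+ 2).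
    by apply: le_trans h1 _; rewrite ler_wpM2l// mulr_ge0 ?(ltW K0_gt0)// ltW.
  have h5 := le_trans h3 h4.
  have -> : enorm (z - x - t *: w) = sigma / dl * (sigma^-1 * dl * enorm (z - x - t *: w)).
    by field; rewrite !gt_eqF.
  by rewrite ler_wpM2l// divr_ge0// ltW.
have h3 := isQ_taylor hq M0 qM xrc zrc.
rewrite -zy !uq//.
have -> : q z - q x - t * (\sum_l w 0 l * partial l q x) =
  (q z - q x - \sum_l (z - x) 0 l * partial l q x) + \sum_l (z - x - t *: w) 0 l * partial l q x.
  rewrite mulr_sumr -[RHS]addrA; congr (_ + _).
  rewrite -!sumrN -big_split/=; apply: eq_bigr => l _; rewrite !mxE; ring.
apply: le_trans (ler_normD _ _) _.
rewrite mulrDl; apply: lerD.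
  apply: le_trans h3 _; rewrite -[Kq * _ * _]mulrA; exact: ler_wpM2l.
apply: le_trans (ler_norm_sum _ _ _) _.
apply: (@le_trans _ _ (\sum_l enorm (z - x - t *: w) * `|partial l q x|)).
  apply: ler_sum => l _; rewrite normrM; apply: ler_wpM2r => //; exact: coord_enorm.
rewrite -mulr_sumr -/N.
have -> : sigma / dl * (K0 * dl * C ^+ 2) * N * t ^+ 2 = sigma / dl * (K0 * dl * (C ^+ 2 * t ^+ 2)) * N by ring.
by apply: ler_wpM2r.
Qed.

Lemma grad_upper p (q u : 'rV[R]_d -> R) x k M : isQ p q -> 
  (forall z, ref_cell z -> u (G z) = q z) -> (forall z, ref_cellc z -> `|q z| <= M) -> ref_cell x ->
  `|partial k u (G x)| <= d%:R * (sigma / dl) * (2 * p%:R ^+ 2 * M).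
Proof.
move=> hq uq qM xr; have xrc := ref_cellcS xr.
have [_ ->] := chain_rule k hq uq xr.
have ew : enorm (unitv R k *m invmx (jac x)) <= sigma / dl.
  have /andP[+ _] := jac_reg (unitv R k *m invmx (jac x)) xrc.
  rewrite mulmxKV ?jac_unit// enorm_unitv => h.
  set e := enorm _ in h *.
  have -> : e = sigma / dl * (sigma^-1 * dl * e) by field; rewrite !gt_eqF.
  by rewrite -[X in _ <= X]mulr1 ler_wpM2l// divr_ge0// ltW.
apply: le_trans (ler_norm_sum _ _ _) _.
apply: (@le_trans _ _ (\sum_(l < d) sigma / dl * (2 * p%:R ^+ 2 * M))).
  apply: ler_sum => l _; rewrite normrM; apply: ler_pM => //.
    exact: le_trans (coord_enorm _ _) ew.
  exact: isQ_markov hq qM _ _ xrc.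
by rewrite sumr_const card_ord -[X in X <= _]mulr_natr -!mulrA [X in _ <= X]mulrC -!mulrA.
Qed.

Lemma grad_pullback p (q u : 'rV[R]_d -> R) x l : isQ p q ->
  (forall z, ref_cell z -> u (G z) = q z) -> ref_cell x ->
  partial l q x = dotv (unitv R l *m jac x) (\row_m partial m u (G x)).
Proof.
move=> hq uq xr; have xrc := ref_cellcS xr.
pose gq : 'cV[R]_d := \col_j partial j q x.
have gu : (\row_m partial m u (G x))^T = invmx (jac x) *m gq.
  apply/colP => m; rewrite !mxE; have [_ ->] := chain_rule m hq uq xr.
  by apply: eq_bigr => j _; rewrite -rowE !mxE.
have : jac x *m (\row_m partial m u (G x))^T = gq by rewrite gu mulKVmx ?jac_unit.
move/(congr1 (fun A : 'cV[R]_d => A l 0)); rewrite [gq l 0]mxE => <-.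
by rewrite mxE /dotv; apply: eq_bigr => m _; rewrite -rowE !mxE.
Qed.

(* The partial derivative that is largest at some point stays comparable to its maximum on a cube of
   side of order [p^-2]. *)
Lemma grad_lower p (q u : 'rV[R]_d -> R) a b : (0 < p)%N -> isQ p q ->
  (forall z, ref_cell z -> u (G z) = q z) -> ref_cellc a -> ref_cellc b ->
  exists c, forall y, enorm (y - c) < dl * (rho0 / p%:R ^+ 2) / (4 * sigma) ->
    (exists2 x, ref_cell x & G x = y) /\
    (q a - q b) ^+ 2 <= 16 * d%:R ^+ 4 * sigma ^+ 2 * dl ^+ 2 * \sum_k partial k u y ^+ 2.
Proof.
move=> p0 hq uq ar br.
have d1 : 1 <= d%:R :> R by rewrite ler1n.
have p1 : 1 <= p%:R :> R by rewrite ler1n.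
pose F x := \sum_k `|partial k q x|.
have cF : continuous F.
  rewrite /F; elim: (index_enum _) => [|k s IH].
    rewrite (_ : (fun x => _) = cst 0) => [|]; last by apply/funext => x; rewrite big_nil.
    exact: cst_continuous.
  rewrite (_ : (fun x => _) = (fun x => `|partial k q x|) + (fun x => \sum_(k <- s) `|partial k q x|)); last first.
    by apply/funext => x; rewrite big_cons.
  move=> x; apply: continuousD; last exact: IH.
  apply: (@continuous_comp _ _ _ (partial k q) (fun z => `|z|)); last exact: norm_continuous.
  exact: isQ_continuous (isQ_partial hq k) _.
have [x0 x0r x0max] := @compact_EVT_max _ _ F (@ref_cellc R d) (ex_intro _ a ar)
   (@ref_cellc_compact R d) (continuous_subspaceT cF).
rewrite inE in x0r.
pose S := F x0.
have S0 : 0 <= S by apply: sumr_ge0.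
have pS k z : ref_cellc z -> `|partial k q z| <= S.
  move=> zr; apply: (@le_trans _ _ (F z)); last by apply: x0max; rewrite inE.
  by rewrite /F (bigD1 k)//= lerDl sumr_ge0.
have [k0 hk0] : exists k, S / d%:R <= `|partial k q x0|.
  apply: contrapT => /forallNP h.
  have : S < \sum_(k < d) (S / d%:R).
    apply: ltr_sum => [|k _]; last by rewrite ltNge; apply/negP; exact: h.
    by apply/hasP; exists (Ordinal d0) => //; rewrite mem_index_enum.
  by rewrite sumr_const card_ord -[X in _ < X]mulr_natr divfK ?ltxx// pnatr_eq0 -lt0n.
pose rho := rho0 / p%:R ^+ 2.
have p2 : 1 <= p%:R ^+ 2 :> R by rewrite exprn_ege1.
have rho_gt0 : 0 < rho by rewrite divr_gt0 ?rho0_gt0// (lt_le_trans ltr01 p2).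
have rho_le : rho <= rho0.
  by rewrite ler_pdivrMr ?(lt_le_trans ltr01 p2)// ler_peMr// ltW// rho0_gt0.
have rho_r : rho <= (8 * d%:R ^+ 2 * p%:R ^+ 2)^-1.
  rewrite /rho /rho0 -invfM lef_pV2 ?posrE ?mulr_gt0 ?K0_gt0 ?(lt_le_trans ltr01 p2) ?exprn_gt0 ?ltr0n//.
  rewrite ler_wpM2r ?(le_trans ler01 p2)// K0E.
  have d2 : 1 <= d%:R ^+ 2 :> R by rewrite exprn_ege1.
  have h : d%:R ^+ 2 <= d%:R ^+ 3 * sigma.
    rewrite (exprSr _ 2) -mulrA ler_peMr ?(le_trans ler01 d2)//.
    by rewrite (le_trans d1)// ler_peMr// (le_trans ler01 d1).
  lra.
(* The maximum point [x0] may lie on the boundary of the reference cell; shrinking it leaves room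
   for a cube of radius [rho]. *)
pose xi := (1 - rho) *: x0.
have rho1 : rho <= 1.
  apply: le_trans rho_r _; rewrite invf_le1 ?mulr_gt0 ?exprn_gt0 ?ltr0n//.
  have d2 : 1 <= d%:R ^+ 2 :> R by rewrite exprn_ege1.
  have : 1 <= d%:R ^+ 2 * p%:R ^+ 2 :> R by rewrite mulr_ege1.
  lra.
have x0n : `|x0| <= 1 by apply: norm_rV_le => // k; rewrite ler_norml; exact: x0r.
have ballr z : `|z - xi| <= rho -> ref_cellc z.
  move=> zx k; rewrite -ler_norml; apply: le_trans (coord_norm _ _) _.
  rewrite -(subrK xi z); apply: le_trans (ler_normD _ _) _.
  rewrite /xi normrZ (ger0_norm (_ : 0 <= 1 - rho)) ?subr_ge0//.
  have : (1 - rho) * `|x0| <= 1 - rho by rewrite ler_piMr// subr_ge0.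
  lra.
have ballr2 z : `|z - xi| < rho -> ref_cell z.
  move=> zx k; rewrite -ltr_norml; apply: le_lt_trans (coord_norm _ _) _.
  rewrite -(subrK xi z); apply: le_lt_trans (ler_normD _ _) _.
  rewrite /xi normrZ (ger0_norm (_ : 0 <= 1 - rho)) ?subr_ge0//.
  have : (1 - rho) * `|x0| <= 1 - rho by rewrite ler_piMr// subr_ge0.
  lra.
have ballx0 z : `|z - xi| <= rho -> `|z - x0| <= (4 * d%:R ^+ 2 * p%:R ^+ 2)^-1.
  move=> zx; have -> : z - x0 = (z - xi) - rho *: x0.
    by rewrite /xi scalerBl scale1r opprB addrA addrAC addrK.
  apply: le_trans (ler_normB _ _) _; rewrite normrZ (gtr0_norm rho_gt0).
  have : rho * `|x0| <= rho by rewrite ler_piMr// ltW.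
  have -> : (4 * d%:R ^+ 2 * p%:R ^+ 2)^-1 = (8 * d%:R ^+ 2 * p%:R ^+ 2)^-1 + (8 * d%:R ^+ 2 * p%:R ^+ 2)^-1 :> R.
    by field; rewrite !pnatr_eq0 -!lt0n d0 p0.
  lra.
(* By Markov's inequality for [partial k0 q], which is bounded by [S], this derivative changes by at
   most [S / (2 d)] on the cube, half of the lower bound [S / d] for its modulus at [x0]. *)
have low z : `|z - xi| <= rho -> S <= 2 * d%:R * `|partial k0 q z|.
  move=> zx; have zr := ballr z zx.
  have hp := isQ_partial hq k0.
  have : `|partial k0 q x0 - partial k0 q z| <= \sum_(j < d) 2 * p%:R ^+ 2 * S * `|x0 0 j - z 0 j|.
    apply: (lipschitz_partial (lo := const_mx (-1)) (hi := const_mx 1)).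
    - exact: isQ_lpoly hp.
    - move=> w hw j; have wr : ref_cellc w by move=> i; have := hw i; rewrite !mxE.
      apply: (isQ_markov hp) => // v vr; exact: pS.
    - by move=> j; rewrite !mxE; exact: x0r j.
    - by move=> j; rewrite !mxE; exact: zr j.
  have : \sum_(j < d) 2 * p%:R ^+ 2 * S * `|x0 0 j - z 0 j| <= \sum_(j < d) 2 * p%:R ^+ 2 * S * (4 * d%:R ^+ 2 * p%:R ^+ 2)^-1.
    apply: ler_sum => j _; rewrite ler_wpM2l ?mulr_ge0 ?exprn_ge0//.
    rewrite distrC; apply: le_trans _ (ballx0 z zx).
    by apply: le_trans (coord_norm _ j); rewrite !mxE.
  rewrite sumr_const card_ord -[X in _ <= X -> _]mulr_natr.
  have -> : 2 * p%:R ^+ 2 * S * (4 * d%:R ^+ 2 * p%:R ^+ 2)^-1 * d%:R = S / d%:R / 2 :> R.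
    by field; rewrite !pnatr_eq0 -!lt0n d0 p0.
  move=> h1 h2.
  have h3 := le_trans h2 h1.
  have h4 := ler_normD (partial k0 q x0 - partial k0 q z) (partial k0 q z); rewrite subrK in h4.
  have h5 : S / d%:R / 2 <= `|partial k0 q z| by lra.
  have -> : S = 2 * d%:R * (S / d%:R / 2) by field; rewrite pnatr_eq0 -lt0n d0.
  by rewrite ler_wpM2l// mulr_ge0.
have osc : `|q a - q b| <= 2 * d%:R * S.
  have : `|q a - q b| <= \sum_(j < d) S * `|a 0 j - b 0 j|.
    apply: (lipschitz_partial (M := fun=> S) (lo := const_mx (-1)) (hi := const_mx 1)).
    - exact: isQ_lpoly hq.
    - by move=> w hw j; apply: pS => i; have := hw i; rewrite !mxE.
    - by move=> j; rewrite !mxE; exact: ar j.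
    - by move=> j; rewrite !mxE; exact: br j.
  move=> /le_trans; apply.
  apply: (@le_trans _ _ (\sum_(j < d) S * 2)).
    apply: ler_sum => j _; rewrite ler_wpM2l// ler_norml.
    by have /andP[? ?] := ar j; have /andP[? ?] := br j; apply/andP; split; lra.
  by rewrite sumr_const card_ord -[X in X <= _]mulr_natr [X in _ <= X]mulrC mulrA.
exists (G xi) => y hy.
have [|z zx zy] := @G_cover xi rho y _ ballr hy; first by rewrite rho_gt0 rho_le.
have zr := ballr2 z zx.
split; first by exists z.
have hz := low z (ltW zx).
set g : 'rV[R]_d := \row_m partial m u (G z).
have hg : `|partial k0 q z| <= sigma * dl * enorm g.
  rewrite (grad_pullback k0 hq uq zr); apply: le_trans (dotv_le _ _) _.
  apply: ler_wpM2r; first exact: enorm_ge0.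
  by have /andP[_] := jac_reg (unitv R k0) (ref_cellcS zr); rewrite enorm_unitv mulr1.
have -> : \sum_k partial k u y ^+ 2 = enorm g ^+ 2.
  by rewrite enorm_sqr /dotv; apply: eq_bigr => k _; rewrite !mxE zy expr2.
have h6 : `|q a - q b| <= 4 * d%:R ^+ 2 * (sigma * dl * enorm g).
  apply: le_trans osc _.
  apply: (@le_trans _ _ (2 * d%:R * (2 * d%:R * `|partial k0 q z|))).
    by rewrite ler_wpM2l// mulr_ge0.
  have -> : 2 * d%:R * (2 * d%:R * `|partial k0 q z|) = 4 * d%:R ^+ 2 * `|partial k0 q z| by ring.
  by rewrite ler_wpM2l// mulr_ge0// exprn_ge0.
rewrite -[X in X <= _]real_normK ?num_real//.
apply: (@le_trans _ _ ((4 * d%:R ^+ 2 * (sigma * dl * enorm g)) ^+ 2)).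
  by rewrite ler_pXn2r ?nnegrE// !mulr_ge0 ?enorm_ge0 ?exprn_ge0// ltW.
by rewrite le_eqVlt; apply/orP; left; apply/eqP; ring.
Qed.

End CellMap.

(** * Integration over subsets of R^d *)

Section LebesgueRd.
Variable R : realType.

Definition leb_pre n (D : set 'rV[R]_n) : set (leb_type (lebesgueRd R n)) :=
  leb_pt (l := lebesgueRd R n) @^-1` D.

Lemma leb_pt0 n (z : leb_type (lebesgueRd R n.+1)) : leb_pt z 0 ord0 = z.2.
Proof. by rewrite /= mxE; case: splitP => [j _|//]; rewrite mxE. Qed.

Lemma leb_ptS n (z : leb_type (lebesgueRd R n.+1)) j : leb_pt z 0 (lift ord0 j) = leb_pt z.1 0 j.
Proof.
rewrite /= mxE; case: splitP => [i|i] /=; first by rewrite (ord1 i).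
by rewrite /bump /= !add1n => -[ij]; congr (leb_pt _ _ _); apply/val_inj.
Qed.

Lemma measurable_leb_coord n k : measurable_fun setT (fun t : leb_type (lebesgueRd R n) => leb_pt t 0 k).
Proof.
elim: n k => [[]//|n IH] k; case: (unliftP ord0 k) => [j ->|->].
  rewrite (_ : (fun t => _) = (fun t => leb_pt t 0 j) \o fst).
    by apply: measurableT_comp => //; exact: IH.
  by apply/funext => z; rewrite leb_ptS.
rewrite (_ : (fun t => _) = snd); first exact: measurable_snd.
by apply/funext => z; rewrite leb_pt0.
Qed.

Definition cube n (c : 'rV[R]_n) (r : R) : set 'rV[R]_n := [set x | forall k, `|x 0 k - c 0 k| < r].

Lemma cube_ball n (c x : 'rV[R]_n) r : 0 < r -> cube c r x <-> `|x - c| < r.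
Proof.
move=> r0; split=> [h|h k]; first by apply: norm_rV_lt => // k; have := h k; rewrite !mxE.
by apply: le_lt_trans h; apply: le_trans (coord_norm _ k); rewrite !mxE.
Qed.

Lemma measurable_coordP n (P : 'I_n -> set R) : (forall k, measurable (P k)) ->
  measurable (leb_pre [set x : 'rV[R]_n | forall k, P k (x 0 k)]).
Proof.
move=> mP.
rewrite (_ : leb_pre _ = \big[setI/setT]_(k <- index_enum 'I_n) ((fun t => leb_pt t 0 k) @^-1` P k)).
  apply: bigsetI_measurable => k _.
  rewrite -[X in measurable X]setTI; exact: measurable_leb_coord.
rewrite -bigcap_seq; apply/seteqP; split => [t h k _|t h k]; first exact: h.
by apply: h; rewrite /= mem_index_enum.
Qed.

Lemma cubeE n (c : 'rV[R]_n) r :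
  cube c r = [set x | forall k, `]c 0 k - r, c 0 k + r[%classic (x 0 k)].
Proof.
apply/seteqP; split => x h k; have := h k; rewrite /= in_itv/= ltr_distl//.
Qed.

Lemma measurable_cube n (c : 'rV[R]_n) r : measurable (leb_pre (cube c r)).
Proof. by rewrite cubeE; apply: (measurable_coordP (P := fun k => `]c 0 k - r, c 0 k + r[%classic)) => k; exact: measurable_itv. Qed.

Lemma leb_meas_cube n (c : 'rV[R]_n) r : 0 < r -> leb_meas (cube c r) = ((2 * r) ^+ n)%:E.
Proof.
move=> r0; elim: n c => [|n IH] c.
  rewrite /leb_meas /= diracE mem_set ?expr0// => -[]//.
pose c' : 'rV[R]_n := \row_j c 0 (lift ord0 j).
have -> : leb_meas (cube c r) = leb_mu (lebesgueRd R n.+1) (leb_pre (cube c' r) `*` `]c 0 ord0 - r, c 0 ord0 + r[%classic).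
  congr (leb_mu _ _); apply/seteqP; split => [z h|z [h1 h2] k].
    split; first by move=> j /=; have := h (lift ord0 j); rewrite leb_ptS mxE.
    by have := h ord0; rewrite leb_pt0 /= in_itv/= ltr_distl.
  case: (unliftP ord0 k) => [j ->|->]; first by have := h1 j; rewrite leb_ptS mxE.
  by move: h2; rewrite leb_pt0 /= in_itv/= ltr_distl.
rewrite /= product_measure1E; last 2 first.
- exact: measurable_cube.
- exact: measurable_itv.
have := IH c'; rewrite /leb_meas -/(leb_pre _) => ->.
move: (c 0 ord0) => x.
transitivity (((2 * r) ^+ n)%:E * lebesgue_measure (`](x - r)%R, (x + r)%R[%classic : set R))%E => //.
rewrite lebesgue_measure_itv/= lte_fin ifT; last by lra.
rewrite -EFinB -EFinM exprSr; congr (_ * _)%:E; lra.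
Qed.

(** An open set is a countable union of rational cubes, each of which is a measurable box of the
    iterated product. *)
Lemma measurable_open n (D : set 'rV[R]_n) : open D -> measurable (leb_pre D).
Proof.
move=> oD.
pose F (q : 'rV[rat]_n * nat) := leb_pre (cube (map_mx ratr q.1 : 'rV[R]_n) (q.2.+1%:R^-1)).
pose P (q : 'rV[rat]_n * nat) := cube (map_mx ratr q.1 : 'rV[R]_n) (q.2.+1%:R^-1) `<=` D.
have -> : leb_pre D = \bigcup_q (if `[< P q >] then F q else set0).
  apply/seteqP; split => [t Dt|t [q _]]; last by case: asboolP => // h; exact: h.
  have [e e0 he] : exists2 e : R, 0 < e & forall y, `|leb_pt t - y| < e -> D y.
    have : nbhs (leb_pt t) D by apply: open_nbhs_nbhs; split.
    move=> /nbhs_ballP[e /= e0 he]; exists e => // y ye; apply: he.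
    by rewrite -ball_normE.
  have [m hm] : exists m : nat, m.+1%:R^-1 < e / 2.
    exists (Num.Def.trunc (e / 2)^-1).
    rewrite invf_plt ?posrE ?divr_gt0// -[X in _ < X]/(_.+1%:R).
    exact: truncnS_gt.
  have m0 : 0 < m.+1%:R^-1 :> R by rewrite invr_gt0 ltr0n.
  have hq (k : 'I_n) : exists q : rat, `|leb_pt t 0 k - ratr q| < m.+1%:R^-1.
    have lt : leb_pt t 0 k - m.+1%:R^-1 < leb_pt t 0 k + m.+1%:R^-1 by move: m0; set a := _^-1; lra.
    have [q] := rat_in_itvoo lt.
    by rewrite in_itv/= -ltr_distlC => h; exists q.
  pose q : 'rV[rat]_n := \row_k sval (cid (hq k)).
  exists (q, m) => //=; case: asboolP => [_|].
    by move=> k /=; rewrite !mxE; case: cid.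
  apply: contra_notP => _; move=> y hy; apply: he.
  apply: norm_rV_lt => // k.
  have := hy k; rewrite !mxE; case: cid => qk /= hqk h.
  have := ler_normD (leb_pt t 0 k - ratr qk) (ratr qk - y 0 k).
  rewrite addrA subrK distrC => h2.
  move: h2 h hqk hm; rewrite (distrC (ratr qk)); set a := _.+1%:R^-1; lra.
apply: countable_bigcupT_measurable => //= q.
by case: ifP => // _; exact: measurable_cube.
Qed.

Section Integral.
Variable n : nat.
Implicit Types (D : set 'rV[R]_n) (f g : 'rV[R]_n -> R).
Local Notation mu := (leb_mu (lebesgueRd R n)).

(** Paired with the bounded measurable functions of [bmfun], finite measure settles every
    integrability condition at once. *)
Definition nice D := measurable (leb_pre D) /\ (mu (leb_pre D) < +oo)%E.

Definition bmfun D f := measurable_fun (leb_pre D) (fun t => f (leb_pt t)) /\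
  exists M, forall x, D x -> `|f x| <= M.

Lemma bmfun_integrable D f : nice D -> bmfun D f ->
  mu.-integrable (leb_pre D) (EFin \o (fun t => f (leb_pt t))).
Proof.
move=> [mD fD] [mf [M hM]]; apply: measurable_bounded_integrable => //.
exists M; split; first exact: num_real.
by move=> x Mx t Dt /=; apply: le_trans (hM _ Dt) (ltW Mx).
Qed.

Lemma bmfunD D f g : nice D -> bmfun D f -> bmfun D g -> bmfun D (fun x => f x + g x).
Proof.
move=> _ [mf [M hM]] [mg [N hN]]; split; first exact: measurable_realfun.measurable_funD.
by exists (M + N) => x Dx; rewrite (le_trans (ler_normD _ _))// lerD ?hM ?hN.
Qed.

Lemma bmfunM D f g : nice D -> bmfun D f -> bmfun D g -> bmfun D (fun x => f x * g x).
Proof.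
move=> _ [mf [M hM]] [mg [N hN]]; split; first exact: measurable_realfun.measurable_funM.
by exists (M * N) => x Dx; rewrite normrM ler_pM ?hM ?hN.
Qed.

Lemma bmfun_cst D (c : R) : nice D -> bmfun D (fun=> c).
Proof. by move=> _; split; [exact: measurable_cst|exists `|c|]. Qed.

Lemma bmfun_sum D (I : Type) (s : seq I) (F : I -> 'rV[R]_n -> R) : nice D ->
  (forall i, bmfun D (F i)) -> bmfun D (fun x => \sum_(i <- s) F i x).
Proof.
move=> nD h; elim: s => [|i s IH].
  rewrite (_ : (fun x => _) = fun=> 0); first exact: bmfun_cst.
  by apply/funext => x; rewrite big_nil.
rewrite (_ : (fun x => _) = (fun x => F i x + \sum_(i <- s) F i x)); first exact: bmfunD.
by apply/funext => x; rewrite big_cons.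
Qed.

Lemma bmfunS D D' f : measurable (leb_pre D) -> measurable (leb_pre D') -> D `<=` D' -> bmfun D' f -> bmfun D f.
Proof.
move=> mD mD' DD' [mf [M hM]]; split.
  by apply: measurable_funS mf => // t; exact: DD'.
by exists M => x /DD' /hM.
Qed.

Lemma leb_intE D f : leb_int D f = \int[mu]_(t in leb_pre D) f (leb_pt t).
Proof. by []. Qed.

Lemma leb_intD D f g : nice D -> bmfun D f -> bmfun D g ->
  leb_int D (fun x => f x + g x) = leb_int D f + leb_int D g.
Proof.
move=> nD bf bg; rewrite !leb_intE RintegralD//; [by case: nD|exact: bmfun_integrable..].
Qed.

Lemma leb_intZ D f (c : R) : nice D -> bmfun D f ->
  leb_int D (fun x => c * f x) = c * leb_int D f.
Proof. by move=> nD bf; rewrite !leb_intE RintegralZl//; [case: nD|exact: bmfun_integrable]. Qed.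

Lemma leb_int_sum D (I : Type) (s : seq I) (F : I -> 'rV[R]_n -> R) : nice D ->
  (forall i, bmfun D (F i)) -> leb_int D (fun x => \sum_(i <- s) F i x) = \sum_(i <- s) leb_int D (F i).
Proof.
move=> nD h; elim: s => [|i s IH].
  rewrite big_nil (_ : (fun x => _) = fun=> 0 * 0).
    by rewrite leb_intZ ?mul0r//; exact: bmfun_cst.
  by apply/funext => x; rewrite big_nil mul0r.
rewrite big_cons -IH -leb_intD//; last exact: bmfun_sum.
by congr leb_int; apply/funext => x; rewrite big_cons.
Qed.

Lemma leb_int_ge0 D f : (forall x, D x -> 0 <= f x) -> 0 <= leb_int D f.
Proof. by move=> h; apply: Rintegral_ge0 => t; exact: h. Qed.

Lemma leb_int_le D f g : nice D -> bmfun D f -> bmfun D g ->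
  (forall x, D x -> f x <= g x) -> leb_int D f <= leb_int D g.
Proof.
move=> nD bf bg h; apply: le_Rintegral; [by case: nD|exact: bmfun_integrable..|].
by move=> t; exact: h.
Qed.

Lemma leb_int_eq D f g : (forall x, D x -> f x = g x) -> leb_int D f = leb_int D g.
Proof. by move=> h; apply: eq_Rintegral => t; rewrite inE => /h. Qed.

Lemma leb_int_setU A B f : nice A -> nice B -> (forall x, A x -> B x -> False) ->
  bmfun (A `|` B) f -> nice (A `|` B) /\ leb_int (A `|` B) f = leb_int A f + leb_int B f.
Proof.
move=> [mA fA] [mB fB] AB bf.
have nU : nice (A `|` B).
  split; first exact: measurableU.
  apply: le_lt_trans (measureU2 _ mA mB) _; exact: lte_add_pinfty.
split=> //; rewrite !leb_intE -[leb_pre (A `|` B)]/(leb_pre A `|` leb_pre B) Rintegral_setU//.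
  exact: bmfun_integrable nU bf.
by apply/eqP; apply/seteqP; split => // t [At Bt]; apply: (AB _ At Bt).
Qed.

Lemma leb_int_bigcup (I : finType) (C : I -> set 'rV[R]_n) f :
  (forall i, nice (C i)) -> (forall i j x, C i x -> C j x -> i = j) ->
  bmfun (\bigcup_(i in [set: I]) C i) f ->
  nice (\bigcup_(i in [set: I]) C i) /\
  leb_int (\bigcup_(i in [set: I]) C i) f = \sum_i leb_int (C i) f.
Proof.
move=> nC dC bf.
have mU (s : seq I) : measurable (leb_pre (\bigcup_(i in [set` s]) C i)).
  rewrite (_ : leb_pre _ = \bigcup_(i in [set` s]) leb_pre (C i))//.
  by rewrite bigcup_seq; apply: bigsetU_measurable => i _; have [] := nC i.
have all_eq : \bigcup_(i in [set: I]) C i = \bigcup_(i in [set` index_enum I]) C i.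
  by apply/seteqP; split => x [i _ Cx]; exists i => //=; rewrite mem_index_enum.
rewrite all_eq in bf *.
suff : forall s : seq I, uniq s -> nice (\bigcup_(i in [set` s]) C i) /\
    leb_int (\bigcup_(i in [set` s]) C i) f = \sum_(i <- s) leb_int (C i) f.
  by apply; exact: index_enum_uniq.
elim=> [_|i s IH /= /andP[ins us]].
  rewrite big_nil (_ : \bigcup_(i in _) _ = set0); last by apply/seteqP; split => x //; case=> i.
  split; first by split; rewrite /leb_pre preimage_set0 ?measure0.
  by rewrite leb_intE /leb_pre preimage_set0 Rintegral_set0.
have [nI eI] := IH us.
have e : \bigcup_(j in [set` i :: s]) C j = C i `|` \bigcup_(j in [set` s]) C j.
  apply/seteqP; split => [x [j /= ]|x [Cx|[j /= js Cx]]].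
  - by rewrite inE => /orP[/eqP->|js] Cx; [left|right; exists j].
  - by exists i => //=; rewrite mem_head.
  - by exists j => //=; rewrite inE js orbT.
rewrite e big_cons -eI; apply: leb_int_setU => //.
  by move=> x Cx [j /= js Cjx]; move: ins; rewrite (dC _ _ _ Cx Cjx) js.
rewrite -e; apply: bmfunS bf => // x [j _ Cx]; exists j => //=; exact: mem_index_enum.
Qed.

Lemma nice_cube (c : 'rV[R]_n) r : 0 < r -> nice (cube c r).
Proof.
by move=> r0; split; [exact: measurable_cube|have := leb_meas_cube c r0; rewrite /leb_meas => ->; rewrite ltry].
Qed.

Lemma niceS D c r : measurable (leb_pre D) -> 0 < r -> D `<=` cube c r -> nice D.
Proof.
move=> mD r0 Dc; split=> //; have [mc fc] := nice_cube c r0.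
by apply: le_lt_trans fc; apply: le_measure; rewrite ?inE// => t; exact: Dc.
Qed.

Lemma leb_int_cst_cube (c : 'rV[R]_n) r (M : R) : 0 < r -> leb_int (cube c r) (fun=> M) = M * (2 * r) ^+ n.
Proof.
move=> r0; rewrite leb_intE Rintegral_cst; last exact: measurable_cube.
by have := leb_meas_cube c r0; rewrite /leb_meas => ->.
Qed.

Lemma leb_int_subset A B f : nice A -> nice B -> A `<=` B -> bmfun B f ->
  (forall x, B x -> 0 <= f x) -> leb_int A f <= leb_int B f.
Proof.
move=> nA nB AB bf f0.
have e : B = A `|` (B `\` A) by rewrite setDUK.
have mBA : measurable (leb_pre (B `\` A)) by apply: measurableD; [case: nB|case: nA].
have nBA : nice (B `\` A).
  split=> //; case: nB => mB; apply: le_lt_trans; apply: le_measure; rewrite ?inE//.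
  by move=> t [].
rewrite [X in _ <= leb_int X _]e.
have [||_ ->] := leb_int_setU nA nBA _ (f := f) => //.
- by move=> x Ax [_].
- by rewrite -e.
by rewrite lerDl; apply: leb_int_ge0 => x [Bx _]; exact: f0.
Qed.

Lemma leb_int_le_cube D f c r M : nice D -> 0 < r -> D `<=` cube c r -> 0 <= M -> bmfun D f ->
  (forall x, D x -> f x <= M) -> leb_int D f <= M * (2 * r) ^+ n.
Proof.
move=> nD r0 Dc M0 bf fM.
rewrite -(leb_int_cst_cube c M r0).
apply: (@le_trans _ _ (leb_int D (fun=> M))); first by apply: leb_int_le => //; exact: bmfun_cst.
by apply: leb_int_subset => //; [exact: nice_cube|exact: bmfun_cst (nice_cube c r0)].
Qed.

Lemma leb_int_ge_cube D f c r m : nice D -> 0 < r -> cube c r `<=` D -> bmfun D f ->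
  (forall x, D x -> 0 <= f x) -> (forall x, cube c r x -> m <= f x) -> m * (2 * r) ^+ n <= leb_int D f.
Proof.
move=> nD r0 Dc bf f0 fm.
rewrite -(leb_int_cst_cube c m r0).
have nc := nice_cube c r0.
apply: (@le_trans _ _ (leb_int (cube c r) f)); last exact: leb_int_subset.
apply: leb_int_le => //; first exact: bmfun_cst.
by apply: bmfunS bf => //; [case: nc|case: nD].
Qed.

(** Comparison of volumes; it will bound the number of cells that meet at a point. *)
Lemma packing (I : finType) (C : I -> set 'rV[R]_n) (ctr : I -> 'rV[R]_n) c r S : 0 < r -> 0 < S ->
  (forall i, measurable (leb_pre (C i))) -> (forall i j x, C i x -> C j x -> i = j) ->
  (forall i, cube (ctr i) r `<=` C i) -> (forall i, C i `<=` cube c S) ->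
  #|I|%:R * (2 * r) ^+ n <= (2 * S) ^+ n.
Proof.
move=> r0 S0 mC dC rC CS.
have nC i : nice (C i) by apply: niceS (mC i) S0 (CS i).
have mU : measurable (leb_pre (\bigcup_(i in [set: I]) C i)).
  rewrite (_ : leb_pre _ = \bigcup_(i in [set: I]) leb_pre (C i))//.
  by apply: fin_bigcup_measurable.
have nU : nice (\bigcup_(i in [set: I]) C i).
  by apply: niceS mU S0 _ => x [i _ Cx]; exact: CS Cx.
have [_ e] := leb_int_bigcup nC dC (bmfun_cst 1 nU).
rewrite -[X in _ <= X]mul1r.
apply: le_trans (leb_int_le_cube nU S0 _ ler01 (bmfun_cst 1 nU) (fun _ _ => lexx 1)).
  rewrite e -sumr_const mulr_suml; apply: ler_sum => i _.
  by apply: leb_int_ge_cube (rC i) _ _ _ => //; exact: bmfun_cst.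
by move=> x [i _ Cx]; exact: CS Cx.
Qed.

End Integral.
End LebesgueRd.

(** * Common faces of multilinear cells *)

Section Patches.
Variables (R : realType) (d : nat).
Implicit Types (u w z q : 'rV[R]_d).

Definition indep2 u w := forall a b : R, a *: u + b *: w = 0 -> a = 0 /\ b = 0.

(* If the coefficients were negative, the patch [s u + t w + s t z] would be singular at a point of the edge
   [t = 0]. *)
Lemma patch_diagonal_cone u w z (lam s t : R) :
  (forall s t, 0 <= s <= 1 -> 0 <= t <= 1 -> indep2 (u + t *: z) (w + s *: z)) ->
  0 < lam < 1 -> 0 <= s <= 1 -> 0 <= t <= 1 ->
  lam *: (u + w + z) = s *: u + t *: w + (s * t) *: z ->
  exists a b : R, [/\ 0 <= a, 0 <= b & u + w + z = a *: u + b *: w].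
Proof.
move=> ind /andP[l0 l1] /andP[s0 s1] /andP[t0 t1] e.
(* Subtracting [s t (u + w + z)] removes [z] from the right-hand side, and everything depends on the
   sign of [lam - s t]. *)
have e2 : (lam - s * t) *: (u + w + z) = (s * (1 - t)) *: u + (t * (1 - s)) *: w.
  rewrite scalerBl e; apply/rowP => k; rewrite !mxE; ring.
have a0 : 0 <= s * (1 - t) by rewrite mulr_ge0// subr_ge0.
have b0 : 0 <= t * (1 - s) by rewrite mulr_ge0// subr_ge0.
have i00 : indep2 u w.
  by have := ind 0 0; rewrite !scale0r !addr0 lexx ler01; apply.
have [c|c|c] := ltgtP (lam - s * t) 0; last first.
- move: e2; rewrite c scale0r => /esym/i00[h1 h2].
  have : s = t by lra.
  move=> st; subst t.
  have /eqP : s * (1 - s) = 0 by [].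
  rewrite mulf_eq0 subr_eq0 => /orP[/eqP h|/eqP h]; exfalso; [rewrite h in c|rewrite -h in c]; lra.
- exists ((s * (1 - t)) / (lam - s * t)), ((t * (1 - s)) / (lam - s * t)).
  split; [by rewrite divr_ge0// ltW|by rewrite divr_ge0// ltW|].
  have c0 : lam - s * t != 0 by rewrite gt_eqF.
  have -> : u + w + z = (lam - s * t)^-1 *: ((lam - s * t) *: (u + w + z)) by rewrite scalerA mulVf ?scale1r.
  rewrite e2 scalerDr !scalerA.
  by congr (_ *: _ + _ *: _); rewrite mulrC.
- exfalso.
  pose a := s * (1 - t) / (s * t - lam); pose b := t * (1 - s) / (s * t - lam).
  have c' : 0 < s * t - lam by lra.
  have ap : 0 <= a by rewrite divr_ge0// ltW.
  have bp : 0 <= b by rewrite divr_ge0// ltW.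
  have ez : z = - (1 + a) *: u - (1 + b) *: w.
    have : u + w + z = - a *: u - b *: w.
      have c0 : s * t - lam != 0 by rewrite gt_eqF.
      apply/rowP => k; have := congr1 (fun v : 'rV_d => v 0 k) e2; rewrite !mxE => h.
      apply: (mulfI c0); rewrite [LHS](_ : _ = - ((lam - s * t) * (u 0 k + w 0 k + z 0 k))); last by ring.
      by rewrite h /a /b; field.
    move=> h; apply/rowP => k; have := congr1 (fun v : 'rV_d => v 0 k) h.
    by rewrite !mxE => h'; lra.
  have b1 : 0 < 1 + b by lra.
  have := ind (1 + b)^-1 0; rewrite scale0r addr0 lexx ler01 invr_ge0 (ltW b1)/=.
  rewrite invf_le1// lerDl bp => /(_ isT isT ((1 + b)^-1 * (1 + a)) 1).
  have -> : (((1 + b)^-1 * (1 + a)) *: u + 1 *: (w + (1 + b)^-1 *: z)) = 0.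
    rewrite ez; apply/rowP => k; rewrite !mxE; field; exact: lt0r_neq0.
  by move=> /(_ erefl)[_ /eqP]; rewrite oner_eq0.
Qed.

(* Corners [A], [E], [C], [F] of one patch taken in this cyclic order cannot be corners of another one in the
   cyclic order [A], [C], [E], [F]. *)
Lemma patch_order_contra (qE qC qF : 'rV[R]_d) (a b a' b' : R) :
  0 <= a -> 0 <= b -> 0 <= a' -> 0 <= b' ->
  qC = a *: qE + b *: qF -> qE = a' *: qC + b' *: qF ->
  indep2 qC qF -> indep2 (- qE) (qC - qE) -> False.
Proof.
move=> a0 b0 a0' b0' eC eE iCF iE.
have : (a * a' - 1) *: qC + (a * b' + b) *: qF = 0.
  have := eC; rewrite {1}eE => h; apply/rowP => k.
  have := congr1 (fun v : 'rV_d => v 0 k) h; rewrite !mxE => h'; lra.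
move=> /iCF[h1 h2].
have h3 : b = 0 by have := mulr_ge0 a0 b0'; lra.
move: eC; rewrite h3 scale0r addr0 => eC.
have := iE (a - 1) 1; rewrite eC.
have -> : (a - 1) *: - qE + 1 *: (a *: qE - qE) = 0.
  by apply/rowP => k; rewrite !mxE; ring.
by move=> /(_ erefl)[_ /eqP]; rewrite oner_eq0.
Qed.

End Patches.

Section Faces.
Variables (R : realType) (d : nat).
Implicit Types (f g : {ffun 'I_d -> option bool}) (x y : 'rV[R]_d).

Definition face_pt f x : 'rV[R]_d := \row_l (if f l is Some b then sgnb R b else x 0 l).

Definition vtx (s : 'I_d -> bool) : 'rV[R]_d := \row_l sgnb R (s l).

Lemma sgnb_itv (b : bool) : -1 <= sgnb R b <= 1.
Proof. by rewrite /sgnb; case: b; apply/andP; split; lra. Qed.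

Lemma sgnb_inj : injective (@sgnb R).
Proof. by move=> [] [] //; rewrite /sgnb => h; exfalso; lra. Qed.

Lemma sgnb_neq0 (b : bool) : sgnb R b != 0.
Proof. by case: b; rewrite /sgnb ?oppr_eq0 oner_eq0. Qed.

Lemma ref_face_pt f x : ref_cellc x -> ref_face f (face_pt f x).
Proof.
move=> xr; split=> [k|k b fk]; rewrite mxE; last by rewrite fk.
by case: (f k) => [b|]; [exact: sgnb_itv|exact: xr].
Qed.

Lemma face_pt_id f x : ref_face f x -> face_pt f x = x.
Proof.
by move=> [_ h]; apply/rowP => k; rewrite mxE; case e: (f k) => [b|//]; rewrite (h _ _ e).
Qed.

Lemma vtx_ref s : ref_cellc (vtx s).
Proof. by move=> k; rewrite mxE; exact: sgnb_itv. Qed.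

Lemma face_pt_idem f x : face_pt f (face_pt f x) = face_pt f x.
Proof. by apply/rowP => l; rewrite !mxE; case: (f l). Qed.

Lemma ref_face_verticesP f x : ref_face_vertices f x <->
  exists s, x = vtx s /\ forall k b, f k = Some b -> s k = b.
Proof.
split=> [[[xr xf] xv]|[s [-> h]]].
  exists (fun k => sval (cid (xv k))); split.
    by apply/rowP => k; rewrite mxE; case: cid.
  by move=> k b fk; case: cid => c /= hc; apply: sgnb_inj; rewrite -hc (xf k b).
split; [split; first exact: vtx_ref|].
  by move=> k b fk; rewrite mxE (h k b).
by move=> k; exists (s k); rewrite mxE.
Qed.

Lemma face_dimE f : face_dim f = #|[set k | f k == None]%SET|.
Proof. by apply: eq_card => k; rewrite finset.in_set; apply/idP/idP => [|h]; rewrite inE. Qed.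

(** A signed permutation of coordinates, followed by the projection onto the face [g]. Only the
    values of [pi] and [e] at the free coordinates of [g] count. *)
Definition face_map g (pi : 'I_d -> 'I_d) (e : 'I_d -> bool) x : 'rV[R]_d :=
  \row_l (if g l is Some b then sgnb R b else sgnb R (e l) * x 0 (pi l)).

Lemma face_map_ref g pi e x : ref_cellc x -> ref_face g (face_map g pi e x).
Proof.
move=> xr; split=> [k|k b gk]; rewrite mxE; last by rewrite gk.
case: (g k) => [b|]; first exact: sgnb_itv.
have := xr (pi k); rewrite /sgnb; case: (e k) => /andP[a b]; apply/andP; split; lra.
Qed.

Lemma face_map_line g pi e x k :
  {in [pred l | g l == None] &, injective pi} ->
  (exists l, forall t, face_map g pi e (x + t *: unitv R k) = face_map g pi e x + (sgnb R (e l) * t) *: unitv R l) \/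
  (forall t, face_map g pi e (x + t *: unitv R k) = face_map g pi e x).
Proof.
move=> pinj.
have [/existsP[l /andP[/eqP gl /eqP pl]]|] := boolP [exists l, (g l == None) && (pi l == k)].
  left; exists l => t; apply/rowP => j.
  rewrite coord_unitv !mxE eqxx/=.
  have [->|jl] := eqVneq j l; first by rewrite gl pl eqxx mulr1 mulrDr.
  case gj: (g j) => [b|]; first by rewrite addr0.
  rewrite (_ : pi j == k = false) ?mulr0 ?addr0//.
  apply/negP => /eqP pj; move/eqP: jl; apply; apply: pinj; rewrite ?inE ?gj ?gl//.
  by rewrite pj pl.
move=> /existsPn h; right => t; apply/rowP => j; rewrite !mxE eqxx/=.
case gj: (g j) => [b|]; first by [].
by have := h j; rewrite gj eqxx/= => /negPf ->; rewrite mulr0 addr0.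
Qed.

(** Weaker than [isQ], and stable under [face_map] because that map sends coordinate lines to
    coordinate lines or to points; uniqueness on a grid asks for no more. *)
Definition linedeg p (D : 'rV[R]_d -> R) := forall k x,
  exists2 P : {poly R}, (size P <= p.+1)%N & forall t, D (x + t *: unitv R k) = P.[t].

Lemma linedegB p D E : linedeg p D -> linedeg p E -> linedeg p (fun x => D x - E x).
Proof.
move=> hD hE k x; have [P sP eP] := hD k x; have [Q sQ eQ] := hE k x.
exists (P - Q); last by move=> t; rewrite hornerD hornerN eP eQ.
by rewrite (leq_trans (size_polyD _ _))// geq_max sP size_polyN.
Qed.

Lemma linedeg_face_map p q g pi e : isQ p q ->
  {in [pred l | g l == None] &, injective pi} -> linedeg p (fun x => q (face_map g pi e x)).
Proof.
move=> hq pinj k x; have [[l h]|h] := face_map_line e x k pinj; last first.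
  exists (q (face_map g pi e x))%:P; first by rewrite (leq_trans (size_polyC_leq1 _)).
  by move=> t; rewrite h hornerC.
have [P sP eP] := isQ_line hq l (face_map g pi e x).
exists (P \Po (sgnb R (e l) *: 'X)).
  rewrite (leq_trans (size_comp_poly_leq _ _))// size_scale ?sgnb_neq0// size_polyX muln1.
  by case: (size P) sP.
by move=> t; rewrite h eP horner_comp hornerZ hornerX.
Qed.

(** Induction on the number [m] of leading coordinates that may leave the grid: releasing one more
    gives a polynomial of degree at most [p] with more than [p] roots. *)
Lemma grid_uniqueness p D f (s : seq R) : linedeg p D -> uniq s -> (p < size s)%N ->
  (forall x, (forall l, f l = None -> x 0 l \in s) -> D (face_pt f x) = 0) ->
  forall x, D (face_pt f x) = 0.
Proof.
move=> lD us ps h.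
suff H : forall m x, (forall l, f l = None -> (m <= l)%N -> x 0 l \in s) -> D (face_pt f x) = 0.
  by move=> x; apply: (H d) => l _; rewrite leqNgt ltn_ord.
elim=> [|m IH] x hx; first by apply: h => l fl; apply: hx.
have [md|dm] := ltnP m d; last first.
  apply: IH => l fl ml; exfalso; have := ltn_ord l; by rewrite ltnNge (leq_trans dm ml).
pose k := Ordinal md.
case fk : (f k) => [b|].
  apply: IH => l fl; rewrite leq_eqVlt => /orP[/eqP ml|]; last exact: hx.
  have kl : k = l by exact/val_inj.
    by move: fl; rewrite -kl fk.
have [P sP eP] := lD k (face_pt f x - x 0 k *: unitv R k).
have key t : face_pt f x - x 0 k *: unitv R k + t *: unitv R k = face_pt f (\row_l (if l == k then t else x 0 l)).
  apply/rowP => l; rewrite -addrA -scaleNr -scalerDl coord_unitv !mxE.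
  case: eqP => [->|_]; last by rewrite addr0.
  by rewrite fk addrA subrr add0r.
have P0 : P = 0.
  apply: (@roots_geq_poly_eq0 _ P s) => //; last exact: leq_trans sP ps.
  apply/allP => t ts; apply/rootP; rewrite -eP key; apply: IH => l fl.
  rewrite leq_eqVlt mxE => /orP[/eqP ml|ml].
    by rewrite (_ : l = k) ?eqxx//; exact/val_inj.
  rewrite ifF; first exact: hx.
  by apply/negP => /eqP lk; move: ml; rewrite lk ltnn.
by have := eP (x 0 k); rewrite subrK P0 horner0.
Qed.

End Faces.

(** * Corners of a two-dimensional face *)

Section Corners.
Variables (R : realType) (d : nat).
Variables (G : 'rV[R]_d -> 'rV[R]_d) (f : {ffun 'I_d -> option bool}) (k1 k2 : 'I_d).
Hypothesis L : forall k, isQ 1 (fun x => G x 0 k).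
Hypothesis J : forall x, ref_cellc x -> jac G x \in unitmx.
Hypothesis k12 : k1 != k2.
Hypothesis f_free : forall l, f l = None <-> l = k1 \/ l = k2.

Definition cnr_sgn (b1 b2 : bool) (l : 'I_d) : bool :=
  if f l is Some c then c else if l == k1 then b1 else b2.

Definition cnr b1 b2 := G (vtx R (cnr_sgn b1 b2)).

(** The unit square laid over the face with its origin at the corner [(b1, b2)], so that the four
    corners are treated alike. *)
Let xi b1 b2 (s t : R) := vtx R (cnr_sgn b1 b2) + (- 2 * sgnb R b1 * s) *: unitv R k1 + (- 2 * sgnb R b2 * t) *: unitv R k2.

Let fk1 : f k1 = None. Proof. by apply/f_free; left. Qed.
Let fk2 : f k2 = None. Proof. by apply/f_free; right. Qed.

Let xiE b1 b2 s t l : xi b1 b2 s t 0 l = if f l is Some c then sgnb R c else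
   if l == k1 then sgnb R b1 * (1 - 2 * s) else sgnb R b2 * (1 - 2 * t).
Proof.
rewrite /xi !coord_unitv mxE /cnr_sgn.
have [->|l1] := eqVneq l k1; first by rewrite fk1 (negPf k12) addr0; ring.
have [->|l2] := eqVneq l k2; first by rewrite fk2 addr0; ring.
rewrite !addr0; case fl: (f l) => [//|].
by have /f_free[|] := fl => h; [rewrite h eqxx in l1|rewrite h eqxx in l2].
Qed.

Let xi_ref b1 b2 s t : 0 <= s <= 1 -> 0 <= t <= 1 -> ref_face f (xi b1 b2 s t).
Proof.
move=> /andP[s0 s1] /andP[t0 t1]; split=> [l|l b fl]; rewrite xiE; last by rewrite fl.
case: (f l) => [c|]; first exact: sgnb_itv.
by case: ifP => _; rewrite /sgnb; [case: b1|case: b2]; apply/andP; split; lra.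
Qed.

Let xi_surj b1 b2 x : ref_face f x -> exists s t, [/\ 0 <= s <= 1, 0 <= t <= 1 & x = xi b1 b2 s t].
Proof.
move=> [xr xf].
exists ((1 - sgnb R b1 * x 0 k1) / 2), ((1 - sgnb R b2 * x 0 k2) / 2).
have /andP[a1 a2] := xr k1; have /andP[a3 a4] := xr k2.
split; [by rewrite /sgnb; case: b1; apply/andP; split; lra|by rewrite /sgnb; case: b2; apply/andP; split; lra|].
apply/rowP => l; rewrite xiE; case fl: (f l) => [c|]; first exact: xf.
have /f_free[->|->] := fl.
  by rewrite eqxx /sgnb; case: b1; lra.
by rewrite eq_sym (negPf k12) /sgnb; case: b2; lra.
Qed.

Let edge1 b1 b2 := cnr (~~ b1) b2 - cnr b1 b2.
Let edge2 b1 b2 := cnr b1 (~~ b2) - cnr b1 b2.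
Let twist b1 b2 := cnr (~~ b1) (~~ b2) - cnr b1 b2 - edge1 b1 b2 - edge2 b1 b2.

Let xi_cnr b1 b2 : [/\ xi b1 b2 0 0 = vtx R (cnr_sgn b1 b2), xi b1 b2 1 0 = vtx R (cnr_sgn (~~ b1) b2),
  xi b1 b2 0 1 = vtx R (cnr_sgn b1 (~~ b2)) & xi b1 b2 1 1 = vtx R (cnr_sgn (~~ b1) (~~ b2))].
Proof.
by split; apply/rowP => l; rewrite xiE mxE /cnr_sgn; case: (f l) => [//|];
  case: ifP => _; rewrite /sgnb; case: b1; case: b2 => /=; lra.
Qed.

Let line1 b1 b2 s s' t : G (xi b1 b2 s' t) = G (xi b1 b2 s t) + (s' - s) *: ((- 2 * sgnb R b1) *: (unitv R k1 *m jac G (xi b1 b2 s t))).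
Proof.
rewrite scalerA -(G_line L); congr G; apply/rowP => l; rewrite /xi !coord_unitv.
by case: (l == k1); case: (l == k2); ring.
Qed.

Let line2 b1 b2 s t t' : G (xi b1 b2 s t') = G (xi b1 b2 s t) + (t' - t) *: ((- 2 * sgnb R b2) *: (unitv R k2 *m jac G (xi b1 b2 s t))).
Proof.
rewrite scalerA -(G_line L); congr G; apply/rowP => l; rewrite /xi !coord_unitv.
by case: (l == k1); case: (l == k2); ring.
Qed.

Let G_xi b1 b2 s t : G (xi b1 b2 s t) = cnr b1 b2 + (s *: edge1 b1 b2 + t *: edge2 b1 b2 + (s * t) *: twist b1 b2).
Proof.
have [c00 c10 c01 c11] := xi_cnr b1 b2.
have aff (X Y Z V : 'rV[R]_d) (r : R) : X = Y + (r - 0) *: V -> Z = Y + (1 - 0) *: V -> X = Y + r *: (Z - Y).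
  by move=> -> ->; rewrite !subr0 scale1r addrAC subrr add0r.
have h0 := aff _ _ _ _ _ (line1 b1 b2 0 s 0) (line1 b1 b2 0 1 0).
have h1 := aff _ _ _ _ _ (line1 b1 b2 0 s 1) (line1 b1 b2 0 1 1).
have h := aff _ _ _ _ _ (line2 b1 b2 s 0 t) (line2 b1 b2 s 0 1).
rewrite h h0 h1 c00 c10 c01 c11 -!/(cnr _ _) /twist /edge1 /edge2.
by apply/rowP => k; rewrite !mxE; ring.
Qed.

Lemma cnr_indep b1 b2 s t : 0 <= s <= 1 -> 0 <= t <= 1 ->
  indep2 (edge1 b1 b2 + t *: twist b1 b2) (edge2 b1 b2 + s *: twist b1 b2).
Proof.
move=> s01 t01.
have xr : ref_cellc (xi b1 b2 s t) by have [] := xi_ref b1 b2 s01 t01.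
have e1 : edge1 b1 b2 + t *: twist b1 b2 = (- 2 * sgnb R b1) *: (unitv R k1 *m jac G (xi b1 b2 s t)).
  have := line1 b1 b2 s (s + 1) t; rewrite !G_xi (addrAC s) subrr add0r scale1r => h.
  apply/rowP => k; have := congr1 (fun v : 'rV_d => v 0 k) h; rewrite !mxE => h'; lra.
have e2 : edge2 b1 b2 + s *: twist b1 b2 = (- 2 * sgnb R b2) *: (unitv R k2 *m jac G (xi b1 b2 s t)).
  have := line2 b1 b2 s t (t + 1); rewrite !G_xi (addrAC t) subrr add0r scale1r => h.
  apply/rowP => k; have := congr1 (fun v : 'rV_d => v 0 k) h; rewrite !mxE => h'; lra.
move=> a b; rewrite e1 e2 !scalerA !scalemxAl -mulmxDl => h.
have : (a * (- 2 * sgnb R b1)) *: unitv R k1 + (b * (- 2 * sgnb R b2)) *: unitv R k2 = 0.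
  by rewrite -[LHS](mulmxK (J xr)) h mul0mx.
move=> h'; have z1 := congr1 (fun v : 'rV_d => v 0 k1) h'; have z2 := congr1 (fun v : 'rV_d => v 0 k2) h'.
move: z1 z2; rewrite !mxE !eqxx/= (negPf k12) eq_sym (negPf k12) !mulr1 !mulr0 addr0 add0r.
move=> /eqP; rewrite !mulf_eq0 (negPf (sgnb_neq0 _ _)) oppr_eq0 pnatr_eq0 !orbF => /eqP ->.
by move=> /eqP; rewrite !mulf_eq0 (negPf (sgnb_neq0 _ _)) oppr_eq0 pnatr_eq0 !orbF => /eqP ->.
Qed.

(** The hypothesis is met when the diagonal joins corners that are adjacent in the other
    parametrisation of the face, since an image contains the midpoints of its edges. *)
Lemma cnr_cone b1 b2 : (G @` ref_face f) (2^-1 *: (cnr b1 b2 + cnr (~~ b1) (~~ b2))) ->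
  exists a b : R, [/\ 0 <= a, 0 <= b &
    cnr (~~ b1) (~~ b2) - cnr b1 b2 = a *: (cnr (~~ b1) b2 - cnr b1 b2) + b *: (cnr b1 (~~ b2) - cnr b1 b2)].
Proof.
move=> [x xf e]; have [s [t [s01 t01 ex]]] := xi_surj b1 b2 xf.
have h01 : 0 < (2^-1 : R) < 1 by apply/andP; split; lra.
have := @patch_diagonal_cone R d (edge1 b1 b2) (edge2 b1 b2) (twist b1 b2) 2^-1 s t
  (@cnr_indep b1 b2) h01 s01 t01.
have -> : edge1 b1 b2 + edge2 b1 b2 + twist b1 b2 = cnr (~~ b1) (~~ b2) - cnr b1 b2.
  by rewrite /twist; apply/rowP => k; rewrite !mxE; ring.
apply; have := G_xi b1 b2 s t; rewrite -ex e => h.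
apply/rowP => k; have := congr1 (fun v : 'rV_d => v 0 k) h; rewrite !mxE => h'; lra.
Qed.

Lemma cnr_edge_mid b1 b2 :
  (G @` ref_face f) (2^-1 *: (cnr b1 b2 + cnr (~~ b1) b2)) /\
  (G @` ref_face f) (2^-1 *: (cnr b1 b2 + cnr b1 (~~ b2))).
Proof.
have h0 : 0 <= (0 : R) <= 1 by rewrite lexx ler01.
have h2 : 0 <= (2^-1 : R) <= 1 by apply/andP; split; lra.
split.
  exists (xi b1 b2 2^-1 0); first exact: xi_ref.
  by rewrite G_xi mulr0 !scale0r !addr0 /edge1; apply/rowP => k; rewrite !mxE; lra.
exists (xi b1 b2 0 2^-1); first exact: xi_ref.
by rewrite G_xi mul0r !scale0r !addr0 add0r /edge2; apply/rowP => k; rewrite !mxE; lra.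
Qed.

Lemma cnr_edges_indep b1 b2 : indep2 (cnr (~~ b1) b2 - cnr b1 b2) (cnr b1 (~~ b2) - cnr b1 b2).
Proof.
have h0 : 0 <= (0 : R) <= 1 by rewrite lexx ler01.
by have := @cnr_indep b1 b2 0 0 h0 h0; rewrite !scale0r !addr0.
Qed.

End Corners.

Lemma indep2_sym (R : realType) (d : nat) (u w : 'rV[R]_d) : indep2 u w -> indep2 w u.
Proof. by move=> h a b; rewrite addrC => /h[-> ->]. Qed.

(** The combinatorics of a relabelling of a square that breaks opposition: the corner that was
    opposite to [c] becomes a neighbour, and one of the two former neighbours becomes opposite. *)
Lemma adj_cases (c c' e1 e2 : bool * bool) : c' <> c -> c' <> (~~ c.1, ~~ c.2) -> e1 <> c -> e2 <> c ->
  e1 <> e2 -> e1 <> c' -> e2 <> c' ->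
  (c' = (~~ c.1, c.2) /\ ((e1 = (~~ c.1, ~~ c.2) /\ e2 = (c.1, ~~ c.2)) \/
                          (e1 = (c.1, ~~ c.2) /\ e2 = (~~ c.1, ~~ c.2)))) \/
  (c' = (c.1, ~~ c.2) /\ ((e1 = (~~ c.1, ~~ c.2) /\ e2 = (~~ c.1, c.2)) \/
                          (e1 = (~~ c.1, c.2) /\ e2 = (~~ c.1, ~~ c.2)))).
Proof.
by move: c c' e1 e2 => [[] []] [[] []] [[] []] [[] []] //= *; auto.
Qed.

(** * Matching the two parametrisations of a common face *)

Section FaceMatching.
Variables (R : realType) (d : nat).
Variables (G1 G2 : 'rV[R]_d -> 'rV[R]_d).
Hypothesis L1 : forall k, isQ 1 (fun x => G1 x 0 k).
Hypothesis L2 : forall k, isQ 1 (fun x => G2 x 0 k).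
Hypothesis I1 : {in @ref_cellc R d &, injective G1}.
Hypothesis I2 : {in @ref_cellc R d &, injective G2}.
Hypothesis J1 : forall x, ref_cellc x -> jac G1 x \in unitmx.
Hypothesis J2 : forall x, ref_cellc x -> jac G2 x \in unitmx.
Variables (f g : {ffun 'I_d -> option bool}).
Hypothesis fg_img : G1 @` @ref_face R d f = G2 @` @ref_face R d g.
Hypothesis fg_vtx : G1 @` @ref_face_vertices R d f = G2 @` @ref_face_vertices R d g.
Implicit Types (x : 'rV[R]_d).

Definition matched (pi : 'I_d -> 'I_d) (e : 'I_d -> bool) :=
  [/\ forall l, g l = None -> f (pi l) = None,
      {in [pred l | g l == None] &, injective pi} &
      forall x, ref_face f x -> G1 x = G2 (face_map g pi e x)].

(** Both sides have degree one along coordinate lines, so the two-point grid of vertices decides. *)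
Lemma matched_vtx pi e : (forall l, g l = None -> f (pi l) = None) ->
  {in [pred l | g l == None] &, injective pi} ->
  (forall s, (forall k b, f k = Some b -> s k = b) -> G1 (vtx R s) = G2 (face_map g pi e (vtx R s))) ->
  matched pi e.
Proof.
move=> h1 h2 h3; split=> // x xf; apply/rowP => m; apply/eqP; rewrite -subr_eq0; apply/eqP.
rewrite -(face_pt_id xf).
pose D x := G1 x 0 m - G2 (face_map g pi e x) 0 m.
apply: (@grid_uniqueness R d 1 D f [:: -1; 1]) => //.
- apply: linedegB; first by move=> k y; exact: isQ_line (L1 m) k y.
  exact: linedeg_face_map (L2 m) h2.
- by rewrite /= inE andbT; apply/eqP => h; lra.
move=> y hy; rewrite /D.
pose s l := if f l is Some b then b else y 0 l == 1.
have -> : face_pt f y = vtx R s.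
  apply/rowP => l; rewrite !mxE /s; case fl: (f l) => [//|].
  have := hy l fl; rewrite !inE => /orP[]/eqP ->; rewrite ?eqxx//.
  have -> : (-1 == 1 :> R) = false by apply/negP => /eqP; lra.
  by [].
rewrite h3 ?subrr// => k b fk; by rewrite /s fk.
Qed.

Lemma vtx_bij s : (forall k b, f k = Some b -> s k = b) ->
  exists2 s', (forall k b, g k = Some b -> s' k = b) & G1 (vtx R s) = G2 (vtx R s').
Proof.
move=> h; have : (G1 @` @ref_face_vertices R d f) (G1 (vtx R s)).
  by exists (vtx R s) => //; apply/ref_face_verticesP; exists s.
rewrite fg_vtx => -[y /ref_face_verticesP[s' [-> h']] e]; by exists s'.
Qed.

Lemma face_dim0_matched : (forall l, g l <> None) -> exists pi e, matched pi e.
Proof.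
move=> gn; exists id, (fun=> true); apply: matched_vtx => [l /gn//|a b /[!inE]/eqP/gn//|s hs].
have [s' hs' ->] := vtx_bij hs; congr G2; apply/rowP => l; rewrite !mxE.
by case gl: (g l) => [b|]; [rewrite (hs' _ _ gl)|case: (gn l)].
Qed.

Lemma vtx_inj s s' : vtx R (d := d) s = vtx R s' -> s =1 s'.
Proof. by move=> h l; have := congr1 (fun v : 'rV_d => v 0 l) h; rewrite !mxE => /sgnb_inj. Qed.

Lemma face_dim1_matched k l : (forall m, f m = None <-> m = k) -> (forall m, g m = None <-> m = l) ->
  exists pi e, matched pi e.
Proof.
move=> fk gl.
pose sp b j := if f j is Some c then c else b : bool.
have spf b j c : f j = Some c -> sp b j = c by rewrite /sp => ->.
have spE s : (forall j c, f j = Some c -> s j = c) -> s =1 sp (s k).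
  by move=> h j; rewrite /sp; case fj: (f j) => [c|]; [exact: h|have /fk -> := fj].
have [s' hs' es'] := vtx_bij (spf true).
exists (fun=> k), (fun=> s' l); apply: matched_vtx => [m _|a b|s hs].
- exact/fk.
- by rewrite !inE => /eqP/gl -> /eqP/gl ->.
have [s'' hs'' es''] := vtx_bij hs.
rewrite es''; congr G2; apply/rowP => j; rewrite !mxE.
case gj: (g j) => [b|]; first by rewrite (hs'' _ _ gj).
have /gl -> := gj.
have vE : vtx R s = vtx R (sp (s k)) by apply/rowP => i; rewrite !mxE spE.
case sk: (s k); rewrite sk in vE.
  have : vtx R s'' = vtx R s'.
    by apply: I2; rewrite ?inE; [exact: vtx_ref|exact: vtx_ref|rewrite -es'' -es' vE].
  by move/vtx_inj => ->; rewrite /sgnb mulr1.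
have ne : s'' l != s' l.
  apply/eqP => h.
  have v'' : vtx R s'' = vtx R s'.
    apply/rowP => i; rewrite !mxE; congr sgnb.
    by case gi: (g i) => [c|]; [rewrite (hs'' _ _ gi) (hs' _ _ gi)|have /gl -> := gi].
  have : vtx R s = vtx R (sp true).
    by apply: I1; rewrite ?inE; [exact: vtx_ref|exact: vtx_ref|rewrite es'' es' v''].
  move/vtx_inj/(_ k); rewrite sk /sp.
  by have -> : f k = None by apply/fk.
by move: ne; rewrite /sgnb; case: (s'' l); case: (s' l) => //= _; lra.
Qed.

Section Dim2.
Variables k1 k2 l1 l2 : 'I_d.
Hypothesis k12 : k1 != k2.
Hypothesis l12 : l1 != l2.
Hypothesis f_free : forall m, f m = None <-> m = k1 \/ m = k2.
Hypothesis g_free : forall m, g m = None <-> m = l1 \/ m = l2.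

Let P := cnr G1 f k1.
Let Q := cnr G2 g l1.

Let beta_ex b1 b2 : exists c : bool * bool, P b1 b2 = Q c.1 c.2.
Proof.
have hs j b : f j = Some b -> cnr_sgn f k1 b1 b2 j = b by rewrite /cnr_sgn => ->.
have [s' hs' e] := vtx_bij hs.
exists (s' l1, s' l2); rewrite /P /Q /cnr e; congr G2; apply/rowP => j; rewrite !mxE; congr sgnb.
rewrite /cnr_sgn /=; case gj: (g j) => [c|]; first exact: hs'.
by have /g_free[->|->] := gj; rewrite ?eqxx// eq_sym (negPf l12).
Qed.

Let beta b1 b2 := sval (cid (beta_ex b1 b2)).
Let betaE b1 b2 : P b1 b2 = Q (beta b1 b2).1 (beta b1 b2).2.
Proof. by rewrite /beta; case: cid. Qed.

Let P_inj b1 b2 c1 c2 : P b1 b2 = P c1 c2 -> (b1, b2) = (c1, c2).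
Proof.
move/I1; rewrite !inE => /(_ (vtx_ref _ _) (vtx_ref _ _))/vtx_inj h.
have := h k1; have := h k2; rewrite /cnr_sgn.
have -> : f k1 = None by apply/f_free; left.
have -> : f k2 = None by apply/f_free; right.
by rewrite eqxx eq_sym (negPf k12) => -> ->.
Qed.

Let beta_inj b1 b2 c1 c2 : beta b1 b2 = beta c1 c2 -> (b1, b2) = (c1, c2).
Proof. by move=> h; apply: P_inj; rewrite !betaE h. Qed.

(* [E] is the corner opposite to [A] for [G2] and adjacent to it for [G1]. *)
Let anti_contra (A E C F : 'rV[R]_d) (a b a' b' : R) :
  0 <= a -> 0 <= b -> 0 <= a' -> 0 <= b' ->
  C - A = a *: (E - A) + b *: (F - A) -> E - A = a' *: (C - A) + b' *: (F - A) ->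
  indep2 (C - A) (F - A) -> indep2 (A - E) (C - E) -> False.
Proof.
move=> a0 b0 a0' b0' eC eE i1 i2; apply: (patch_order_contra a0 b0 a0' b0' eC eE i1).
by rewrite opprB addrA subrK.
Qed.

(** Otherwise a diagonal of each patch is an edge of the other. Each diagonal then lies in the cone
    of the edges of its own patch, and the two cone relations are incompatible by [anti_contra]. *)
Let beta_anti b1 b2 : beta (~~ b1) (~~ b2) = (~~ (beta b1 b2).1, ~~ (beta b1 b2).2).
Proof.
apply: contrapT => ne.
have cone1 := cnr_cone L1 J1 k12 f_free (b1 := b1) (b2 := b2).
have eimg := fg_img.
set c := beta b1 b2 in ne *.
have eA : P b1 b2 = Q c.1 c.2 by rewrite betaE.
set c' := beta (~~ b1) (~~ b2) in ne *.
have eC : P (~~ b1) (~~ b2) = Q c'.1 c'.2 by rewrite betaE.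
have nb (b : bool) : ~~ b <> b by case: b.
have nc : c' <> c by move/beta_inj/(congr1 fst)/nb.
set e1 := beta (~~ b1) b2; set e2 := beta b1 (~~ b2).
have eE1 : P (~~ b1) b2 = Q e1.1 e1.2 by rewrite betaE.
have eE2 : P b1 (~~ b2) = Q e2.1 e2.2 by rewrite betaE.
have n1 : e1 <> c by move/beta_inj/(congr1 fst)/nb.
have n2 : e2 <> c by move/beta_inj/(congr1 snd)/nb.
have n12 : e1 <> e2 by move/beta_inj/(congr1 fst)/nb.
have n1' : e1 <> c' by move/beta_inj/(congr1 snd)/esym/nb.
have n2' : e2 <> c' by move/beta_inj/(congr1 fst)/esym/nb.
have cone2 := cnr_cone L2 J2 l12 g_free (b1 := c.1) (b2 := c.2).
have [mid1 mid2] := cnr_edge_mid L1 k12 f_free b1 b2.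
have [mid3 mid4] := cnr_edge_mid L2 l12 g_free c.1 c.2.
rewrite -/P -/Q in cone1 cone2 mid1 mid2 mid3 mid4.
have iA := cnr_edges_indep L2 J2 l12 g_free (b1 := c.1) (b2 := c.2); rewrite -/Q in iA.
have iE1 := cnr_edges_indep L1 J1 k12 f_free (b1 := ~~ b1) (b2 := b2); rewrite -/P negbK in iE1.
have iE2 := cnr_edges_indep L1 J1 k12 f_free (b1 := b1) (b2 := ~~ b2); rewrite -/P negbK in iE2.
rewrite eimg in cone1 mid1 mid2.
rewrite eA eC eE1 eE2 in cone1 mid1 mid2 iE1 iE2.
move: nc ne n1 n2 n12 n1' n2' cone1 cone2 mid1 mid2 mid3 mid4 iA iE1 iE2.
move: c c' e1 e2 {eA eC eE1 eE2} => c c' e1 e2 nc ne n1 n2 n12 n1' n2'.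
have [[ec' [[-> ->]|[-> ->]]]|[ec' [[-> ->]|[-> ->]]]] := adj_cases nc ne n1 n2 n12 n1' n2';
  rewrite {}ec' /= => cone1 cone2 mid1 mid2 mid3 mid4 iA iE1 iE2.
- have [a [b [a0 b0 h1]]] := cone1 mid3; have [a' [b' [a0' b0' h2]]] := cone2 mid1.
  exact: anti_contra a0 b0 a0' b0' h1 h2 iA iE1.
- have [a [b [a0 b0 h1]]] := cone1 mid3; have [a' [b' [a0' b0' h2]]] := cone2 mid2.
  rewrite [RHS]addrC in h1; exact: anti_contra b0 a0 a0' b0' h1 h2 iA (indep2_sym iE2).
- have [a [b [a0 b0 h1]]] := cone1 mid4; have [a' [b' [a0' b0' h2]]] := cone2 mid1.
  rewrite [RHS]addrC in h2; exact: anti_contra a0 b0 b0' a0' h1 h2 (indep2_sym iA) iE1.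
- have [a [b [a0 b0 h1]]] := cone1 mid4; have [a' [b' [a0' b0' h2]]] := cone2 mid2.
  rewrite [RHS]addrC in h1; rewrite [RHS]addrC in h2.
  exact: anti_contra b0 a0 b0' a0' h1 h2 (indep2_sym iA) (indep2_sym iE2).
Qed.

Lemma face_dim2_matched : exists pi e, matched pi e.
Proof.
have f1 : f k1 = None by apply/f_free; left.
have f2 : f k2 = None by apply/f_free; right.
have vE s : (forall j b, f j = Some b -> s j = b) -> vtx R s = vtx R (cnr_sgn f k1 (s k1) (s k2)).
  move=> h; apply/rowP => j; rewrite !mxE /cnr_sgn; case fj: (f j) => [b|]; first by rewrite (h _ _ fj).
  by have /f_free[->|->] := fj; rewrite ?eqxx// eq_sym (negPf k12).
have ff := @beta_anti true true; have tf := @beta_anti true false; rewrite /= in ff tf.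
have ne : beta true false <> beta true true by move/beta_inj/(congr1 snd).
have ne2 : beta true false <> beta false false by move/beta_inj/(congr1 fst).
rewrite ff in ne2.
(* A bijection of the corners that respects opposition is a symmetry of the square. The image of
   [(true, false)] tells whether the axes are kept or exchanged, that of [(true, true)] gives the
   signs. *)
have [e|e] : beta true false = ((beta true true).1, ~~ (beta true true).2) \/
    beta true false = (~~ (beta true true).1, (beta true true).2).
  move: ne ne2; case: (beta true false) => -[] []; case: (beta true true) => -[] [] //= ? ?; auto.
- exists (fun l => if l == l1 then k1 else k2), (fun l => if l == l1 then (beta true true).1 else (beta true true).2).
  apply: matched_vtx => [l _|a b|s hs].
  + by case: ifP.
  + rewrite !inE => /eqP/g_free[->|->] /eqP/g_free[->|->] //; rewrite eqxx eq_sym (negPf l12).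
      by move=> /eqP; rewrite (negPf k12).
    by move=> /eqP; rewrite eq_sym (negPf k12).
  rewrite vE// -/(cnr G1 f k1 _ _) -/(P _ _) betaE /Q /cnr; congr G2; apply/rowP => l; rewrite !mxE.
  rewrite /cnr_sgn; case gl: (g l) => [//|].
  have /g_free[->|->] := gl; rewrite ?eqxx 1?(eq_sym l2) ?(negPf l12) ?f1 ?f2 ?eqxx 1?(eq_sym k2) ?(negPf k12).
    by case: (s k1); case: (s k2); rewrite ?ff ?tf ?e /= /sgnb; case: (beta true true).1 => /=; ring.
  by case: (s k1); case: (s k2); rewrite ?ff ?tf ?e /= /sgnb; case: (beta true true).2 => /=; ring.
- exists (fun l => if l == l1 then k2 else k1), (fun l => if l == l1 then (beta true true).1 else (beta true true).2).
  apply: matched_vtx => [l _|a b|s hs].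
  + by case: ifP.
  + rewrite !inE => /eqP/g_free[->|->] /eqP/g_free[->|->] //; rewrite eqxx eq_sym (negPf l12).
      by move=> /eqP; rewrite eq_sym (negPf k12).
    by move=> /eqP; rewrite (negPf k12).
  rewrite vE// -/(cnr G1 f k1 _ _) -/(P _ _) betaE /Q /cnr; congr G2; apply/rowP => l; rewrite !mxE.
  rewrite /cnr_sgn; case gl: (g l) => [//|].
  have /g_free[->|->] := gl; rewrite ?eqxx 1?(eq_sym l2) ?(negPf l12) ?f1 ?f2 ?eqxx 1?(eq_sym k2) ?(negPf k12).
    by case: (s k1); case: (s k2); rewrite ?ff ?tf ?e /= /sgnb; case: (beta true true).1 => /=; ring.
  by case: (s k1); case: (s k2); rewrite ?ff ?tf ?e /= /sgnb; case: (beta true true).2 => /=; ring.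
Qed.

End Dim2.

Lemma faces_matched : (d <= 3)%N -> face_dim f = face_dim g -> (face_dim f < d)%N ->
  exists pi e, matched pi e.
Proof.
move=> d3 fg fd; have : (face_dim f <= 2)%N by rewrite -ltnS (leq_trans fd).
rewrite leq_eqVlt ltnS leq_eqVlt ltnS leqn0 => /or3P[]/eqP ef.
- have eg := esym fg; rewrite ef in eg.
  have [k1 [k2 [k12 fs]]] : exists x y : 'I_d, x != y /\ [set k | f k == None]%SET = [set x; y]%SET.
    have /cards2P : #|[set k | f k == None]%SET| == 2%N by rewrite -face_dimE; exact/eqP.
    move=> [x [y [xy E]]].
    by exists x, y.
  have [l1 [l2 [l12 gs]]] : exists x y : 'I_d, x != y /\ [set k | g k == None]%SET = [set x; y]%SET.
    have /cards2P : #|[set k | g k == None]%SET| == 2%N by rewrite -face_dimE; exact/eqP.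
    move=> [x [y [xy E]]].
    by exists x, y.
  apply: (@face_dim2_matched k1 k2 l1 l2) => // m.
    have /setP/(_ m) := fs; rewrite !inE => h.
    by split=> [/eqP|h']; [rewrite h => /orP[]/eqP; auto|apply/eqP; rewrite h; case: h' => ->; rewrite eqxx ?orbT].
  have /setP/(_ m) := gs; rewrite !inE => h.
  by split=> [/eqP|h']; [rewrite h => /orP[]/eqP; auto|apply/eqP; rewrite h; case: h' => ->; rewrite eqxx ?orbT].
- have eg := esym fg; rewrite ef in eg.
  have /cards1P[k fs] : #|[set k | f k == None]%SET| == 1%N by rewrite -face_dimE; exact/eqP.
  have /cards1P[l gs] : #|[set k | g k == None]%SET| == 1%N by rewrite -face_dimE; exact/eqP.
  apply: (@face_dim1_matched k l) => m.
    have /setP/(_ m) := fs; rewrite !inE => h.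
    by split=> [/eqP|->]; [rewrite h => /eqP|apply/eqP; have /setP/(_ k) := fs; rewrite !inE eqxx => ->].
  have /setP/(_ m) := gs; rewrite !inE => h.
  by split=> [/eqP|->]; [rewrite h => /eqP|apply/eqP; have /setP/(_ l) := gs; rewrite !inE eqxx => ->].
- apply: face_dim0_matched => l gl; have := esym fg; rewrite ef face_dimE => /eqP; rewrite cards_eq0 => /eqP/setP/(_ l).
  by rewrite !inE gl.
Qed.

End FaceMatching.

(** * Finite element functions on a conforming mesh *)

Section Topology.
Variables (R : realType) (d : nat).
Implicit Types (A : set 'rV[R]_d) (x y : 'rV[R]_d).

Lemma nbhs_rVP x A : nbhs x A <-> exists2 e : R, 0 < e & forall y, `|y - x| < e -> A y.
Proof.
split=> [/nbhs_ballP[e e0 h]|[e e0 h]].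
  by exists e => // y yx; apply: h; rewrite -ball_normE /= distrC.
by apply/nbhs_ballP; exists e => // y; rewrite -ball_normE /= distrC; exact: h.
Qed.

Lemma interior_rVP x A : interior A x <-> exists2 e : R, 0 < e & forall y, `|y - x| < e -> A y.
Proof. exact: nbhs_rVP. Qed.

Lemma open_rVP A : open A -> forall x, A x -> exists2 e : R, 0 < e & forall y, `|y - x| < e -> A y.
Proof. by move=> oA x Ax; apply/nbhs_rVP; exact: open_nbhs_nbhs. Qed.

Lemma closure_rVP x A : closure A x <-> forall e : R, 0 < e -> exists2 y, A y & `|y - x| < e.
Proof.
split=> [cA e e0|h B /nbhs_rVP[e e0 hB]].
  have [|y [Ay yx]] := cA [set y | `|y - x| < e]; first by apply/nbhs_rVP; exists e.
  by exists y.
by have [y Ay yx] := h e e0; exists y; split=> //; exact: hB.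
Qed.

Lemma within_continuous_rVP A (f : 'rV[R]_d -> R) : {within A, continuous f} <->
  forall x e, A x -> 0 < e -> exists2 dl : R, 0 < dl & forall y, A y -> `|y - x| < dl -> `|f y - f x| < e.
Proof.
split=> [/subspace_continuousP cf x e Ax e0|h].
  have := cf x Ax [set z | `|z - f x| < e].
  have nb : nbhs (f x) [set z : R | `|z - f x| < e].
    by apply/nbhs_ballP; exists e => // z; rewrite -ball_normE /= distrC.
  move=> /(_ nb) /nbhs_rVP[dl dl0 hd]; exists dl => // y Ay yx; exact: hd.
apply/subspace_continuousP => x Ax B /nbhs_ballP[e e0 hB].
have [dl dl0 hd] := h x e Ax e0; apply/nbhs_rVP; exists dl => // y yx Ay.
by apply: hB; rewrite -ball_normE /= distrC; exact: hd.
Qed.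

Lemma ref_cell_dense x (e : R) : ref_cellc x -> 0 < e -> exists2 z, ref_cell z & `|z - x| < e.
Proof.
move=> xr e0; pose s := Num.min 1 (e / 2).
have s0 : 0 < s by rewrite lt_min ltr01 divr_gt0.
have s1 : s <= 1 by rewrite ge_min lexx.
have se : s < e by rewrite gt_min; apply/orP; right; lra.
exists ((1 - s) *: x); first by apply: ref_cell_scale => //; apply/andP; split; lra.
have -> : (1 - s) *: x - x = - (s *: x) by rewrite scalerBl scale1r addrAC subrr add0r.
rewrite normrN normrZ gtr0_norm//; apply: le_lt_trans se; rewrite ler_piMr ?(ltW s0)//.
by apply: norm_rV_le => // k; rewrite ler_norml; exact: xr.
Qed.

Lemma finite_min_gt0 (I : finType) (F : I -> R) : (forall i, 0 < F i) ->
  exists2 m : R, 0 < m & forall i, m <= F i.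
Proof.
move=> F0; exists (\big[Num.min/1]_i F i).
  by elim/big_ind: _ => // x y x0 y0; rewrite lt_min x0.
by move=> i; rewrite (bigD1 i)//= ge_min lexx.
Qed.

Lemma diam_ge A (M : R) x y : (forall z, A z -> enorm z <= M) -> A x -> A y -> enorm (x - y) <= diam A.
Proof.
move=> hM Ax Ay; apply: ub_le_sup; last by exists (x, y).
exists (M + M) => _ [[a b] /= [Aa Ab] <-].
by rewrite (le_trans (enormD _ _))// enormN lerD// hM.
Qed.

Lemma diam_le A (M : R) : A !=set0 -> (forall x y, A x -> A y -> enorm (x - y) <= M) -> diam A <= M.
Proof.
move=> [x Ax] h; apply: ge_sup; first by exists (enorm (x - x)), (x, x).
by move=> _ [[a b] /= [Aa Ab] <-]; exact: h.
Qed.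

End Topology.

Section Mesh.
Variables (R : realType) (d : nat) (Omega : set 'rV[R]_d) (sigma gamma : R) (T : mesh R d).
Hypothesis d0 : (0 < d)%N.
Hypothesis d3 : (d <= 3)%N.
Hypothesis sigma1 : 1 <= sigma.
Hypothesis mesh_ok : admissible_mesh Omega sigma gamma T.
Hypothesis geo_lin : multilinear_geo T.
Implicit Types (j : 'I_(ncell T)) (x y xi : 'rV[R]_d).

Lemma geo_inj j : {in @ref_cellc R d &, injective (geo j)}.
Proof. by case: mesh_ok => h _ _ _ _; exact: h. Qed.

Lemma geo_injP j x y : ref_cellc x -> ref_cellc y -> geo j x = geo j y -> x = y.
Proof. by move=> xr yr; apply: geo_inj; rewrite inE. Qed.

Lemma geo_bounded j : exists M, forall x, ref_cellc x -> enorm (geo j x) <= M.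
Proof.
have hM k := isQ_bounded (geo_lin j k).
pose M k := sval (cid2 (hM k)).
have MP k : forall z, ref_cellc z -> `|geo j z 0 k| <= M k by rewrite /M; case: cid2.
have M0 k : 0 <= M k by rewrite /M; case: cid2.
exists (d%:R * \sum_k M k) => x xr; rewrite (le_trans (enorm_le_norm _))// ler_wpM2l//.
apply: norm_rV_le => [|k]; first exact: sumr_ge0.
by rewrite (le_trans (MP k _ xr))// (bigD1 k)//= lerDl sumr_ge0.
Qed.

Lemma cell_diam j x y : ref_cell x -> ref_cell y -> enorm (geo j x - geo j y) <= diam (cell j).
Proof.
move=> xr yr; have [M hM] := geo_bounded j.
by apply: (@diam_ge R d _ M); [move=> _ [z zr <-]; apply: hM; exact: ref_cellcS|exists x|exists y].
Qed.

Lemma ref_cell0 : ref_cell (0 : 'rV[R]_d).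
Proof. by move=> k; rewrite mxE; apply/andP; split; lra. Qed.

Lemma diam_cell_gt0 j : 0 < diam (cell j).
Proof.
pose x : 'rV[R]_d := 2^-1 *: unitv R (Ordinal d0).
have xr : ref_cell x.
  move=> k; rewrite /x -[_ *: _]add0r coord_unitv mxE; case: eqP => _; apply/andP; split; lra.
apply: lt_le_trans (cell_diam j xr ref_cell0).
rewrite lt_neqAle enorm_ge0 eq_sym enorm_eq0 subr_eq0 andbT; apply/eqP.
move/(geo_injP (ref_cellcS xr) (ref_cellcS ref_cell0)) => /(congr1 (fun v : 'rV_d => v 0 (Ordinal d0))).
by rewrite !mxE !eqxx/= => h; lra.
Qed.

Lemma geo_reg j x v : ref_cellc x ->
  sigma^-1 * diam (cell j) * enorm v <= enorm ('D_v (geo j) x) <= sigma * diam (cell j) * enorm v.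
Proof. by case: mesh_ok => _ _ _ _ [h _]; exact: h. Qed.

Lemma geo_continuous j : continuous (geo j).
Proof. exact: G_continuous. Qed.

Lemma geo_jac_unit j x : ref_cellc x -> jac (geo j) x \in unitmx.
Proof. exact: jac_unit (geo_lin j) (diam_cell_gt0 j) sigma1 (@geo_reg j) _. Qed.

(** A continuous injection of a compact set: away from [xi], the distance to [geo j xi] attains a
    positive minimum. *)
Lemma geo_inv_continuous j xi (e : R) : ref_cellc xi -> 0 < e ->
  exists2 dl : R, 0 < dl & forall z, ref_cellc z -> `|geo j z - geo j xi| < dl -> `|z - xi| < e.
Proof.
move=> xir e0.
pose K := [set z : 'rV[R]_d | ref_cellc z /\ e <= `|z - xi|].
have cK : compact K.
  apply: (@compact_closedI _ _ [set z : 'rV[R]_d | e <= `|z - xi|]); first exact: ref_cellc_compact.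
  have -> : [set z : 'rV[R]_d | e <= `|z - xi|] = (fun z : 'rV[R]_d => `|z - xi|) @^-1` [set r | e <= r] by [].
  apply: preimage_closed; last exact: closed_ge.
  move=> z _; apply: (@continuous_comp 'rV[R]_d 'rV[R]_d R (fun z => z - xi) (fun v => `|v|)); last exact: norm_continuous.
  by apply: (@continuousB R 'rV[R]_d); [exact: id|exact: cst_continuous].
have [[z0 Kz0]|K0] := pselect (K !=set0); last first.
  exists 1 => // z zr _; rewrite ltNge; apply/negP => ez; by apply: K0; exists z.
have cf : continuous (fun z : 'rV[R]_d => `|geo j z - geo j xi|).
  move=> z; apply: (@continuous_comp 'rV[R]_d 'rV[R]_d); last exact: norm_continuous.
  by apply: (@continuousB R 'rV[R]_d); [exact: geo_continuous|exact: cst_continuous].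
have [c] := @EVT_min_rV R d (fun z => `|geo j z - geo j xi|) K (ex_intro _ z0 Kz0) cK (continuous_subspaceT cf).
rewrite inE => -[cr ce] hc; exists `|geo j c - geo j xi|.
  rewrite normr_gt0 subr_eq0; apply/eqP => /(geo_injP cr xir) ec.
  by move: ce; rewrite ec subrr normr0 leNgt e0.
move=> z zr zlt; rewrite ltNge; apply/negP => ez.
by have := hc z; rewrite inE => /(_ (conj zr ez)); rewrite leNgt zlt.
Qed.

Lemma closure_cell j : closure (cell j) = geo j @` @ref_cellc R d.
Proof.
rewrite eqEsubset; split.
  have cl : closed (geo j @` @ref_cellc R d).
    apply: compact_closed; first exact: norm_hausdorff.
    apply: continuous_compact; last exact: ref_cellc_compact.
    exact/continuous_subspaceT/geo_continuous.
  have sub : cell j `<=` geo j @` @ref_cellc R d by move=> _ [x xr <-]; exists x => //; exact: ref_cellcS.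
  by move=> y /(closureS sub); rewrite -(closure_id _).1.
move=> _ [x xr <-]; apply/closure_rVP => e e0.
have /rV_continuousP/(_ x e e0)[dl dl0 h] := @geo_continuous j.
have [z zr zx] := ref_cell_dense xr dl0.
by exists (geo j z); [exists z|rewrite distrC h// distrC].
Qed.

Lemma cell_cover y : closure Omega y <-> exists j xi, ref_cellc xi /\ geo j xi = y.
Proof.
case: mesh_ok => _ _ <- _ _; split=> [[j _]|[j [xi [xr <-]]]].
  by rewrite closure_cell => -[xi xr <-]; exists j, xi.
by exists j => //; rewrite closure_cell; exists xi.
Qed.

Lemma geo_closure j xi : ref_cellc xi -> closure Omega (geo j xi).
Proof. by move=> xr; apply/cell_cover; exists j, xi. Qed.

Lemma geo_face_map i j xi eta : i != j -> ref_cellc xi -> ref_cellc eta -> geo i xi = geo j eta ->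
  exists f g pi e, [/\ ref_face f xi, matched (geo i) (geo j) f g pi e & eta = face_map g pi e xi].
Proof.
move=> ij xr er e; case: mesh_ok => _ _ _ conf _.
have [|[f [g [fg fd ef eg ev]]]] := conf i j ij.
  by move/seteqP => [/(_ (geo i xi))h _]; exfalso; apply: h; rewrite !closure_cell; split; [exists xi|exists eta].
have [|pi [s m]] := @faces_matched R d (geo i) (geo j) (geo_lin i) (geo_lin j) (@geo_inj i) (@geo_inj j)
  (@geo_jac_unit i) (@geo_jac_unit j) f g _ ev d3 fg fd; first by rewrite -ef -eg.
have : (closure (cell i) `&` closure (cell j)) (geo i xi).
  by rewrite !closure_cell; split; [exists xi|exists eta].
rewrite ef => -[z zf /(geo_injP (proj1 zf) xr) zx]; rewrite zx in zf.
exists f, g, pi, s; split=> //.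
case: m => _ _ m; apply: (@geo_injP j _ _ er); first by have [] := face_map_ref g pi s xr.
by rewrite -e m.
Qed.

Section Functions.
Variable p : nat.
Hypothesis p0 : (0 < p)%N.
Implicit Types (u v val : 'rV[R]_d -> R) (a b : {ffun 'I_d -> 'I_p.+1}).

Definition node j a : 'rV[R]_d := geo j (gll_pt R a).

Definition local_interp val j xi : R := \sum_a val (node j a) * lgll_tensor a xi.

Lemma support_ptsP x : reflect (exists j a, x = node j a) (x \in support_pts T p).
Proof.
apply: (iffP (imfsetP _ _ _ _)) => [[[j a] _ ->]|[j [a ->]]]; first by exists j, a.
by exists (j, a); rewrite ?inE.
Qed.

Lemma local_interp_isQ val j : isQ p (local_interp val j).
Proof. by apply: isQ_sum => a; apply: isQ_scale; exact: isQ_lgll. Qed.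

Lemma local_interp_node val j a : local_interp val j (gll_pt R a) = val (node j a).
Proof.
rewrite /local_interp (bigD1 a)//= lgll_tensor_node// eqxx mulr1 big1 ?addr0// => b ba.
by rewrite lgll_tensor_node// (negPf ba) mulr0.
Qed.

Lemma gll_coordP (x : 'rV[R]_d) : (forall l, x 0 l \in gll R p) -> exists a, x = gll_pt R a.
Proof.
move=> h.
have hi l : exists i : 'I_p.+1, x 0 l = (gll R p)`_i.
  have := h l; rewrite -index_mem size_gll// => il.
  by exists (Ordinal il); rewrite nth_index.
by exists [ffun l => sval (cid (hi l))]; apply/rowP => l; rewrite mxE ffunE; case: cid.
Qed.

Lemma gll_mem (i : 'I_p.+1) : glln R i \in gll R p.
Proof. by rewrite /glln mem_nth// size_gll. Qed.

Lemma gll_sgnb (c : bool) (x : R) : x \in gll R p -> sgnb R c * x \in gll R p.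
Proof.
move=> xg; case: c; rewrite /sgnb ?mul1r// mulN1r.
have := xg; rewrite -index_mem size_gll// => il.
have -> : x = glln R (Ordinal il) by rewrite /glln nth_index.
by rewrite -glln_rev// gll_mem.
Qed.

Lemma sgnb_gll (c : bool) : sgnb R c \in gll R p.
Proof. by case: c; rewrite /sgnb; [rewrite -(@glln_max R p)|rewrite -(@glln0 R p)]; rewrite ?gll_mem. Qed.

(** Along the common face both interpolants have degree at most [p] on coordinate lines, and
    [face_map] takes nodes to nodes because the GLL points are symmetric and include the
    endpoints. *)
Lemma local_interp_compat val i j xi eta : ref_cellc xi -> ref_cellc eta -> geo i xi = geo j eta ->
  local_interp val i xi = local_interp val j eta.
Proof.
move=> xr er; have [<- /(geo_injP xr er) -> //|ij e] := eqVneq i j.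
have [f [g [pi [s [xf [m1 m2 m3] ->]]]]] := geo_face_map ij xr er e.
apply/eqP; rewrite -subr_eq0; apply/eqP; rewrite -(face_pt_id xf).
pose D x := local_interp val i x - local_interp val j (face_map g pi s x).
have srt := sorted_gll R p0.
apply: (@grid_uniqueness R d p D f (gll R p)).
- apply: linedegB; first by move=> k y; exact: isQ_line (local_interp_isQ val i) k y.
  exact: linedeg_face_map (local_interp_isQ val j) m2.
- exact: lt_sorted_uniq.
- by rewrite size_gll.
move=> y hy; have [a ya] : exists a, face_pt f y = gll_pt R a.
  by apply: gll_coordP => l; rewrite mxE; case fl: (f l) => [b|]; [exact: sgnb_gll|exact: hy].
have [b yb] : exists b, face_map g pi s (face_pt f y) = gll_pt R b.
  apply: gll_coordP => l; rewrite mxE; case gl: (g l) => [b|]; first exact: sgnb_gll.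
  by apply: gll_sgnb; rewrite mxE m1//; apply: hy; exact: m1.
have yf : ref_face f (face_pt f y).
  rewrite -[face_pt f y]face_pt_idem; apply: ref_face_pt; rewrite ya; exact: gll_pt_ref.
by rewrite /D yb {1}ya !local_interp_node /node -ya -yb m3// subrr.
Qed.

(** A preimage is chosen among all cells; [local_interp_compat] makes the choice immaterial. Off the
    mesh the value is 0, as [fe_space] demands. *)
Definition glue val y : R :=
  if pselect (exists z : 'I_(ncell T) * 'rV[R]_d, ref_cellc z.2 /\ geo z.1 z.2 = y) is left h
  then local_interp val (sval (cid h)).1 (sval (cid h)).2 else 0.

Lemma glue_geo val j xi : ref_cellc xi -> glue val (geo j xi) = local_interp val j xi.
Proof.
move=> xr; rewrite /glue; case: pselect => [h|[]]; last by exists (j, xi).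
by case: cid => -[i eta] /= [er e]; exact: local_interp_compat.
Qed.

Lemma glue_out val y : ~ closure Omega y -> glue val y = 0.
Proof.
by move=> h; rewrite /glue; case: pselect => // -[[j xi] /= [xr e]]; case: h; rewrite -e; exact: geo_closure.
Qed.

(** Density and continuity carry the polynomial identity from open to closed cells. Conversely,
    finitely many closed cells with continuous inverse maps give continuity at each point. *)
Lemma fe_spaceP u : fe_space Omega T p u <->
  (forall x, ~ closure Omega x -> u x = 0) /\
  forall j xi, ref_cellc xi -> u (geo j xi) = local_interp u j xi.
Proof.
split=> [[/within_continuous_rVP cu uo uq]|[uo ui]].
  split=> // j xi xr; have [q [qQ uq']] := uq j.
  have key z : ref_cellc z -> u (geo j z) = q z.
    move=> zr; apply/eqP; rewrite -subr_eq0 -normr_le0; apply/ler_addgt0Pl => e e0; rewrite addr0.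
    have e20 : 0 < e / 2 by rewrite divr_gt0.
    have [dl dl0 hdl] := cu (geo j z) _ (@geo_closure j z zr) e20.
    have /rV_continuousP/(_ z dl dl0)[d1 d10 h1] := @geo_continuous j.
    have /rV_continuousP/(_ z _ e20)[d2 d20 h2] := isQ_continuous qQ.
    have [y yr yz] : exists2 y, ref_cell y & `|y - z| < Num.min d1 d2.
      by apply: ref_cell_dense => //; rewrite lt_min d10.
    move: yz; rewrite lt_min => /andP[y1 y2].
    have -> : u (geo j z) - q z = - (u (geo j y) - u (geo j z)) - (q z - q y) by rewrite -(uq' y yr); ring.
    rewrite (le_trans (ler_normB _ _))// normrN [leRHS](splitr e) lerD// ltW//.
      apply: hdl; first exact/geo_closure/ref_cellcS.
      by rewrite distrC h1// distrC.
    by apply: h2; rewrite distrC.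
  rewrite key// (isQ_interp p0 qQ); apply: eq_bigr => a _; rewrite -key//; exact: gll_pt_ref.
split=> // [|j]; last first.
  by exists (local_interp u j); split; [exact: local_interp_isQ|move=> x /ref_cellcS/ui].
apply/within_continuous_rVP => x e cx e0.
have hj j : exists2 dl : R, 0 < dl & forall xi, ref_cellc xi -> `|geo j xi - x| < dl -> `|u (geo j xi) - u x| < e.
  have [[eta er <-]|nx] := pselect ((geo j @` @ref_cellc R d) x).
    have /rV_continuousP/(_ eta e e0)[d1 d10 h1] := isQ_continuous (local_interp_isQ u j).
    have [dl dl0 hdl] := geo_inv_continuous j er d10.
    exists dl => // xi xr /(hdl _ xr) xe; rewrite !ui// distrC h1// distrC//.
  have : open (~` closure (cell j)) by rewrite openC; exact: closed_closure.
  move=> /open_rVP/(_ x); rewrite closure_cell => /(_ nx)[dl dl0 h]; exists dl => // xi xr /h [].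
  by exists xi.
pose dl j := sval (cid2 (hj j)).
have dl0 j : 0 < dl j by rewrite /dl; case: cid2.
have hdl j : forall xi, ref_cellc xi -> `|geo j xi - x| < dl j -> `|u (geo j xi) - u x| < e.
  by rewrite /dl; case: cid2.
have [m m0 hm] : exists2 m : R, 0 < m & forall j, m <= dl j by exact: finite_min_gt0.
exists m => // y /cell_cover[j [xi [xr <-]]] yx; apply: hdl => //; exact: lt_le_trans (hm j).
Qed.

Lemma glue_fe val : fe_space Omega T p (glue val).
Proof.
apply/fe_spaceP; split=> [x|j xi xr]; first exact: glue_out.
rewrite glue_geo//; apply: eq_bigr => a _; rewrite /node glue_geo ?local_interp_node//.
exact: gll_pt_ref.
Qed.

Lemma glue_node val x : x \in support_pts T p -> glue val x = val x.
Proof.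
by move=> /support_ptsP[j [a ->]]; rewrite /node glue_geo ?local_interp_node//; exact: gll_pt_ref.
Qed.

(** The glued indicator of [x] is the witness that gives the choice in [phi] its properties. *)
Lemma phiP x : x \in support_pts T p -> [/\ fe_space Omega T p (phi Omega T p x), phi Omega T p x x = 1 &
  forall y, y \in support_pts T p -> y != x -> phi Omega T p x y = 0].
Proof.
move=> xs; apply: (@getPex _ [set u | [/\ fe_space Omega T p u, u x = 1 &
  forall y, y \in support_pts T p -> y != x -> u y = 0]]).
exists (glue (fun y => (y == x)%:R)); split; first exact: glue_fe.
  by rewrite glue_node// eqxx.
by move=> y ys /negPf yx; rewrite glue_node// yx.
Qed.

Lemma phi_node x y : x \in support_pts T p -> y \in support_pts T p -> phi Omega T p x y = (y == x)%:R.
Proof. by move=> xs ys; have [_ h1 h2] := phiP xs; case: eqVneq => [->//|]; exact: h2. Qed.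

Lemma fe_geo u j xi : fe_space Omega T p u -> ref_cellc xi -> u (geo j xi) = local_interp u j xi.
Proof. by move=> /fe_spaceP[_ h]; exact: h. Qed.

Lemma fe_sum (I : finType) (c : I -> R) (F : I -> 'rV[R]_d -> R) :
  (forall i, fe_space Omega T p (F i)) -> fe_space Omega T p (fun x => \sum_i c i * F i x).
Proof.
move=> hF; apply/fe_spaceP; split=> [x nx|j xi xr].
  by rewrite big1// => i _; have [_ -> //] := hF i; rewrite mulr0.
rewrite /local_interp; under [RHS]eq_bigr do rewrite mulr_suml.
rewrite exchange_big; apply: eq_bigr => i _; rewrite (fe_geo _ (hF i))// mulr_sumr.
by apply: eq_bigr => a _; rewrite mulrA.
Qed.

Lemma fe_ext u v : fe_space Omega T p u -> fe_space Omega T p v ->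
  (forall x, x \in support_pts T p -> u x = v x) -> u = v.
Proof.
move=> hu hv e; apply/funext => x; have [/cell_cover[j [xi [xr <-]]]|nx] := pselect (closure Omega x).
  rewrite !fe_geo//; apply: eq_bigr => a _; rewrite e//; apply/support_ptsP; by exists j, a.
by have [_ -> //] := hu; have [_ -> //] := hv.
Qed.

Lemma interior_ptsP x : reflect (x \in support_pts T p /\ ~ bdry Omega x) (x \in interior_pts Omega T p).
Proof. by rewrite !inE; apply: (iffP andP) => -[? /asboolP]. Qed.

Local Notation n := (ndof Omega T p).

Lemma dof_interior (k : 'I_n) : dof k \in interior_pts Omega T p.
Proof. by rewrite /dof mem_nth. Qed.

Lemma dof_support (k : 'I_n) : dof k \in support_pts T p.
Proof. by have /interior_ptsP[] := dof_interior k. Qed.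

Lemma dof_inj : injective (@dof R d Omega T p).
Proof.
move=> k l /eqP; rewrite /dof nth_uniq//; first by move/eqP/val_inj.
exact: fset_uniq.
Qed.

Lemma dof_surj x : x \in interior_pts Omega T p -> exists k : 'I_n, dof k = x.
Proof. by move=> xi; have := xi; rewrite -index_mem => ix; exists (Ordinal ix); rewrite /dof nth_index. Qed.

Lemma realize_fe (c : 'cV[R]_n) : fe_space Omega T p (realize c).
Proof. by apply: fe_sum => k; have [] := phiP (dof_support k). Qed.

Lemma realize_dof (c : 'cV[R]_n) k : realize c (dof k) = c k 0.
Proof.
rewrite /realize (bigD1 k)//= phi_node ?dof_support// eqxx mulr1 big1 ?addr0// => l lk.
by rewrite phi_node ?dof_support// (inj_eq dof_inj) eq_sym (negPf lk) mulr0.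
Qed.

Lemma coords_realize (c : 'cV[R]_n) : coords Omega T p (realize c) = c.
Proof. by apply/colP => k; rewrite mxE realize_dof. Qed.

Lemma realize_bdry_node (c : 'cV[R]_n) x : x \in support_pts T p -> bdry Omega x -> realize c x = 0.
Proof.
move=> xs bx; rewrite /realize big1// => k _; rewrite phi_node ?dof_support//.
case: eqVneq => [e|_]; last by rewrite mulr0.
by have /interior_ptsP[_] := dof_interior k; rewrite -e.
Qed.

Lemma V_realize v : V_space Omega T p v -> realize (coords Omega T p v) = v.
Proof.
move=> [fv bv]; apply: fe_ext => //; first exact: realize_fe.
move=> x xs; have [bx|nb] := pselect (bdry Omega x); first by rewrite realize_bdry_node// bv.
have [|k <-] := @dof_surj x; first by apply/interior_ptsP.
by rewrite realize_dof mxE.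
Qed.

End Functions.

End Mesh.

(** * Vanishing on the boundary *)

Section Boundary.
Variables (R : realType) (d : nat) (Omega : set 'rV[R]_d) (sigma gamma : R) (T : mesh R d).
Hypothesis d0 : (0 < d)%N.
Hypothesis d3 : (d <= 3)%N.
Hypothesis sigma1 : 1 <= sigma.
Hypothesis mesh_ok : admissible_mesh Omega sigma gamma T.
Hypothesis geo_lin : multilinear_geo T.
Hypothesis dom : admissible_domain Omega.
Implicit Types (j k : 'I_(ncell T)) (x y v xi eta : 'rV[R]_d).

(** The tangent cone of the reference cube at [eta]: only the active facets impose a sign. *)
Definition inward eta (c : 'rV[R]_d) := forall l, (eta 0 l = 1 -> c 0 l <= 0) /\ (eta 0 l = -1 -> 0 <= c 0 l).

(** The direction [v] pulled back to the reference cell; locked to hide the inverse matrix from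
    simplification. *)
Definition dir j v eta : 'rV[R]_d := locked (v *m invmx (jac (geo j) eta)).

Lemma not_inward eta c : ~ inward eta c -> exists l (s : bool), eta 0 l = sgnb R s /\ 0 < sgnb R s * c 0 l.
Proof.
move=> h; apply: contrapT => h'; apply: h => l; split=> e; rewrite leNgt; apply/negP => cl; apply: h'; exists l.
  by exists true; rewrite /sgnb mul1r.
by exists false; rewrite /sgnb mulN1r oppr_gt0.
Qed.

Lemma inwardS eta c l (s : bool) : inward eta c -> eta 0 l = sgnb R s -> sgnb R s * c 0 l <= 0.
Proof.
move=> /(_ l)[h1 h2]; case: s; rewrite /sgnb => e; first by rewrite mul1r h1.
by rewrite mulN1r oppr_le0 h2.
Qed.

Let sigma0 : 0 < sigma := lt_le_trans ltr01 sigma1.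

Let OmegaI : interior Omega = Omega.
Proof. by apply/interior_id; case: dom. Qed.

Lemma dir_jac j v eta : ref_cellc eta -> dir j v eta *m jac (geo j) eta = v.
Proof. by move=> er; rewrite /dir -lock mulmxKV// (geo_jac_unit d0 sigma1 mesh_ok geo_lin). Qed.

Lemma jac_geo_lower j eta (w : 'rV[R]_d) : ref_cellc eta ->
  enorm w <= sigma / diam (cell j) * enorm (w *m jac (geo j) eta).
Proof.
move=> er; have dl0 := diam_cell_gt0 d0 mesh_ok geo_lin j.
have /andP[h _] := jac_reg (geo_lin j) (@geo_reg R d Omega sigma gamma T mesh_ok j) w er.
have p : 0 < sigma / diam (cell j) by rewrite divr_gt0.
move: h; rewrite -(ler_pM2l p) (_ : sigma / diam (cell j) * (sigma^-1 * diam (cell j) * enorm w) = enorm w)//.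
by field; rewrite !gt_eqF.
Qed.

Lemma dir_bound j v eta : ref_cellc eta -> enorm (dir j v eta) <= sigma / diam (cell j) * enorm v.
Proof. by move=> er; have := jac_geo_lower j (dir j v eta) er; rewrite dir_jac. Qed.

Lemma geo_taylor j eta z : ref_cellc eta -> ref_cellc z ->
  enorm (geo j z - geo j eta - (z - eta) *m jac (geo j) eta) <= K0 R d * diam (cell j) * `|z - eta| ^+ 2.
Proof.
exact: (G_taylor (geo_lin j) (@cell_diam R d T geo_lin j)
  (diam_cell_gt0 d0 mesh_ok geo_lin j)).
Qed.

(** The local lower bound for [geo j] makes [z - eta] of order [s]; the Taylor remainder is then of
    order [s^2]. *)
Lemma dir_quadratic j v eta : ref_cellc eta -> exists s0 B : R, [/\ 0 < s0, 0 <= B &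
  forall s z, 0 < s < s0 -> ref_cellc z -> geo j z = geo j eta + s *: v ->
    enorm (s *: dir j v eta - (z - eta)) <= B * s ^+ 2].
Proof.
move=> er; set dl := diam (cell j); have dl0 : 0 < dl := diam_cell_gt0 d0 mesh_ok geo_lin j.
have r0 := rho0_gt0 d0 sigma1.
have [e e0 he] := geo_inv_continuous mesh_ok geo_lin j er r0.
have N0 : 0 <= enorm v := enorm_ge0 v.
have K00 : 0 < K0 R d := K0_gt0 R d0.
pose A := 2 * sigma / dl * enorm v.
have A0 : 0 <= A by rewrite mulr_ge0// divr_ge0 ?ltW// mulr_gt0.
exists (e / (enorm v + 1)), (sigma / dl * (K0 R d * dl * A ^+ 2)); split.
- by rewrite divr_gt0// ltr_wpDl.
- by rewrite mulr_ge0 ?(ltW (divr_gt0 _ _))// mulr_ge0 ?exprn_ge0// mulr_ge0 ?ltW.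
move=> s z /andP[sp slt] zr ez.
have sv : geo j z - geo j eta = s *: v by rewrite ez addrAC subrr add0r.
have zr0 : `|z - eta| <= rho0 d sigma.
  apply/ltW/he => //; rewrite sv (le_lt_trans (norm_le_enorm _))// enormZ gtr0_norm//.
  move: slt; rewrite ltr_pdivlMr ?ltr_wpDl// => /(le_lt_trans _); apply.
  by rewrite ler_wpM2l ?lerDl// ltW.
have zA : `|z - eta| <= A * s.
  have := G_lower d0 (geo_lin j) (@cell_diam R d T geo_lin j) dl0 sigma1
    (@geo_reg R d Omega sigma gamma T mesh_ok j) er zr zr0.
  rewrite sv enormZ gtr0_norm// -/dl => h.
  have c0 : 0 < dl / (2 * sigma) by rewrite divr_gt0// mulr_gt0.
  rewrite -(ler_pM2l c0) (le_trans h)// (_ : dl / (2 * sigma) * (A * s) = s * enorm v)//.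
  by rewrite /A; field; rewrite !gt_eqF.
clearbody A; rewrite (le_trans (jac_geo_lower j _ er))// -/dl -!mulrA ler_pM2l// ler_pM2l ?invr_gt0//.
rewrite mulmxBl -scalemxAl dir_jac// -sv (le_trans (geo_taylor j er zr))// -/dl.
rewrite -!mulrA ler_pM2l// ler_pM2l// (_ : A * (A * s ^+ 2) = (A * s) ^+ 2); last by ring.
by rewrite ler_sqr ?nnegrE// mulr_ge0// ltW.
Qed.

Lemma cell_escape j x v : (forall eta, ref_cellc eta -> geo j eta = x -> ~ inward eta (dir j v eta)) ->
  exists2 s0 : R, 0 < s0 & forall s z, 0 < s < s0 -> ref_cellc z -> geo j z <> x + s *: v.
Proof.
move=> h; have [[eta er ex]|nx] := pselect ((geo j @` @ref_cellc R d) x); last first.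
  have : open (~` closure (cell j)) by rewrite openC; exact: closed_closure.
  move=> /open_rVP/(_ x); rewrite (closure_cell geo_lin) => /(_ nx)[e e0 he].
  exists (e / (`|v| + 1)); first by rewrite divr_gt0// ltr_wpDl.
  move=> s z /andP[sp slt] zr ez; apply: (he (x + s *: v)); last by exists z.
  rewrite addrAC subrr add0r normrZ gtr0_norm//.
  move: slt; rewrite ltr_pdivlMr ?ltr_wpDl// => /(le_lt_trans _); apply.
  by rewrite ler_wpM2l ?lerDl// ltW.
have [l [b [el cl]]] := not_inward (h _ er ex).
have [s0 [B [s00 B0 hB]]] := dir_quadratic j v er.
set c := sgnb R b * _ in cl.
(* Below [c / (B + 1)] the outward drift [s c] exceeds the error [B s^2]. *)
exists (Num.min s0 (c / (B + 1))); first by rewrite lt_min s00 divr_gt0// ltr_wpDl.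
move=> s z; rewrite lt_min => /andP[sp /andP[ss0 sc]] zr; rewrite -ex => ez.
have := hB s z; rewrite sp ss0 => /(_ isT zr ez) h1.
have := le_trans (coord_enorm _ l) h1; rewrite !mxE.
have : sgnb R b * (s * dir j v eta 0 l - (z 0 l - eta 0 l)) <= `|s * dir j v eta 0 l - (z 0 l - eta 0 l)|.
  by rewrite /sgnb; case: b {el cl c sc} => //; rewrite ?mul1r ?mulN1r ?ler_norm// -normrN ler_norm.
move=> h2 h3; have := le_trans h2 h3.
have : sgnb R b * (z 0 l - eta 0 l) <= 0.
  by have /andP[] := zr l; rewrite el /sgnb; case: b {el cl c sc h2} => ? ?; lra.
move=> h4 h5; move: sc; rewrite ltr_pdivlMr ?ltr_wpDl// => sc.
have : s * c <= B * s ^+ 2 by rewrite /c; lra.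
rewrite (_ : B * s ^+ 2 = s * (B * s)); last by ring.
rewrite ler_pM2l// => h6; have : 0 < s by []; lra.
Qed.

(** A short ray from a point of [Omega] stays in [Omega], which finitely many closed cells cover; it
    cannot escape all of them. *)
Lemma inward_cover x v : Omega x -> exists j eta, [/\ ref_cellc eta, geo j eta = x & inward eta (dir j v eta)].
Proof.
move=> Ox; apply: contrapT => h.
have hj j : exists2 s0 : R, 0 < s0 & forall s z, 0 < s < s0 -> ref_cellc z -> geo j z <> x + s *: v.
  by apply: cell_escape => eta er ex i; apply: h; exists j, eta.
pose s0 j := sval (cid2 (hj j)).
have s00 j : 0 < s0 j by rewrite /s0; case: cid2.
have hs0 j : forall s z, 0 < s < s0 j -> ref_cellc z -> geo j z <> x + s *: v by rewrite /s0; case: cid2.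
have [m m0 hm] := finite_min_gt0 s00.
case: dom => oO _ _ _; have [e e0 he] := open_rVP oO Ox.
pose s := Num.min (m / 2) (e / (2 * (`|v| + 1))).
have v1 : 0 < `|v| + 1 by rewrite ltr_wpDl.
have sp : 0 < s by rewrite lt_min !divr_gt0// mulr_gt0.
have sm : s < m by rewrite gt_min; apply/orP; left; lra.
have se : s <= e / (2 * (`|v| + 1)) by rewrite ge_min lexx orbT.
have Os : Omega (x + s *: v).
  apply: he; rewrite addrAC subrr add0r normrZ gtr0_norm//.
  move: se; rewrite ler_pdivlMr ?mulr_gt0//; have := normr_ge0 v; nra.
have /(cell_cover mesh_ok geo_lin)[j [z [zr ez]]] := subset_closure Os.
by apply: (hs0 j s z) => //; rewrite sp (lt_le_trans sm).
Qed.

Lemma inward_curve j eta v : ref_cellc eta -> inward eta (dir j v eta) ->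
  exists s0 B : R, [/\ 0 < s0, 0 <= B & forall s, 0 < s < s0 ->
    exists2 y, closure Omega y & enorm (y - (geo j eta + s *: v)) <= B * s ^+ 2].
Proof.
move=> er hi; set c := dir j v eta in hi.
(* Room for the step in each coordinate: the distance to the nearer facet if none is active, and
   otherwise 1, which suffices because [c] does not point out of the active facet. *)
pose F l := (if `|eta 0 l| == 1 then 1 else 1 - `|eta 0 l|) / (`|c 0 l| + 1).
have F0 l : 0 < F l.
  rewrite /F divr_gt0 ?ltr_wpDl//; case: eqVneq => // ne.
  by rewrite subr_gt0 lt_neqAle ne/= ler_norml; exact: er.
have [m m0 hm] := finite_min_gt0 F0.
exists m, (K0 R d * diam (cell j) * `|c| ^+ 2); split=> //.
  by rewrite mulr_ge0 ?exprn_ge0// mulr_ge0 ?ltW ?K0_gt0 ?(diam_cell_gt0 d0 mesh_ok).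
move=> s /andP[s0 sm].
have zr : ref_cellc (eta + s *: c).
  move=> l; rewrite !mxE; have /andP[e1 e2] := er l; have [i1 i2] := hi l.
  have c0 : 0 < `|c 0 l| + 1 by rewrite ltr_wpDl.
  have := lt_le_trans sm (hm l); rewrite /F ltr_pdivlMr// => h.
  have h1 : s * `|c 0 l| <= s * (`|c 0 l| + 1) by rewrite ler_pM2l// lerDl.
  have : `|s * c 0 l| < if `|eta 0 l| == 1 then 1 else 1 - `|eta 0 l|.
    by rewrite normrM gtr0_norm//; lra.
  have [E|_] := eqVneq `|eta 0 l| 1; last first.
    rewrite ltr_norml => /andP[a b]; have := ler_norm (eta 0 l); have := ler_norm (- eta 0 l); rewrite normrN.
    by move=> ? ?; apply/andP; split; lra.
  rewrite ltr_norml => /andP[a b]; move: E; have [ep|en] := lerP 0 (eta 0 l).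
    by rewrite ger0_norm// => E; have := i1 E; rewrite -(ler_pM2l s0) mulr0 => ?; apply/andP; split; lra.
  rewrite ltr0_norm// => E; have e' : eta 0 l = -1 by lra.
  by have := i2 e'; rewrite -(ler_pM2l s0) mulr0 => ?; apply/andP; split; lra.
exists (geo j (eta + s *: c)); first exact: (geo_closure mesh_ok geo_lin).
have := geo_taylor j er zr; rewrite (_ : eta + s *: c - eta = s *: c); last by rewrite addrAC subrr add0r.
rewrite -scalemxAl dir_jac// normrZ gtr0_norm// exprMn opprD addrA => /le_trans; apply.
by rewrite (mulrC (s ^+ 2)) mulrA.
Qed.

(** Moving by [s] against the graph direction [e] leads below the Lipschitz graph by a margin of
    order [s]. If [-e] were inward for some cell, the closed domain would contain a point within
    [O(s^2)] of the place reached. *)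
Lemma bdry_outward x : bdry Omega x ->
  exists v, forall j eta, ref_cellc eta -> geo j eta = x -> ~ inward eta (dir j v eta).
Proof.
case: dom => oO _ _ lip bx; have [r [e [M [g [r0 e1 gL ge gO]]]]] := lip x bx.
have cl y : closure Omega y -> enorm (y - x) < r -> g y <= dotv y e.
  move=> cy yr; rewrite leNgt; apply/negP => lt.
  pose a := g y - dotv y e; have a0 : 0 < a by rewrite subr_gt0.
  pose f := Num.min ((r - enorm (y - x)) / d%:R) (a / (d%:R * (`|M| + 2))).
  have dr : 0 < d%:R :> R by rewrite ltr0n.
  have f0 : 0 < f by rewrite lt_min !divr_gt0 ?subr_gt0// mulr_gt0// ltr_wpDl.
  have [z Oz zy] := (closure_rVP _ _).1 cy f f0.
  move: zy; rewrite lt_min => /andP[z1 z2].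
  have zE := enorm_le_norm (z - y).
  have z1' : enorm (z - y) < r - enorm (y - x).
    by apply: le_lt_trans zE _; rewrite mulrC -ltr_pdivlMr.
  have zx : enorm (z - x) < r.
    by have := enormD (z - y) (y - x); rewrite addrA subrK; lra.
  have M2 : 0 < `|M| + 2 by rewrite ltr_wpDl.
  have z2' : enorm (z - y) * (`|M| + 2) < a.
    move: z2; rewrite ltr_pdivlMr ?mulr_gt0// mulrA => h; apply: le_lt_trans h.
    by rewrite ler_pM2r// mulrC.
  have h1 := (gO z zx).1 Oz.
  have h2 := gL z y; have h3 : `|dotv (z - y) e| <= enorm (z - y) by have := dotv_le (z - y) e; rewrite e1 mulr1.
  have h4 : dotv z e = dotv (z - y) e + dotv y e by rewrite -dotvDl subrK.
  have h5 := ler_norm M; have h6 := enorm_ge0 (z - y).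
  have h7 : M * enorm (z - y) <= `|M| * enorm (z - y) by rewrite ler_wpM2r.
  move: h2 h3; rewrite !ler_norml => /andP[h2 _] /andP[_ h3]; rewrite /a in z2'; lra.
have nOx : ~ Omega x by case: bx => _ nx Ox; apply: nx; rewrite OmegaI.
have gx : dotv x e <= g x.
  rewrite leNgt; apply/negP => h; apply/nOx/gO => //.
  by rewrite subrr -[X in enorm X](scale0r 0) enormZ normr0 mul0r.
exists (- e) => j eta er ex hi.
have [s0 [B [s00 B0 hB]]] := inward_curve er hi.
have M1 : 0 < `|M| + 1 by rewrite ltr_wpDl.
pose s := Num.min (s0 / 2) (Num.min 1 (Num.min (r / (2 * (1 + B))) (1 / (2 * (`|M| + 1) * (B + 1))))).
have B1 : 0 < B + 1 by rewrite ltr_wpDl.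
have B1' : 0 < 1 + B by lra.
have sp : 0 < s by rewrite !lt_min ltr01 !divr_gt0 ?mulr_gt0.
have ss0 : s < s0 by rewrite gt_min; apply/orP; left; lra.
have s1 : s <= 1 by rewrite !ge_min lexx orbT.
have sr : s <= r / (2 * (1 + B)) by rewrite !ge_min lexx !orbT.
have sM : s <= 1 / (2 * (`|M| + 1) * (B + 1)) by rewrite !ge_min lexx !orbT.
have [|y cy yB] := hB s; first by rewrite sp.
rewrite ex in yB; set b := y - _ in yB.
have ey : y = x - s *: e + b by rewrite /b scalerN addrC subrK.
clearbody b; have ss : s ^+ 2 <= s by rewrite expr2 ler_piMl// ltW.
have yr : enorm (y - x) < r.
  have -> : y - x = - (s *: e) + b by rewrite ey; apply/rowP => ?; rewrite !mxE; ring.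
  have := enormD (- (s *: e)) b; rewrite enormN enormZ e1 mulr1 gtr0_norm// => h.
  have : B * s ^+ 2 <= B * s by rewrite ler_wpM2l.
  by move: sr; rewrite ler_pdivlMr ?mulr_gt0// => ? ?; lra.
have h1 := cl y cy yr.
have h2 : g x = g (x - s *: e) by rewrite -scaleNr ge.
have h3 := gL y (x - s *: e).
have yb : y - (x - s *: e) = b by rewrite ey addrAC subrr add0r.
have h4 : `|dotv b e| <= enorm b by have := dotv_le b e; rewrite e1 mulr1.
have h5 : dotv y e = dotv x e - s + dotv b e.
  by rewrite ey !dotvDl dotvNl dotvZl -enorm_sqr e1 expr1n mulr1.
rewrite yb in h3; have h6 := ler_norm M; have h7 := enorm_ge0 b.
have h8 : M * enorm b <= `|M| * enorm b by rewrite ler_wpM2r.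
move: h3 h4; rewrite !ler_norml => /andP[h3 _] /andP[_ h4].
have h9 : s <= (`|M| + 1) * enorm b by lra.
have h10 : (`|M| + 1) * enorm b <= (`|M| + 1) * (B * s ^+ 2) by rewrite ler_pM2l.
move: sM; rewrite ler_pdivlMr ?mulr_gt0// => sM.
have : s * 1 <= s * ((`|M| + 1) * B * s) by move: (le_trans h9 h10); rewrite mulr1 expr2; lra.
rewrite ler_pM2l// => h11.
have : 0 < (`|M| + 1) * s by rewrite mulr_gt0.
lra.
Qed.

Lemma dir_continuous j v eta0 (e : R) : ref_cellc eta0 -> 0 < e -> exists2 dl : R, 0 < dl &
  forall eta, ref_cellc eta -> `|eta - eta0| < dl -> enorm (dir j v eta - dir j v eta0) < e.
Proof.
move=> er0 e0; set D := diam (cell j); have D0 : 0 < D := diam_cell_gt0 d0 mesh_ok geo_lin j.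
have sD : 0 < sigma / D by rewrite divr_gt0.
have dr : 0 < d%:R :> R by rewrite ltr0n.
have N0 := enorm_ge0 v.
pose K := sigma / D * (d%:R * (d%:R * (sigma / D * enorm v))).
have K0 : 0 <= K by rewrite /K !(mulr_ge0 (ltW sD), mulr_ge0 (ltW dr)).
have e'0 : 0 < e / (K + 1) by rewrite divr_gt0// ltr_wpDl.
have hc (km : 'I_d * 'I_d) : exists2 dl : R, 0 < dl & forall eta, `|eta0 - eta| < dl ->
    `|jac (geo j) eta0 km.1 km.2 - jac (geo j) eta km.1 km.2| < e / (K + 1).
  have /rV_continuousP/(_ eta0 _ e'0)[dl dl0 h] := isQ_continuous (isQ_partial (geo_lin j km.2) km.1).
  by exists dl => // eta /h; rewrite !mxE.
pose f km := sval (cid2 (hc km)).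
have f0 km : 0 < f km by rewrite /f; case: cid2.
have hf km : forall eta, `|eta0 - eta| < f km ->
    `|jac (geo j) eta0 km.1 km.2 - jac (geo j) eta km.1 km.2| < e / (K + 1) by rewrite /f; case: cid2.
have [m m0 hm] := finite_min_gt0 f0.
exists m => // eta er lt.
apply: le_lt_trans (jac_geo_lower j _ er0) _; rewrite -/D.
(* This identity replaces continuity of the matrix inverse: only the Jacobian itself has to vary
   little. *)
have -> : (dir j v eta - dir j v eta0) *m jac (geo j) eta0 = dir j v eta *m (jac (geo j) eta0 - jac (geo j) eta).
  by rewrite mulmxBl mulmxBr !dir_jac.
have : enorm (dir j v eta *m (jac (geo j) eta0 - jac (geo j) eta)) <=
    d%:R * (d%:R * (sigma / D * enorm v) * (e / (K + 1))).
  apply: le_trans (enorm_le_norm _) _; rewrite ler_wpM2l ?ler0n//; apply: norm_rV_le => [|l].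
    by rewrite !(mulr_ge0 _ (ltW e'0), mulr_ge0 (ltW sD), mulr_ge0 (ltW dr)).
  rewrite mxE (le_trans (ler_norm_sum _ _ _))//.
  apply: le_trans (_ : \sum_(i < d) sigma / D * enorm v * (e / (K + 1)) <= _).
    apply: ler_sum => i _; rewrite normrM !mxE; apply: ler_pM => //.
      exact: le_trans (coord_enorm _ i) (dir_bound j v er).
    have := hf (i, l) eta; rewrite !mxE => h; apply/ltW/h.
    by rewrite distrC; apply: lt_le_trans lt (hm _).
  by rewrite sumr_const card_ord -[leRHS]mulrA mulr_natl.
move=> h; apply: le_lt_trans (_ : sigma / D * (d%:R * (d%:R * (sigma / D * enorm v) * (e / (K + 1)))) < _).
  by rewrite ler_pM2l.
rewrite (_ : _ * _ = K * (e / (K + 1))); last by rewrite /K; ring.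
rewrite mulrA ltr_pdivrMr ?ltr_wpDl// mulrC ltr_pM2l//; lra.
Qed.

Lemma not_inward_near j v eta0 : ref_cellc eta0 -> ~ inward eta0 (dir j v eta0) ->
  exists2 dl : R, 0 < dl & forall eta, ref_cellc eta -> `|eta - eta0| < dl ->
    (forall l s, eta0 0 l = sgnb R s -> eta 0 l = sgnb R s) -> ~ inward eta (dir j v eta).
Proof.
move=> er0 /not_inward[l [s [el cl]]].
have [dl dl0 h] := dir_continuous j v er0 cl; exists dl => // eta er lt hs hi.
have := inwardS hi (hs _ _ el); have := le_lt_trans (coord_enorm _ l) (h eta er lt); rewrite !mxE ltr_norml.
move: cl {h hi}; move: (dir j v eta 0 l) (dir j v eta0 0 l) => a b.
by rewrite /sgnb; case: s {el} => ? /andP[? ?] ?; lra.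
Qed.

(** The condition on signs keeps the half-open segment in one open face. In each cell sharing it the
    active facets do not change along the segment, so a strictly violated constraint stays violated
    nearby; cells that do not contain the point stay away from its neighbours. *)
Lemma not_inward_line j xi0 w t0 v :
  (forall t, 0 < t <= 1 -> ref_cellc (xi0 + t *: w)) ->
  (forall t t' l s, 0 < t <= 1 -> 0 < t' <= 1 -> (xi0 + t *: w) 0 l = sgnb R s -> (xi0 + t' *: w) 0 l = sgnb R s) ->
  0 < t0 <= 1 ->
  (forall k eta, ref_cellc eta -> geo k eta = geo j (xi0 + t0 *: w) -> ~ inward eta (dir k v eta)) ->
  exists2 e : R, 0 < e & forall t, 0 < t <= 1 -> `|t - t0| < e ->
    forall k eta, ref_cellc eta -> geo k eta = geo j (xi0 + t *: w) -> ~ inward eta (dir k v eta).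
Proof.
move=> wr ws t01 h; have w1 : 0 < `|w| + 1 by rewrite ltr_wpDl.
have near t (e : R) : 0 < e -> `|t - t0| < e / (`|w| + 1) -> `|(xi0 + t *: w) - (xi0 + t0 *: w)| < e.
  move=> e0; rewrite ltr_pdivlMr// => lt.
  rewrite opprD addrACA subrr add0r -scalerBl normrZ; apply: le_lt_trans lt.
  by rewrite ler_wpM2l// lerDl.
suff hk k : exists2 e : R, 0 < e & forall t, 0 < t <= 1 -> `|t - t0| < e ->
    forall eta, ref_cellc eta -> geo k eta = geo j (xi0 + t *: w) -> ~ inward eta (dir k v eta).
  pose f k := sval (cid2 (hk k)).
  have f0 k : 0 < f k by rewrite /f; case: cid2.
  have hf k : forall t, 0 < t <= 1 -> `|t - t0| < f k ->
    forall eta, ref_cellc eta -> geo k eta = geo j (xi0 + t *: w) -> ~ inward eta (dir k v eta) by rewrite /f; case: cid2.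
  have [m m0 hm] := finite_min_gt0 f0; exists m => // t t1 lt k; apply: hf => //.
  exact: lt_le_trans lt (hm k).
have [[eta0 er0 ex]|nx] := pselect ((geo k @` @ref_cellc R d) (geo j (xi0 + t0 *: w))); last first.
  have : open (~` closure (cell k)) by rewrite openC; exact: closed_closure.
  move=> /open_rVP; rewrite (closure_cell geo_lin) => /(_ _ nx)[e e0 he].
  have /rV_continuousP/(_ (xi0 + t0 *: w) e e0)[e1 e10 h1] := @geo_continuous R d T geo_lin j.
  exists (e1 / (`|w| + 1)); first by rewrite divr_gt0.
  move=> t t1 /near lt eta er eeq _; apply: (he (geo j (xi0 + t *: w))); last by exists eta.
  by rewrite distrC; apply: h1; rewrite distrC; exact: lt.
have ni := h k eta0 er0 ex.
have [dl dl0 hdl] := not_inward_near er0 ni.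
exists (dl / (`|w| + 1)); first by rewrite divr_gt0.
move=> t t1 /(near t _ dl0) lt eta er eeq.
have [kj|kj] := eqVneq k j.
  subst k; have ee := geo_injP mesh_ok er (wr t t1) eeq.
  have ee0 := geo_injP mesh_ok er0 (wr t0 t01) ex.
  apply: hdl => //; first by rewrite ee ee0.
  by move=> l s; rewrite ee ee0; exact: ws.
rewrite eq_sym in kj.
have [f [g [pi [s [xf [m1 m2 m3] e0]]]]] := geo_face_map d0 d3 sigma1 mesh_ok geo_lin kj (wr t0 t01) er0 (esym ex).
have xtf : ref_face f (xi0 + t *: w).
  by split=> [|l b fl]; [exact: wr|apply: (ws t0) => //; case: xf => _; apply].
have ee : eta = face_map g pi s (xi0 + t *: w).
  apply: (@geo_injP _ _ _ _ _ _ mesh_ok k _ _ er); first by have [] := face_map_ref g pi s (wr t t1).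
  by rewrite eeq m3.
have diff l : `|(eta - eta0) 0 l| <= `|(xi0 + t *: w) - (xi0 + t0 *: w)|.
  rewrite ee e0 !mxE; case gl: (g l) => [b|]; first by rewrite subrr normr0.
  rewrite -mulrBr normrM (_ : `|sgnb R (s l)| = 1) ?mul1r; last by case: (s l); rewrite /sgnb ?normrN normr1.
  by have := coord_norm ((xi0 + t *: w) - (xi0 + t0 *: w)) (pi l); rewrite !mxE.
apply: hdl => //.
  by apply: le_lt_trans lt; exact: norm_rV_le.
move=> l b; rewrite ee e0 !mxE; case gl: (g l) => [c//|].
have sg (z : R) : sgnb R (s l) * z = sgnb R b -> z = sgnb R (s l == b).
  by rewrite /sgnb; case: (s l); case: b => /= ?; lra.
have sg' (z : R) : z = sgnb R (s l == b) -> sgnb R (s l) * z = sgnb R b.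
  by move=> -> {sg}; rewrite /sgnb; case: (s l); case: b => /=; lra.
move=> /sg z0; apply: sg'; have := ws t0 t (pi l) (s l == b) t01 t1; rewrite !mxE; exact.
Qed.

Lemma interior_pts_Omega p x : (0 < p)%N -> x \in interior_pts Omega T p -> Omega x.
Proof.
move=> p0 /(interior_ptsP Omega T p)[/(support_ptsP)[j [a xE]] nb].
have cx : closure Omega x by rewrite xE; apply: (geo_closure mesh_ok geo_lin); exact: gll_pt_ref.
case: dom => oO _ _ _; apply: contrapT => nO; apply: nb; split=> //; by rewrite OmegaI.
Qed.

Lemma phi_bdry p x y : (0 < p)%N -> x \in interior_pts Omega T p -> bdry Omega y -> phi Omega T p x y = 0.
Proof.
move=> p0 xi by_; have Ox := interior_pts_Omega p0 xi.
case: dom => oO _ _ _.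
have nOy : ~ Omega y by case: by_ => _ ny Oy; apply: ny; rewrite OmegaI.
have [cy _] := by_; have [j [xi1 [x1r ey]]] := (cell_cover mesh_ok geo_lin y).1 cy.
have /interior_ptsP[xs _] := xi.
have [fx _ _] := phiP d0 d3 sigma1 mesh_ok geo_lin p0 xs.
rewrite -ey (fe_geo mesh_ok geo_lin p0 _ fx x1r) /local_interp big1// => a _.
have ns : node j a \in support_pts T p by apply/support_ptsP; exists j, a.
rewrite (phi_node d0 d3 sigma1 mesh_ok geo_lin p0 xs ns).
case: eqVneq => [xa|_]; last by rewrite mul0r.
rewrite mul1r; apply: contrapT => /eqP La.
pose xi0 := gll_pt R a; pose w := xi1 - xi0.
have x0r : ref_cellc xi0 by exact: gll_pt_ref.
(* The basis polynomial of the node does not vanish at [xi1], and on a facet only an end node has a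
   nonzero one-dimensional factor; hence every facet through [xi1] contains the node. *)
have act l s : xi1 0 l = sgnb R s -> xi0 0 l = sgnb R s.
  move=> xl; have : (lgll R (a l)).[xi1 0 l] != 0.
    by move: La; rewrite /lgll_tensor (bigD1 l)//= mulf_eq0 negb_or => /andP[].
  pose i : 'I_p.+1 := if s then ord_max else ord0.
  have gi : sgnb R s = glln R i by rewrite /i /sgnb; case: (s); rewrite ?glln_max ?glln0.
  rewrite xl gi lgll_node//; have [ai _|_] := eqVneq (a l) i; last by rewrite eqxx.
  by rewrite mxE ai.
have xt t l : (xi0 + t *: w) 0 l = (1 - t) * xi0 0 l + t * xi1 0 l by rewrite !mxE; ring.
have wr t : 0 < t <= 1 -> ref_cellc (xi0 + t *: w).
  move=> /andP[t0 t1] l; rewrite xt; have /andP[? ?] := x0r l; have /andP[? ?] := x1r l.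
  by apply/andP; split; nra.
have ws' t l s : 0 < t <= 1 -> (xi0 + t *: w) 0 l = sgnb R s -> xi1 0 l = sgnb R s.
  move=> /andP[t0 t1]; rewrite xt; have /andP[? ?] := x0r l; have /andP[? ?] := x1r l.
  by rewrite /sgnb; case: s => e; nra.
have ws t t' l s : 0 < t <= 1 -> 0 < t' <= 1 -> (xi0 + t *: w) 0 l = sgnb R s -> (xi0 + t' *: w) 0 l = sgnb R s.
  by move=> t1 t1' /(ws' _ _ _ t1) e; rewrite xt e (act _ _ e); ring.
have near t0 : Omega (geo j (xi0 + t0 *: w)) -> exists2 e : R, 0 < e & forall t, `|t - t0| < e ->
    Omega (geo j (xi0 + t *: w)).
  move=> /(open_rVP oO)[e e0 he].
  have /rV_continuousP/(_ (xi0 + t0 *: w) e e0)[e1 e10 h1] := @geo_continuous R d T geo_lin j.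
  have w1 : 0 < `|w| + 1 by rewrite ltr_wpDl.
  exists (e1 / (`|w| + 1)); first by rewrite divr_gt0.
  move=> t; rewrite ltr_pdivlMr// => lt; apply: he; rewrite distrC; apply: h1.
  rewrite opprD addrACA subrr add0r -scalerBl normrZ distrC; apply: le_lt_trans lt.
  by rewrite ler_wpM2l// lerDl.
(* The supremum of the parameters in [Omega] will give a boundary point. The value [t = 0] is left
   out because the node may lie on more facets than the rest of the segment. *)
pose A := [set t : R | 0 < t <= 1 /\ Omega (geo j (xi0 + t *: w))].
have [t1 At1] : A !=set0.
  have [|e e0 he] := near 0; first by rewrite scale0r addr0 -/(node j a) xa.
  exists (Num.min 1 (e / 2)); split.
    by rewrite lt_min ltr01 divr_gt0// ge_min lexx.
  apply: he; rewrite subr0 gtr0_norm ?lt_min ?ltr01 ?divr_gt0// gt_min; apply/orP; right; lra.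
have hA : has_sup A by split; [exists t1|exists 1 => t [/andP[]]].
have s01 : 0 < sup A <= 1.
  rewrite (lt_le_trans _ (ub_le_sup hA.2 At1)); last by have [/andP[]] := At1.
  by apply: ge_sup; [exists t1|move=> t [/andP[]]].
have [OT|nOT] := pselect (Omega (geo j (xi0 + sup A *: w))).
  have [e e0 he] := near _ OT.
  have T1 : sup A < 1.
    rewrite lt_neqAle; have /andP[_ ->] := s01; rewrite andbT; apply/eqP => E.
    by apply: nOy; move: OT; rewrite E scale1r /w addrC subrK ey.
  have : A (Num.min 1 (sup A + e / 2)).
    have /andP[a0 a1] := s01; split.
      by rewrite lt_min ltr01 ge_min lexx /= addr_gt0// divr_gt0.
    by apply: he; rewrite ltr_norml; apply/andP; split; rewrite /Num.min; case: ifP => ?; lra.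
  move=> /(ub_le_sup hA.2); rewrite ge_min leNgt T1/=; lra.
have bT : bdry Omega (geo j (xi0 + sup A *: w)).
  by split; [apply: (geo_closure mesh_ok geo_lin); exact: wr|rewrite OmegaI].
(* This direction lies outside all cones at the supremum, hence also at nearby parameters; some of
   these belong to [Omega], where the cones fill the space. *)
have [v hv] := bdry_outward bT.
have [e e0 he] := not_inward_line wr ws s01 hv.
have [t [tI Ot] lt] := sup_adherent e0 hA.
have le : t <= sup A by apply: (ub_le_sup hA.2).
have [k [eta [er ek]]] := inward_cover v Ot.
apply: he er ek => //; rewrite ltr_norml; apply/andP; split; lra.
Qed.

End Boundary.

(** * Energy and its cell contributions *)

Section CellIntegrals.
Variables (R : realType) (d : nat) (Omega : set 'rV[R]_d) (sigma gamma : R) (T : mesh R d) (p : nat).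
Hypothesis d2 : (2 <= d)%N.
Hypothesis d3 : (d <= 3)%N.
Hypothesis sigma1 : 1 <= sigma.
Hypothesis gamma1 : 1 <= gamma.
Hypothesis mesh_ok : admissible_mesh Omega sigma gamma T.
Hypothesis geo_lin : multilinear_geo T.
Hypothesis dom : admissible_domain Omega.
Hypothesis p0 : (0 < p)%N.
Implicit Types (j : 'I_(ncell T)) (x y v xi eta : 'rV[R]_d) (u w : 'rV[R]_d -> R).

Let d0 : (0 < d)%N := ltn_trans (ltn0Sn 0) d2.
Let sigma0 : 0 < sigma := lt_le_trans ltr01 sigma1.
Let gamma0 : 0 < gamma := lt_le_trans ltr01 gamma1.
Let dl0 j : 0 < diam (cell j) := diam_cell_gt0 d0 mesh_ok geo_lin j.
Let dr : 0 < d%:R :> R. Proof. by rewrite ltr0n. Qed.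
Let pr : 0 < p%:R :> R. Proof. by rewrite ltr0n. Qed.
Let reg j := @geo_reg R d Omega sigma gamma T mesh_ok j.
Let cdiam j := @cell_diam R d T geo_lin j.
Let r00 : 0 < rho0 d sigma := rho0_gt0 d0 sigma1.

Local Notation fe := (fe_space Omega T p).
Local Notation U := (\bigcup_(j in [set: 'I_(ncell T)]) cell j).

Lemma cell_open j : open (cell j).
Proof.
rewrite openE => _ [z zr <-]; apply/nbhs_rVP.
have [e e0 he] := G_cover_small d0 (geo_lin j) (cdiam j) (dl0 j) sigma1 (@reg j) zr.
exists (e / d%:R); first by rewrite divr_gt0.
move=> y; rewrite ltr_pdivlMr// => lt; have [|z' zr' [<- _]] := he y; last by exists z'.
by apply: le_lt_trans lt; rewrite mulrC enorm_le_norm.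
Qed.

Lemma cells_open : open U.
Proof. by apply: bigcup_open => j _; exact: cell_open. Qed.

Lemma cell_disjoint i j x : cell i x -> cell j x -> i = j.
Proof.
move=> ci cj; apply: contrapT => /eqP ij; case: mesh_ok => _ h _ _ _.
by have := h i j ij; move/seteqP => [/(_ x)[]].
Qed.

Lemma cell_cube j x : closure (cell j) x -> cell j `<=` cube x (2 * diam (cell j)).
Proof.
rewrite closure_cell// => -[a ar <-] _ [b br <-] k.
have := G_diamc (geo_lin j) (cdiam j) (ref_cellcS br) ar.
have := coord_enorm (geo j b - geo j a) k; rewrite !mxE; have := dl0 j; lra.
Qed.

Lemma cell_center j : closure (cell j) (geo j 0).
Proof. by rewrite closure_cell//; exists 0 => //; exact/ref_cellcS/ref_cell0. Qed.

Lemma nice_cell j : nice (cell j).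
Proof.
apply: (@niceS R d _ (geo j 0) (2 * diam (cell j))); [|by rewrite mulr_gt0|exact: (cell_cube (@cell_center j))].
exact/measurable_open/cell_open.
Qed.

Lemma nice_cells : nice U.
Proof. 
have [|//] := @leb_int_bigcup R d _ (fun j => cell j) (fun=> 0) nice_cell cell_disjoint.
by split; [exact: measurable_cst|exists 0 => x _; rewrite normr0].
Qed.

Lemma fe_cell u j xi : fe u -> ref_cell xi -> u (geo j xi) = local_interp p u j xi.
Proof. by move=> fu /ref_cellcS; exact: (fe_geo mesh_ok geo_lin p0). Qed.

Lemma partial_geo u j k z : fe u -> ref_cell z -> derivable u (geo j z) (delta_mx 0 k) /\
  partial k u (geo j z) = \sum_l dir j (unitv R k) z 0 l * partial l (local_interp p u j) z.
Proof.
move=> fu zr; have [h1 h2] := chain_rule d0 (geo_lin j) (cdiam j) (dl0 j) sigma1 (@reg j) k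
  (local_interp_isQ p u j) (fun z zr => fe_cell j fu zr) zr.
by split=> //; rewrite h2 /dir -lock.
Qed.

Lemma measurable_continuous D (f : 'rV[R]_d -> R) : open D ->
  (forall x e, D x -> 0 < e -> exists2 dl : R, 0 < dl & forall y, `|y - x| < dl -> D y -> `|f y - f x| < e) ->
  measurable_fun (leb_pre D) (fun t => f (leb_pt t)).
Proof.
move=> oD cf.
apply: (@measurability _ _ _ _ _ _ (@measurable_realfun.RGenOInfty.G R)); first exact: measurable_realfun.RGenOInfty.measurableE.
move=> _ [_ [r ->] <-].
have -> : leb_pre D `&` (fun t => f (leb_pt t)) @^-1` `]r, +oo[%classic =
    leb_pre (D `&` [set x | r < f x]).
  by apply/seteqP; split=> t /=; rewrite in_itv/= andbT.
apply: measurable_open; rewrite openE => x [Dx rx]; apply/nbhs_rVP.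
have [e1 e10 h1] := open_rVP oD Dx.
have e0 : 0 < f x - r by rewrite subr_gt0.
have [dl dlp h] := cf x _ Dx e0.
exists (Num.min e1 dl); first by rewrite lt_min e10.
move=> y; rewrite lt_min => /andP[y1 y2]; split; first exact: h1.
by have := h y y2 (h1 _ y1); rewrite /= ltr_norml => /andP[? _]; lra.
Qed.

Lemma partial_continuous u k x (e : R) : fe u -> U x -> 0 < e ->
  exists2 dl : R, 0 < dl & forall y, `|y - x| < dl -> U y -> `|partial k u y - partial k u x| < e.
Proof.
move=> fu [j _ [z zr <-]] e0.
have hl l : exists2 dl : R, 0 < dl & forall z', ref_cell z' -> `|z' - z| < dl ->
    `|dir j (unitv R k) z' 0 l * partial l (local_interp p u j) z' -
      dir j (unitv R k) z 0 l * partial l (local_interp p u j) z| < e / d%:R.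
  set a := dir j _ z 0 l; set b := partial l _ z.
  have ed : 0 < e / d%:R by rewrite divr_gt0.
  have K0 : 0 < `|a| + `|b| + 1 by rewrite ltr_wpDl// addr_ge0.
  pose e1 := Num.min 1 (e / d%:R / (2 * (`|a| + `|b| + 1))).
  have e10 : 0 < e1 by rewrite lt_min ltr01 divr_gt0// mulr_gt0.
  have [dl1 dl10 h1] := dir_continuous d0 sigma1 mesh_ok geo_lin j (unitv R k) (ref_cellcS zr) e10.
  have /rV_continuousP/(_ z _ e10)[dl2 dl20 h2] := isQ_continuous (isQ_partial (local_interp_isQ p u j) l).
  exists (Num.min dl1 dl2); first by rewrite lt_min dl10.
  move=> z' zr'; rewrite lt_min => /andP[l1 l2].
  have := le_lt_trans (coord_enorm _ l) (h1 z' (ref_cellcS zr') l1); rewrite !mxE -/a.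
  rewrite distrC in l2; have := h2 z' l2; rewrite distrC -/b.
  move: (dir _ _ z' _ _) (partial l _ z') => a' b' hb ha.
  have -> : a' * b' - a * b = (a' - a) * (b' - b) + (a' - a) * b + a * (b' - b) by ring.
  have e11 : e1 <= 1 by rewrite ge_min lexx.
  have e1e : e1 <= e / d%:R / (2 * (`|a| + `|b| + 1)) by rewrite ge_min lexx orbT.
  move: e1e; rewrite ler_pdivlMr ?mulr_gt0// => e1e.
  apply: le_lt_trans (ler_normD _ _) _; apply: le_lt_trans (lerD (ler_normD _ _) (lexx _)) _; rewrite !normrM.
  have t1 : `|a' - a| * `|b' - b| <= e1 * 1.
    by apply: ler_pM => //; [exact: ltW|exact: le_trans (ltW hb) e11].
  have t2 : `|a' - a| * `|b| <= e1 * `|b| by rewrite ler_wpM2r// ltW.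
  have t3 : `|a| * `|b' - b| <= `|a| * e1 by rewrite ler_wpM2l// ltW.
  have := normr_ge0 a; have := normr_ge0 b; nra.
pose f l := sval (cid2 (hl l)).
have f0 l : 0 < f l by rewrite /f; case: cid2.
have hf l : forall z', ref_cell z' -> `|z' - z| < f l ->
    `|dir j (unitv R k) z' 0 l * partial l (local_interp p u j) z' -
      dir j (unitv R k) z 0 l * partial l (local_interp p u j) z| < e / d%:R by rewrite /f; case: cid2.
have [m m0 hm] := finite_min_gt0 f0.
have [dl dlp hdl] := geo_inv_continuous mesh_ok geo_lin j (ref_cellcS zr) m0.
have cz : cell j (geo j z) by exists z.
have [e2 e20 he2] := open_rVP (@cell_open j) cz.
exists (Num.min dl e2); first by rewrite lt_min dlp.
move=> y; rewrite lt_min => /andP[y1 /he2[z' zr' yE]] _; rewrite -yE in y1 *.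
rewrite !(partial_geo j k fu _).2// -sumrB.
apply: le_lt_trans (ler_norm_sum _ _ _) _.
apply: lt_le_trans (_ : \sum_(i < d) e / d%:R <= _).
  apply: ltr_sum => [|l _]; first by apply/hasP; exists (Ordinal d0); rewrite ?mem_index_enum.
  by apply: hf => //; apply: lt_le_trans (hm l); apply: hdl => //; exact: ref_cellcS.
by rewrite sumr_const card_ord -[leLHS]mulr_natr divfK ?gt_eqF.
Qed.

Lemma partial_bounded u k : fe u -> exists M, forall x, U x -> `|partial k u x| <= M.
Proof.
move=> fu.
have hj j : exists M, forall x, cell j x -> `|partial k u x| <= M.
  have [M M0 hM] := isQ_bounded (local_interp_isQ p u j).
  exists (d%:R * (sigma / diam (cell j)) * (2 * p%:R ^+ 2 * M)) => _ [z zr <-].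
  exact: grad_upper d0 (geo_lin j) (cdiam j) (dl0 j) sigma1 (@reg j) _ _ _ _ _ _
    (local_interp_isQ p u j) (fun z zr => fe_cell j fu zr) hM zr.
exists (\sum_j `|sval (cid (hj j))|) => x [j _ cx].
rewrite (bigD1 j)//=; case: cid => M /= hM.
apply: le_trans (hM x cx) _; apply: le_trans (ler_norm M) _.
by rewrite lerDl sumr_ge0.
Qed.

Lemma bmfun_partial u k : fe u -> bmfun U (partial k u).
Proof.
move=> fu; split; last exact: partial_bounded.
apply: measurable_continuous; first exact: cells_open.
by move=> x e Ux e0; exact: partial_continuous.
Qed.

Lemma bmfun_grad u w : fe u -> fe w -> bmfun U (fun x => \sum_k partial k u x * partial k w x).
Proof.
move=> fu fw; apply: bmfun_sum => [|k]; first exact: nice_cells.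
by apply: bmfunM; [exact: nice_cells|exact: bmfun_partial|exact: bmfun_partial].
Qed.

Lemma energyC u w : energy T u w = energy T w u.
Proof. by apply: leb_int_eq => x _; apply: eq_bigr => k _; rewrite mulrC. Qed.

Lemma fe_partial_sum (I : finType) (c : I -> R) (F : I -> 'rV[R]_d -> R) k x :
  (forall i, fe (F i)) -> U x -> partial k (fun y => \sum_i c i * F i y) x = \sum_i c i * partial k (F i) x.
Proof.
move=> hF [j _ [z zr <-]]; have fs := fe_sum mesh_ok geo_lin p0 c hF.
rewrite (partial_geo j k fs zr).2.
under [RHS]eq_bigr => i _ do rewrite (partial_geo j k (hF i) zr).2 mulr_sumr.
rewrite exchange_big; apply: eq_bigr => l _ /=.
have -> : local_interp p (fun y => \sum_i c i * F i y) j =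
    (fun z => \sum_i c i * local_interp p (F i) j z).
  apply/funext => y; rewrite /local_interp.
  under eq_bigr do rewrite mulr_suml; rewrite exchange_big; apply: eq_bigr => i _.
  by rewrite mulr_sumr; apply: eq_bigr => a _; rewrite mulrA.
rewrite partial_sum; last by move=> i; apply/isQ_lpoly/isQ_scale/local_interp_isQ.
rewrite mulr_sumr; apply: eq_bigr => i _.
rewrite mulrCA; congr (_ * _); apply: partialZ; exact/isQ_lpoly/local_interp_isQ.
Qed.

Lemma energy_sum (I : finType) (c : I -> R) (F : I -> 'rV[R]_d -> R) w :
  (forall i, fe (F i)) -> fe w -> energy T (fun y => \sum_i c i * F i y) w = \sum_i c i * energy T (F i) w.
Proof.
move=> hF fw; have nU := nice_cells.
transitivity (leb_int U (fun x => \sum_i c i * \sum_k partial k (F i) x * partial k w x)).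
  apply: leb_int_eq => x Ux.
  under eq_bigr => k _ do rewrite fe_partial_sum// mulr_suml.
  rewrite exchange_big; apply: eq_bigr => i _; rewrite mulr_sumr; apply: eq_bigr => k _; rewrite mulrA//.
rewrite leb_int_sum//; last first.
  by move=> i; apply: bmfunM => //; [exact: bmfun_cst|exact: bmfun_grad].
by apply: eq_bigr => i _; rewrite leb_intZ//; exact: bmfun_grad.
Qed.

Lemma fe_phi (k : 'I_(ndof Omega T p)) : fe (phi Omega T p (dof k)).
Proof. by have [] := phiP d0 d3 sigma1 mesh_ok geo_lin p0 (dof_support k). Qed.

Lemma energy_realize (c c' : 'cV[R]_(ndof Omega T p)) :
  energy T (realize c) (realize c') = (c'^T *m stiffness Omega T p *m c) 0 0.
Proof.
rewrite energy_sum; [|exact: fe_phi|exact: (realize_fe d0 d3 sigma1 mesh_ok geo_lin p0)].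
rewrite mxE; apply: eq_bigr => k _; rewrite mulrC; congr (_ * _).
rewrite energyC energy_sum; [|exact: fe_phi|exact: fe_phi].
by rewrite mxE; apply: eq_bigr => l _; rewrite [c'^T 0 l]mxE [stiffness _ _ _ l k]mxE energyC.
Qed.

Definition cell_energy u j : R := leb_int (cell j) (fun x => \sum_k partial k u x * partial k u x).

Lemma cell_energy_ge0 u j : 0 <= cell_energy u j.
Proof. by apply: leb_int_ge0 => x _; apply: sumr_ge0 => k _; rewrite -expr2 sqr_ge0. Qed.

Lemma energy_cells u : fe u -> energy T u u = \sum_j cell_energy u j.
Proof.
move=> fu; rewrite /energy; have [_ ->//] := @leb_int_bigcup R d _ (fun j => cell j)
  (fun x => \sum_k partial k u x * partial k u x) nice_cell cell_disjoint (bmfun_grad fu fu).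
Qed.

Lemma bmfun_grad_cell u j : fe u -> bmfun (cell j) (fun x => \sum_k partial k u x * partial k u x).
Proof.
move=> fu; apply: bmfunS (bmfun_grad fu fu).
- by have [] := nice_cell j.
- by have [] := nice_cells.
- by move=> x cx; exists j.
Qed.

(** The gradient bound holds on a cube of side proportional to [diam (cell j) / p^2]. Its volume
    supplies the power [d] of the diameter, and the scaling of the gradient takes two back. *)
Lemma cell_osc u j (a b : {ffun 'I_d -> 'I_p.+1}) : fe u -> (u (node j a) - u (node j b)) ^+ 2 * diam (cell j) ^+ d.-2 *
   (rho0 d sigma / (2 * sigma * d%:R)) ^+ d <=
  16 * d%:R ^+ 4 * sigma ^+ 2 * (p%:R ^+ 2) ^+ d * cell_energy u j.
Proof.
move=> fu; set dl := diam (cell j); set K := 16 * _ * _.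
have K0 : 0 < K by rewrite !mulr_gt0// ?exprn_gt0.
have q := local_interp_isQ p u j.
have ga c : ref_cellc (gll_pt R (d := d) (p := p) c) by exact: gll_pt_ref.
have [c hc] := grad_lower d0 (geo_lin j) (cdiam j) (dl0 j) sigma1 (@reg j) p0 q
  (fun z zr => fe_cell j fu zr) (ga a) (ga b).
rewrite -!(fe_geo mesh_ok geo_lin p0 j fu (ga _)) -!/(node j _) -/dl -/K in hc.
(* The division by [d] makes the cube fit into the Euclidean ball. *)
pose r := dl * (rho0 d sigma / p%:R ^+ 2) / (4 * sigma) / d%:R.
have dlj : 0 < dl := dl0 j.
have r0 : 0 < r.
  apply: divr_gt0 => //; apply: divr_gt0; last by rewrite mulr_gt0.
  by apply: mulr_gt0 => //; apply: divr_gt0 => //; rewrite exprn_gt0.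
have sub y : cube c r y -> enorm (y - c) < dl * (rho0 d sigma / p%:R ^+ 2) / (4 * sigma).
  move=> /(cube_ball _ _ r0); rewrite /r ltr_pdivlMr// => lt; apply: le_lt_trans lt.
  by rewrite mulrC enorm_le_norm.
have KD : 0 < K * dl ^+ 2 by rewrite mulr_gt0// exprn_gt0.
have := @leb_int_ge_cube R d (cell j) (fun x => \sum_k partial k u x * partial k u x) c r
  ((u (node j a) - u (node j b)) ^+ 2 / (K * dl ^+ 2)) (nice_cell j) r0.
move=> /(_ _ (bmfun_grad_cell j fu) _ _)/=.
have sc : cube c r `<=` cell j by move=> y /sub/hc[[z zr <-] _]; exists z.
move=> /(_ sc); rewrite -/(cell_energy u j).
have h1 x : cell j x -> 0 <= \sum_k partial k u x * partial k u x.
  by move=> _; apply: sumr_ge0 => k _; rewrite -expr2 sqr_ge0.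
have h2 x : cube c r x -> (u (node j a) - u (node j b)) ^+ 2 / (K * dl ^+ 2) <= \sum_k partial k u x * partial k u x.
  by move=> /sub/hc[_ h]; rewrite ler_pdivrMr// mulrC.
move=> /(_ h1 h2); rewrite mulrAC ler_pdivrMr// => h.
have dE : d = d.-2.+2 by rewrite -[LHS](subnK d2) addn2 -subn2.
rewrite -(ler_pM2l (exprn_gt0 2 (dl0 j))) -/dl.
rewrite (_ : dl ^+ 2 * _ = (u (node j a) - u (node j b)) ^+ 2 * (2 * r) ^+ d * (p%:R ^+ 2) ^+ d); last first.
  rewrite -[RHS]mulrA -exprMn (_ : 2 * r * p%:R ^+ 2 = dl * (rho0 d sigma / (2 * sigma * d%:R))); last first.
    by rewrite /r; field; rewrite !gt_eqF.
  rewrite [in RHS]exprMn (_ : dl ^+ d = dl ^+ 2 * dl ^+ d.-2); last by rewrite -exprD addSn addSn add0n -dE.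
  ring.
rewrite (_ : dl ^+ 2 * _ = cell_energy u j * (K * dl ^+ 2) * (p%:R ^+ 2) ^+ d); last by ring.
by rewrite ler_pM2r ?exprn_gt0.
Qed.

Lemma cell_energy_eq0 u j x : fe u -> (forall a : {ffun 'I_d -> 'I_p.+1}, u (node j a) = 0) -> cell_energy u j = 0.
Proof.
move=> fu u0; rewrite /cell_energy (leb_int_eq (g := fun=> 0)); last first.
  move=> _ [z zr <-]; rewrite big1// => k _.
  have q0 : isQ p (fun _ : 'rV[R]_d => 0 : R) by exact: isQ_cst.
  have := grad_upper d0 (geo_lin j) (cdiam j) (dl0 j) sigma1 (@reg j) (u := u) k (M := 0) q0.
  move=> /(_ z) h; have : `|partial k u (geo j z)| <= d%:R * (sigma / diam (cell j)) * (2 * p%:R ^+ 2 * 0).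
    apply: h => // [z' zr'|z' _]; last by rewrite normr0.
    by rewrite fe_cell// /local_interp big1// => a _; rewrite u0 mul0r.
  by rewrite !mulr0 normr_le0 => /eqP ->; rewrite mul0r.
transitivity (leb_int (cell j) (fun=> 0 * 0)); first by apply: leb_int_eq => y _; rewrite mulr0.
by rewrite (leb_intZ 0 (nice_cell j) (bmfun_cst 0 (nice_cell j))) mul0r.
Qed.

Lemma cell_energy_le u j : fe u -> (forall xi, ref_cellc xi -> `|local_interp p u j xi| <= 1) ->
  cell_energy u j <= 4 ^+ d * d%:R * (2 * d%:R * sigma * p%:R ^+ 2) ^+ 2 * diam (cell j) ^+ d.-2.
Proof.
move=> fu u1; set dl := diam (cell j).
pose M := d%:R * (d%:R * (sigma / dl) * (2 * p%:R ^+ 2)) ^+ 2.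
have M0 : 0 <= M by rewrite mulr_ge0// sqr_ge0.
have := @leb_int_le_cube R d (cell j) (fun x => \sum_k partial k u x * partial k u x) (geo j 0) (2 * dl) M (nice_cell j).
rewrite mulr_gt0 ?(dl0 j)// => /(_ isT (cell_cube (@cell_center j)) M0 (bmfun_grad_cell j fu)).
move=> h; apply: le_trans (h _) _.
  move=> _ [z zr <-]; apply: (@le_trans _ _ (\sum_(k < d) (d%:R * (sigma / dl) * (2 * p%:R ^+ 2)) ^+ 2)).
    apply: ler_sum => k _; rewrite -expr2 -real_normK ?num_real// ler_sqr ?nnegrE//.
      have := grad_upper d0 (geo_lin j) (cdiam j) (dl0 j) sigma1 (@reg j) k (local_interp_isQ p u j)
        (fun z zr => fe_cell j fu zr) u1 zr.
      by rewrite mulr1.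
    apply: mulr_ge0; last by rewrite mulr_ge0 ?exprn_ge0.
    by apply: mulr_ge0 => //; apply: divr_ge0; apply: ltW => //; exact: dl0.
  by rewrite sumr_const card_ord -[leLHS]mulr_natl.
have dE : d = d.-2.+2 by rewrite -[LHS](subnK d2) addn2 -subn2.
have dln : dl != 0 by rewrite gt_eqF//; exact: dl0.
rewrite [leLHS](_ : _ = 4 ^+ d * d%:R * (2 * d%:R * sigma * p%:R ^+ 2) ^+ 2 * dl ^+ d.-2)//.
rewrite (_ : 2 * (2 * dl) = 4 * dl); last by ring.
rewrite exprMn (_ : dl ^+ d = dl ^+ 2 * dl ^+ d.-2); last by rewrite -exprD addSn addSn add0n -dE.
by rewrite /M; field.
Qed.

Lemma diam_le_mesh_size j : diam (cell j) <= mesh_size T.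
Proof. by rewrite /mesh_size (bigD1 j)//= le_max lexx. Qed.

Lemma mesh_size_le_diam j : mesh_size T <= gamma * diam (cell j).
Proof. by case: mesh_ok => _ _ _ _ [_]; exact. Qed.

(** The ratio of sides in the packing argument, to the power [d]: the cells at a point lie in a cube
    of radius [2 h] around it, and each contains a cube of radius [h rho0 / (4 gamma sigma d)]. *)
Definition cell_degree : R := (8 * gamma * sigma * d%:R / rho0 d sigma) ^+ d.

Lemma cells_at_point x : #|[set j : 'I_(ncell T) | `[< closure (cell j) x >]]%SET|%:R <= cell_degree.
Proof.
set S := [set j : 'I_(ncell T) | _]%SET.
have [->|[j0 j0S]] := set_0Vmem S; first by rewrite cards0 exprn_ge0// divr_ge0 ?mulr_ge0 ?ltW.
have h0 : 0 < mesh_size T by apply: lt_le_trans (dl0 j0) (diam_le_mesh_size j0).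
pose I := {j | j \in S}.
pose r := mesh_size T / gamma * rho0 d sigma / (4 * sigma) / d%:R.
have r0 : 0 < r.
  apply: divr_gt0 => //; apply: divr_gt0; last by rewrite mulr_gt0.
  by apply: mulr_gt0 => //; exact: divr_gt0.
have hS : 0 < 2 * mesh_size T by rewrite mulr_gt0.
have sub (i : I) : cube (geo (val i) 0) r `<=` cell (val i).
  move=> y /(cube_ball _ _ r0); rewrite /r ltr_pdivlMr// => lt.
  have [|||z z1 <-] := @G_cover R d (geo (val i)) sigma _ d0 (geo_lin _) (cdiam _) (dl0 _) sigma1 (@reg _) 0 (rho0 d sigma) y.
  - by rewrite r00/=.
  - move=> z; rewrite subr0 => zr k; rewrite -ler_norml (le_trans (coord_norm _ _))// (le_trans zr)//.
    rewrite /rho0 invf_le1 ?mulr_gt0 ?K0_gt0//.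
    have : 1 <= K0 R d * sigma by rewrite mulr_ege1// K0_ge1.
    lra.
  - apply: le_lt_trans (enorm_le_norm _) _; rewrite mulrC; apply: lt_le_trans lt _.
    rewrite ler_pM2r ?invr_gt0 ?mulr_gt0// ler_pM2r// ler_pdivrMr// mulrC; exact: mesh_size_le_diam.
  exists z => // k; rewrite -ltr_norml (le_lt_trans (coord_norm _ _))// -[z]subr0 (lt_le_trans z1)//.
  rewrite /rho0 invf_le1 ?mulr_gt0 ?K0_gt0//.
  have : 1 <= K0 R d * sigma by rewrite mulr_ege1// K0_ge1.
  lra.
have := @packing R d I (fun i => cell (val i)) (fun i => geo (val i) 0) x r (2 * mesh_size T) r0 hS.
move=> /(_ _ _ sub) h.
have : #|{: I}|%:R * (2 * r) ^+ d <= (2 * (2 * mesh_size T)) ^+ d.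
  apply: h => [i|i i' y ci ci'|i].
  - by apply/measurable_open/cell_open.
  - by apply/val_inj/(cell_disjoint ci ci').
  - have : closure (cell (val i)) x by have := valP i; rewrite inE => /asboolP.
    move=> /cell_cube sb y /sb cy k; apply: lt_le_trans (cy k) _.
    by rewrite ler_pM2l//; exact: diam_le_mesh_size.
move=> h1; have : #|{: I}|%:R <= (2 * (2 * mesh_size T)) ^+ d / (2 * r) ^+ d.
  by rewrite ler_pdivlMr// exprn_gt0// mulr_gt0.
rewrite -expr_div_n card_sig => h'.
rewrite (eq_card (_ : _ =i [pred i | i \in S])); last by [].
apply: le_trans h' _; rewrite /cell_degree le_eqVlt; apply/orP; left; apply/eqP; congr (_ ^+ _).
by rewrite /r; field; rewrite !gt_eqF.
Qed.

Lemma node_inj j : injective (@node R d T p j).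
Proof.
move=> a b /(geo_injP mesh_ok (gll_pt_ref R a p0) (gll_pt_ref R b p0)) e.
by apply/ffunP => l; apply: (@glln_inj R p p0); have := congr1 (fun v : 'rV_d => v 0 l) e; rewrite !mxE.
Qed.

Lemma local_interp_phi x j xi : x \in support_pts T p -> ref_cellc xi ->
  `|local_interp p (phi Omega T p x) j xi| <= 1.
Proof.
move=> xs xr; have ns (a : {ffun 'I_d -> 'I_p.+1}) : node j a \in support_pts T p by apply/support_ptsP; exists j, a.
rewrite /local_interp; under eq_bigr do rewrite (phi_node d0 d3 sigma1 mesh_ok geo_lin p0 xs (ns _)).
have [[a ax]|na] := pselect (exists a : {ffun 'I_d -> 'I_p.+1}, node j a = x).
  rewrite (bigD1 a)//= ax eqxx mul1r big1 ?addr0; first exact: lgll_tensor_le1.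
  by move=> b ba; rewrite -ax (inj_eq (@node_inj j)) (negPf ba) mul0r.
rewrite big1 ?normr0// => b _; case: eqVneq => [e|_]; last by rewrite mul0r.
by case: na; exists b.
Qed.

Lemma mesh_size_gt0 j : 0 < mesh_size T.
Proof. exact: lt_le_trans (dl0 j) (diam_le_mesh_size j). Qed.

(** Cells whose closure misses [x] contribute nothing, because all their nodal values vanish. On the
    others the interpolant is bounded by 1, and Markov's inequality for its gradient, squared, gives
    [p^4]. *)
Lemma energy_phi_le x : x \in support_pts T p -> energy T (phi Omega T p x) (phi Omega T p x) <=
  cell_degree * (4 ^+ d * d%:R * (2 * d%:R * sigma * p%:R ^+ 2) ^+ 2 * mesh_size T ^+ d.-2).
Proof.
move=> xs; have [fx _ _] := phiP d0 d3 sigma1 mesh_ok geo_lin p0 xs.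
have [j0 _] := support_ptsP _ _ _ xs; have h0 := mesh_size_gt0 j0.
rewrite energy_cells// (bigID (fun j : 'I_(ncell T) => `[< closure (cell j) x >]))/= [X in _ + X]big1 ?addr0; last first.
  move=> j /asboolPn nx; apply: cell_energy_eq0 => // a.
  rewrite (phi_node d0 d3 sigma1 mesh_ok geo_lin p0 xs); last by apply/support_ptsP; exists j, a.
  case: eqVneq => // e; case: nx; rewrite -e closure_cell//; exists (gll_pt R a) => //; exact: gll_pt_ref.
set K := 4 ^+ d * _ * _ * _.
have K0 : 0 <= K by rewrite !mulr_ge0 ?exprn_ge0 ?mulr_ge0 ?ltW.
apply: (@le_trans _ _ (\sum_(j < ncell T | `[< closure (cell j) x >]) K)).
  apply: ler_sum => j _; apply: le_trans (cell_energy_le fx _) _.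
    by move=> xi xr; exact: local_interp_phi.
  rewrite /K ler_wpM2l//; first by rewrite !mulr_ge0 ?exprn_ge0 ?mulr_ge0 ?ltW.
  by rewrite lerXn2r ?nnegrE ?diam_le_mesh_size//; exact: ltW.
rewrite sumr_const -[leLHS]mulr_natl ler_wpM2r//; apply: le_trans (cells_at_point x).
by rewrite ler_nat subset_leq_card//; apply/fintype.subsetP => j; rewrite !inE.
Qed.

Definition osc_const : R := 16 * d%:R ^+ 4 * sigma ^+ 2 * gamma ^+ d.-2 / (rho0 d sigma / (2 * sigma * d%:R)) ^+ d.

Lemma osc_const_ge0 : 0 <= osc_const.
Proof.
have s0 := ltW sigma0; have g0 := ltW gamma0; have r0 := ltW r00.
have ds : 0 <= 2 * sigma * d%:R by rewrite !mulr_ge0.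
by rewrite /osc_const divr_ge0 ?exprn_ge0 ?divr_ge0// !mulr_ge0 ?exprn_ge0.
Qed.

Lemma cell_osc_mesh u j (a b : {ffun 'I_d -> 'I_p.+1}) : fe u ->
  (u (node j a) - u (node j b)) ^+ 2 * mesh_size T ^+ d.-2 <= osc_const * p%:R ^+ (2 * d) * cell_energy u j.
Proof.
move=> fu; have := cell_osc j a b fu.
set c := rho0 d sigma / _; set O := _ ^+ 2; set dl := diam _; set E := cell_energy _ _.
have c0 : 0 < c by rewrite divr_gt0// !mulr_gt0.
have O0 : 0 <= O by exact: sqr_ge0.
move=> h; rewrite exprM /osc_const -/c.
have hg : mesh_size T ^+ d.-2 <= gamma ^+ d.-2 * dl ^+ d.-2.
  rewrite -exprMn lerXn2r ?nnegrE ?mesh_size_le_diam//; first exact/ltW/(mesh_size_gt0 j).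
  by apply: mulr_ge0; apply: ltW => //; exact: dl0.
apply: (@le_trans _ _ (O * (gamma ^+ d.-2 * dl ^+ d.-2))); first by rewrite ler_wpM2l.
have g0 : 0 < gamma ^+ d.-2 by rewrite exprn_gt0.
move: h; rewrite -ler_pdivlMr ?exprn_gt0// => h.
rewrite mulrCA; apply: (@le_trans _ _ (gamma ^+ d.-2 * (16 * d%:R ^+ 4 * sigma ^+ 2 * p%:R ^+ 2 ^+ d * E / c ^+ d))).
  by rewrite ler_pM2l.
by rewrite le_eqVlt; apply/orP; left; apply/eqP; ring.
Qed.

Definition coarse_const : R := cell_degree * (4 ^+ d * d%:R * (2 * d%:R * sigma) ^+ 2) * osc_const.

(** The power of the mesh size in the diagonal entry is exactly the weight in [cell_osc_mesh], so
    the product is free of it. *)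
Lemma diag_osc x u j (a b : {ffun 'I_d -> 'I_p.+1}) : fe u -> x \in support_pts T p ->
  energy T (phi Omega T p x) (phi Omega T p x) * (u (node j a) - u (node j b)) ^+ 2 <=
  coarse_const * p%:R ^+ (2 * d + 4) * cell_energy u j.
Proof.
move=> fu xs; have h1 := energy_phi_le xs; have h2 := cell_osc_mesh j a b fu.
have cd0 : 0 <= cell_degree by rewrite exprn_ge0// divr_ge0 ?mulr_ge0 ?ltW.
set O := (_ - _) ^+ 2 in h2 *; have O0 : 0 <= O by exact: sqr_ge0.
apply: le_trans (ler_wpM2r O0 h1) _.
set K := cell_degree * (4 ^+ d * d%:R * (2 * d%:R * sigma) ^+ 2) * p%:R ^+ 4.
have K0 : 0 <= K by rewrite /K mulr_ge0 ?exprn_ge0// mulr_ge0// mulr_ge0 ?sqr_ge0// mulr_ge0 ?exprn_ge0.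
rewrite (_ : _ * O = K * (O * mesh_size T ^+ d.-2)); last by rewrite /K exprMn; ring.
apply: le_trans (ler_wpM2l K0 h2) _.
by rewrite le_eqVlt; apply/orP; left; apply/eqP; rewrite /K /coarse_const exprD; ring.
Qed.

Lemma lgll_tensor_sum xi : \sum_(a : {ffun 'I_d -> 'I_p.+1}) lgll_tensor a xi = 1 :> R.
Proof.
have := isQ_interp p0 (@isQ_cst R d p 1) xi => /= ->.
by apply: eq_bigr => a _; rewrite mul1r.
Qed.

(** The infimum of the parameters outside [Omega] exists by boundedness and is positive and a first
    exit by openness. *)
Lemma ray_to_bdry x : Omega x -> exists2 t : R, 0 < t & bdry Omega (x + t *: unitv R (Ordinal d0)) /\
  forall s, 0 <= s < t -> Omega (x + s *: unitv R (Ordinal d0)).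
Proof.
move=> Ox; have [oO [M hM] _ _] := dom; set e := unitv R _.
pose A := [set t : R | 0 <= t /\ ~ Omega (x + t *: e)].
have en : enorm e = 1 by exact: enorm_unitv.
have A0 : A !=set0.
  exists (M + M + 1); split.
    have := le_trans (enorm_ge0 x) (hM _ Ox); lra.
  move=> /hM h; have := enormD (x + (M + M + 1) *: e) (- x).
  rewrite addrAC subrr add0r enormN enormZ en mulr1 => h2.
  have := ler_norm (M + M + 1); have := hM _ Ox; lra.
have iA : has_inf A by split=> //; exists 0 => t [].
have near t : Omega (x + t *: e) -> exists2 r : R, 0 < r & forall s, `|s - t| < r -> Omega (x + s *: e).
  move=> /(open_rVP oO)[r r0 hr]; exists r => // s st; apply: hr.
  rewrite opprD addrACA subrr add0r -scalerBl normrZ; apply: le_lt_trans st.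
  by rewrite ler_piMr// (le_trans (norm_le_enorm _))// en.
have nO : ~ Omega (x + inf A *: e).
  move=> /near[r r0 hr]; have [t At lt] := inf_adherent r0 iA.
  have le : inf A <= t by apply: (ge_inf iA.2).
  by case: At => _; apply; apply: hr; rewrite ger0_norm; lra.
have i0 : 0 <= inf A by apply: lb_le_inf => // t [].
have ip : 0 < inf A.
  rewrite lt_neqAle i0 andbT; apply/eqP => E; apply: nO; by rewrite -E scale0r addr0.
have Os s : 0 <= s < inf A -> Omega (x + s *: e).
  move=> /andP[s0 sl]; apply: contrapT => ns.
  by have := ge_inf iA.2 (conj s0 ns : A s); rewrite leNgt sl.
exists (inf A) => //; split=> //; split; last by rewrite (interior_id _).1.
apply/closure_rVP => r r0; pose s := inf A - Num.min (inf A) (r / 2).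
have m0 : 0 < Num.min (inf A) (r / 2) by rewrite lt_min ip divr_gt0.
have m1 : Num.min (inf A) (r / 2) <= inf A by rewrite ge_min lexx.
have m2 : Num.min (inf A) (r / 2) < r by rewrite gt_min; apply/orP; right; lra.
exists (x + s *: e); first by apply: Os; apply/andP; split; rewrite /s; lra.
rewrite opprD addrACA subrr add0r -scalerBl normrZ.
have -> : `|s - inf A| = Num.min (inf A) (r / 2) by rewrite /s addrAC subrr add0r normrN gtr0_norm.
by apply: le_lt_trans m2; rewrite ler_piMr ?(ltW m0)// (le_trans (norm_le_enorm _))// en.
Qed.

(* Zero energy makes [u] constant on each cell, so [u] takes finitely many values along a ray to the boundary. *)
Lemma energy_definite u x : fe u -> (forall y, bdry Omega y -> u y = 0) -> energy T u u = 0 -> Omega x -> u x = 0.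
Proof.
move=> fu ub; rewrite energy_cells// => /eqP; rewrite psumr_eq0; last by move=> j _; exact: cell_energy_ge0.
move=> /allP E0 Ox.
pose a0 : {ffun 'I_d -> 'I_p.+1} := [ffun=> ord0].
pose c j := u (node j a0).
have uc j xi : ref_cellc xi -> u (geo j xi) = c j.
  move=> xr; rewrite (fe_geo mesh_ok geo_lin p0 j fu xr) -[RHS]mulr1 -(lgll_tensor_sum xi) mulr_sumr.
  apply: eq_bigr => a _; congr (_ * _); apply/eqP; rewrite -subr_eq0 -sqrf_eq0 eq_le sqr_ge0 andbT.
  have h0 := mesh_size_gt0 j.
  rewrite -(ler_pM2r (exprn_gt0 d.-2 h0)) mul0r; apply: le_trans (cell_osc_mesh j a a0 fu) _.
  by have /eqP -> := E0 j (mem_index_enum _); rewrite mulr0.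
have [t t0 [bt Ot]] := ray_to_bdry Ox; set e := unitv R _ in bt Ot.
pose g s := u (x + s *: e).
have [g0|ng0] := eqVneq (g 0) 0; first by move: g0; rewrite /g scale0r addr0.
have gt : g t = 0 by exact: ub.
have en : `|e| <= 1 by rewrite (le_trans (norm_le_enorm _))// enorm_unitv.
have cl s : 0 <= s <= t -> closure Omega (x + s *: e).
  move=> /andP[s0]; rewrite le_eqVlt => /orP[/eqP ->|st]; first by case: bt.
  by apply: subset_closure; apply: Ot; rewrite s0.
have gc s : 0 <= s <= t -> exists j, g s = c j.
  by move=> /cl/(cell_cover mesh_ok geo_lin)[j [xi [xr E]]]; exists j; rewrite /g -E uc.
have cg : {within `[0, t], continuous g}.
  apply/subspace_continuousP => s; rewrite /= in_itv/= => st B /nbhs_ballP[r r0 hB].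
  have [/within_continuous_rVP cu _ _] := fu.
  have [dl dlp hd] := cu _ _ (cl s st) r0.
  apply/nbhs_ballP; exists dl => // s' /= ss'; rewrite /= in_itv/= => st'.
  apply: hB; rewrite -ball_normE /= distrC; apply: hd; first exact: cl.
  rewrite opprD addrACA subrr add0r -scalerBl normrZ.
  move: ss'; rewrite -ball_normE /= distrC => ss'; apply: le_lt_trans ss'.
  by rewrite ler_piMr.
(* [m] bounds the nonzero moduli from below. The number [g 0 * r] is a nonzero intermediate value of
   modulus less than [m], which the intermediate value theorem forces [g] to take. *)
pose F j := if c j == 0 then 1 else `|c j|.
have F0 j : 0 < F j by rewrite /F; case: eqVneq => // n0; rewrite normr_gt0.
have [m m0 hm] := finite_min_gt0 F0.
have gp : 0 < `|g 0| by rewrite normr_gt0.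
pose r := Num.min 1 (m / (2 * `|g 0|)).
have r0 : 0 < r by rewrite lt_min ltr01 divr_gt0// mulr_gt0.
have r1 : r <= 1 by rewrite ge_min lexx.
have iv : Num.min (g 0) (g t) <= g 0 * r <= Num.max (g 0) (g t).
  rewrite gt; have [g1|g1] := leP 0 (g 0); apply/andP; split.
  - by rewrite mulr_ge0// ltW.
  - by rewrite ler_piMr.
  - by rewrite -[leLHS]mulr1 ler_wnM2l// ltW.
  - by rewrite mulr_le0_ge0// ltW.
have [s] := IVT (ltW t0) cg iv.
rewrite in_itv/= => /gc[j ->] cj.
have cn0 : c j != 0 by rewrite cj mulf_neq0// gt_eqF.
have := hm j; rewrite /F (negPf cn0) cj normrM (gtr0_norm r0).
have : r <= m / (2 * `|g 0|) by rewrite ge_min lexx orbT.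
rewrite ler_pdivlMr ?mulr_gt0// => h1 h2; exfalso; nra.
Qed.

End CellIntegrals.

(** * Agglomerates and the coarse space *)

Section Agglomeration.
Variables (R : realType) (d : nat) (Omega : set 'rV[R]_d) (sigma gamma kappa : R) (T : mesh R d) (p p' : nat).
Variable B : hierarchy R d.
Hypothesis d2 : (2 <= d)%N.
Hypothesis d3 : (d <= 3)%N.
Hypothesis sigma1 : 1 <= sigma.
Hypothesis gamma1 : 1 <= gamma.
Hypothesis kappa1 : 1 <= kappa.
Hypothesis mesh_ok : admissible_mesh Omega sigma gamma T.
Hypothesis geo_lin : multilinear_geo T.
Hypothesis dom : admissible_domain Omega.
Hypothesis p0 : (0 < p)%N.
Hypothesis hier_ok : admissible_hierarchy T p B kappa p'.
Implicit Types (j k : 'I_(ncell T)) (i : 'I_(nbox B)) (x y : 'rV[R]_d) (u : 'rV[R]_d -> R).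

Let d0 : (0 < d)%N := ltn_trans (ltn0Sn 0) d2.
Let kappa0 : 0 < kappa := lt_le_trans ltr01 kappa1.
Local Notation n := (ndof Omega T p).
Local Notation fe := (fe_space Omega T p).

Let own_ok : owns_support_pts T p B. Proof. by case: hier_ok. Qed.

Definition meets j k := `[< closure (cell j) `&` closure (cell k) !=set0 >].

Definition agg_set i := [set j | `[< @agg_cells R d T B i j >]]%SET.

Lemma meetsC j k : meets j k = meets k j.
Proof. by rewrite /meets setIC. Qed.

(** A common face contains a vertex of both cells, and vertices are nodes since the GLL points
    include the endpoints. *)
Lemma shared_node j k : meets j k -> exists a b : {ffun 'I_d -> 'I_p.+1}, node j a = node k b.
Proof.
move=> /asboolP[x []]; rewrite !closure_cell// => -[xi xr ex] [eta er ee].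
have [->|jk] := eqVneq j k; first by exists [ffun=> ord0], [ffun=> ord0].
have [f [g [pi [s [xf [m1 _ m3] _]]]]] := geo_face_map d0 d3 sigma1 mesh_ok geo_lin jk xr er (etrans ex (esym ee)).
pose y : 'rV[R]_d := face_pt f (vtx R (fun=> true)).
have yf : ref_face f y by apply: ref_face_pt; exact: vtx_ref.
have yg l : y 0 l \in gll R p by rewrite !mxE; case: (f l) => [b|]; exact: sgnb_gll.
have [a ya] := gll_coordP p0 yg.
have [|b yb] := @gll_coordP R d p p0 (face_map g pi s y).
  by move=> l; rewrite mxE; case: (g l) => [c|]; [exact: sgnb_gll|exact: gll_sgnb].
by exists a, b; rewrite /node -ya -yb m3.
Qed.

Let agg_rel i : rel 'I_(ncell T) := fun j k => [&& j \in agg_set i, k \in agg_set i & meets j k].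

Let agg_rel_sym i : connect_sym (agg_rel i).
Proof. by apply: sym_connect_sym => j k; rewrite /agg_rel andbCA meetsC. Qed.

Lemma region_cell (S : set 'I_(ncell T)) j : S j -> cell j `<=` region S.
Proof.
move=> Sj x cx; have := cell_open d2 sigma1 mesh_ok geo_lin (j := j).
rewrite openE => /(_ x cx) /nbhs_rVP[e e0 he]; apply/interior_rVP; exists e => // y /he cy.
by exists j => //; exact: subset_closure.
Qed.

Lemma closed_cells (S : set 'I_(ncell T)) : closed (\bigcup_(j in S) closure (cell j)).
Proof. by apply: closed_bigcup => [|j _]; [exact: finite_finset|exact: closed_closure]. Qed.

(** The box has positive volume, so the lower bound on the measure of the core excludes an empty
    one. *)
Lemma core_nonempty i : exists j, core_cells p i j.
Proof.
have [_ _ _ /(_ i)[[bp _] [_ vol _ _] _ _ _]] := hier_ok.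
apply: contrapT => h; have vp : 0 < kappa^-1 * box_vol i.
  by rewrite mulr_gt0 ?invr_gt0// prodr_gt0// => k _; rewrite subr_gt0.
move: vol; rewrite (_ : agg_core T p i = set0).
  by rewrite /leb_meas preimage_set0 measure0 lee_fin leNgt vp.
apply/seteqP; split=> // x /interior_subset[j cj _]; by apply: h; exists j.
Qed.

(** The core cells reachable from [j] and the remaining ones form two disjoint closed sets that
    cover the core region; connectedness puts the whole region into the first. *)
Lemma core_connected i j k : core_cells p i j -> core_cells p i k -> connect (agg_rel i) j k.
Proof.
move=> cj ck; have [_ _ _ /(_ i)[_ [con _ _ _] _ _ _]] := hier_ok.
have aggP l : core_cells p i l -> l \in agg_set i by move=> [al _]; rewrite inE; exact/asboolP.
pose S := [set l | core_cells p i l /\ connect (agg_rel i) j l].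
have sep l m : S l -> core_cells p i m -> closure (cell l) `&` closure (cell m) !=set0 -> S m.
  move=> [cl jl] cm lm; split=> //; apply: connect_trans jl _; apply: connect1.
  by rewrite /agg_rel !aggP//; apply/asboolP.
pose A := \bigcup_(l in S) closure (cell l).
pose A' := \bigcup_(l in core_cells p i `\` S) closure (cell l).
have AA' x : A x -> A' x -> False.
  by move=> [l Sl xl] [m [cm nS] xm]; apply: nS; apply: (sep l) => //; exists x.
have cov x : agg_core T p i x -> A x \/ A' x.
  move=> /interior_subset[l cl xl]; have [Sl|nS] := pselect (S l); first by left; exists l.
  by right; exists l.
have : agg_core T p i `&` A = agg_core T p i.
  apply: con.
  - exists (geo j 0); split; last first.
      by exists j; [split=> //; exact: connect0|apply/subset_closure; exists 0 => //; exact: ref_cell0].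
    by apply: (region_cell cj); exists 0 => //; exact: ref_cell0.
  - exists (~` A'); first by rewrite openC; exact: closed_cells.
    apply/seteqP; split=> x [ax h]; split=> //; first by move=> /(AA' _ h).
    by have [] := cov x ax.
  - by exists A => //; exact: closed_cells.
move=> /seteqP[_ sub].
have kc : agg_core T p i (geo k 0) by apply: (region_cell ck); exists 0 => //; exact: ref_cell0.
have [_ [l Sl kl]] := sub _ kc.
have lk : closure (cell l) `&` closure (cell k) !=set0.
  by exists (geo k 0); split=> //; apply/subset_closure; exists 0 => //; exact: ref_cell0.
by have [] := sep l k Sl ck lk.
Qed.

Lemma agg_connected i j k : j \in agg_set i -> k \in agg_set i -> connect (agg_rel i) j k.
Proof.
have [c cc] := core_nonempty i.
have [_ _ _ /(_ i)[_ _ [m _ lay] _ _]] := hier_ok.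
have layered q l : layered_cells p i q l -> connect (agg_rel i) c l /\ l \in agg_set i.
  elim: q l => [|q IH] l /=.
    by move=> cl; split; [exact: core_connected|case: cl => al _; rewrite inE; exact/asboolP].
  move=> [al [l' /IH[cl' al'] ll']].
  have al2 : l \in agg_set i by rewrite inE; exact/asboolP.
  split=> //; apply: connect_trans cl' _; apply: connect1; rewrite /agg_rel al' al2 meetsC; exact/asboolP.
have all_c l : l \in agg_set i -> connect (agg_rel i) c l.
  rewrite inE => /asboolP al; have [ll|nl] := pselect (layer_cells p i l).
    by have [] := layered _ _ (lay _ ll).
  by apply: core_connected => //; split.
by move=> /all_c cj /all_c ck; rewrite (connect_trans _ ck)// agg_rel_sym.
Qed.

Lemma path_osc i u (s : 'I_(ncell T) -> R) :
  (forall j (a b : {ffun 'I_d -> 'I_p.+1}), `|u (node j a) - u (node j b)| <= s j) ->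
  forall q j, path (agg_rel i) j q -> forall a b : {ffun 'I_d -> 'I_p.+1},
    `|u (node j a) - u (node (last j q) b)| <= \sum_(l <- j :: q) s l.
Proof.
move=> hs; elim=> [|k q IH] j /=; first by move=> _ a b; rewrite big_seq1.
move=> /andP[/and3P[_ _ /shared_node[a' [b' e]]] pq] a b; rewrite big_cons.
have -> : u (node j a) - u (node (last k q) b) =
  (u (node j a) - u (node j a')) + (u (node k b') - u (node (last k q) b)) by rewrite e; ring.
by rewrite (le_trans (ler_normD _ _))// lerD ?IH.
Qed.

Lemma sqr_sum_le (I : finType) (A : {set I}) (s : I -> R) :
  (\sum_(l in A) s l) ^+ 2 <= #|A|%:R * \sum_(l in A) s l ^+ 2.
Proof.
have h : 0 <= \sum_(l in A) \sum_(m in A) (s l - s m) ^+ 2 by apply: sumr_ge0 => l _; apply: sumr_ge0 => m _; exact: sqr_ge0.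
have cst (z : R) : \sum_(m in A) z = #|A|%:R * z by rewrite sumr_const mulr_natl.
have e l : \sum_(m in A) (s l - s m) ^+ 2 =
    #|A|%:R * s l ^+ 2 + \sum_(m in A) s m ^+ 2 - 2 * s l * \sum_(m in A) s m.
  transitivity (\sum_(m in A) (s l ^+ 2 + (s m ^+ 2 + (- (2 * s l)) * s m))).
    by apply: eq_bigr => m _; ring.
  by rewrite !big_split/= cst -mulr_sumr; ring.
move: h; under eq_bigr do rewrite e.
rewrite sumrB big_split/= cst -mulr_sumr -mulr_suml -mulr_sumr; lra.
Qed.

(** A path without repetition counts each cell of the agglomerate once, and Cauchy-Schwarz for the
    sum of oscillations costs the number of cells. The weight [W] is absorbed into [u] through its
    square root. *)
Lemma agg_osc i u (W K : R) : 0 <= W -> 0 <= K ->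
  (forall j (a b : {ffun 'I_d -> 'I_p.+1}), W * (u (node j a) - u (node j b)) ^+ 2 <= K * cell_energy u j) ->
  forall x y, x \in owned i -> y \in owned i ->
  W * (u x - u y) ^+ 2 <= #|agg_set i|%:R * (K * \sum_(j in agg_set i) cell_energy u j).
Proof.
move=> W0 K0 h x y xo yo.
have [_ _ own] := own_ok.
have nodeP z : z \in owned i -> exists j (a : {ffun 'I_d -> 'I_p.+1}), node j a = z /\ j \in agg_set i.
  move=> zo; have /support_ptsP[j [a E]] : z \in support_pts T p by apply/own; exists i.
  exists j, a; split=> //; rewrite inE; apply/asboolP; exists z => //.
  by rewrite E closure_cell//; exists (gll_pt R a) => //; exact: gll_pt_ref.
have [j [a [<- ja]]] := nodeP x xo; have [k [b [<- kb]]] := nodeP y yo.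
pose s (l : 'I_(ncell T)) := Num.sqrt (K * cell_energy u l).
have E0 (l : 'I_(ncell T)) : 0 <= K * cell_energy u l by rewrite mulr_ge0 ?cell_energy_ge0.
have sE (l : 'I_(ncell T)) : s l ^+ 2 = K * cell_energy u l by rewrite sqr_sqrtr.
have hs l (a' b' : {ffun 'I_d -> 'I_p.+1}) :
    `|Num.sqrt W * u (node l a') - Num.sqrt W * u (node l b')| <= s l.
  rewrite -mulrBr -ler_sqr ?nnegrE ?sqrtr_ge0// sE normrM exprMn !real_normK ?num_real//.
  by rewrite sqr_sqrtr.
have /connectP[q pq kE] := agg_connected ja kb.
have [q' [pq' uq' lE]] : exists q', [/\ path (agg_rel i) j q', uniq (j :: q') & last j q' = k].
  by case/shortenP: pq kE => q' pq' uq' _ ->; exists q'.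
have := @path_osc i (fun x => Num.sqrt W * u x) s hs q' j pq' a b; rewrite lE => h1.
have sub : {subset j :: q' <= agg_set i}.
  have tl r l' : path (agg_rel i) l' r -> {subset r <= agg_set i}.
    elim: r l' => //= m r IH l' /andP[/and3P[_ am _] pr] l.
    by rewrite inE => /orP[/eqP ->//|]; exact: IH pr l.
  by move=> l; rewrite inE => /orP[/eqP ->//|]; exact: tl pq' l.
have h2 : \sum_(l <- j :: q') s l <= \sum_(l in agg_set i) s l.
  rewrite big_uniq//= [leRHS]big_mkcond [leLHS]big_mkcond; apply: ler_sum => l _.
  case: ifP => [/sub ->//|_]; by case: ifP => // _; exact: sqrtr_ge0.
have h3 := le_trans h1 h2.
have -> : W * (u (node j a) - u (node k b)) ^+ 2 = `|Num.sqrt W * u (node j a) - Num.sqrt W * u (node k b)| ^+ 2.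
  by rewrite real_normK ?num_real// -mulrBr exprMn sqr_sqrtr.
apply: (@le_trans _ _ ((\sum_(l in agg_set i) s l) ^+ 2)).
  by rewrite ler_sqr ?nnegrE// sumr_ge0// => l _; exact: sqrtr_ge0.
apply: le_trans (sqr_sum_le _ _) _; rewrite ler_wpM2l// mulr_sumr.
by apply: ler_sum => l _; rewrite sE.
Qed.

Lemma card_agg_set i : #|agg_set i|%:R <= #|` owned i|%:R * cell_degree d sigma gamma.
Proof.
pose N x : {set 'I_(ncell T)} := [set j | `[< closure (cell j) x >]]%SET.
have : (#|agg_set i| <= \sum_(x <- owned i) #|N x|)%N.
  under eq_bigr do rewrite -sum1_card big_mkcond /=.
  rewrite exchange_big -sum1_card big_mkcond /=; apply: leq_sum => j _.
  case: ifP => //; rewrite inE => /asboolP[x xo cx]; rewrite (big_rem x)//=.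
  by rewrite ifT// inE; exact/asboolP.
rewrite -(ler_nat R) => /le_trans; apply.
elim: (owned i : seq _) => [|x s IH]; first by rewrite big_nil mul0r.
rewrite big_cons natrD /= -[(size s).+1]addn1 natrD mulrDl mul1r addrC lerD//.
exact: (cells_at_point d2 sigma1 gamma1 mesh_ok geo_lin).
Qed.

(** A cell of an agglomerate either lies in its layer, which happens for at most [kappa] boxes, or
    has all its support points owned by the box, which determines the box. *)
Lemma agg_overlap j : (\sum_(i < nbox B) (j \in agg_set i))%:R <= kappa + 1.
Proof.
have [_ bo _ _] := hier_ok; have [_ own1 own2] := own_ok.
have oj := bo (geo j 0).
pose a0 : {ffun 'I_d -> 'I_p.+1} := [ffun=> ord0].
have [i0 oi0] := (own2 (node j a0)).1 (introT (support_ptsP _ _ _) (ex_intro _ j (ex_intro _ a0 erefl))).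
have split i : ((j \in agg_set i) <= (i == i0) + (i \in [set i : 'I_(nbox B) | `[< agg_layer T p i (geo j 0) >]]%SET))%N.
  rewrite !inE; case: (asboolP (agg_cells i j)) => //= ai.
  have [li|nl] := pselect (layer_cells p i j).
    rewrite (_ : `[< _ >] = true) ?addn1//; apply/asboolP.
    by apply: (region_cell li); exists 0 => //; exact: ref_cell0.
  have : node j a0 \in owned i by apply: contrapT => /negP no; apply: nl; split=> //; exists a0.
  by move=> /own1/(_ oi0) ->; rewrite eqxx.
have : (\sum_(i < nbox B) (j \in agg_set i) <= #|[set i : 'I_(nbox B) | `[< agg_layer T p i (geo j 0) >]]%SET| + 1)%N.
  apply: leq_trans (leq_sum _ _) _; first by move=> i _; exact: split.
  rewrite big_split/= addnC leq_add//.
    by rewrite -sum1_card [leqRHS]big_mkcond; apply: leq_sum => i _; case: ifP.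
  by rewrite (bigD1 i0)//= eqxx big1// => i /negPf ->.
rewrite -(ler_nat R) natrD => /le_trans; apply; by rewrite lerD2r.
Qed.

Let ow_ex (k : 'I_n) : exists i : 'I_(nbox B), dof k \in owned i.
Proof. by have [_ _ own] := own_ok; apply/own; exact: dof_support. Qed.

Let ow (k : 'I_n) : 'I_(nbox B) := sval (cid (ow_ex k)).

Let owP (k : 'I_n) : dof k \in owned (ow k). Proof. by rewrite /ow; case: cid. Qed.

Let owE (k : 'I_n) i : (dof k \in owned i) = (ow k == i).
Proof.
by have [_ own1 _] := own_ok; apply/idP/eqP => [/own1/(_ (owP k)) ->//|<-]; exact: owP.
Qed.

Let L : R := (max_owned B)%:R.

Lemma card_owned_le i : #|` owned i|%:R <= L.
Proof. by rewrite ler_nat /max_owned (bigD1 i)//= leq_maxl. Qed.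

Lemma card_owner_le i : #|[set k : 'I_n | ow k == i]%SET|%:R <= L.
Proof.
apply: le_trans (card_owned_le i); rewrite ler_nat cardE -(size_map (@dof R d Omega T p)).
apply: uniq_leq_size; first by rewrite (map_inj_uniq (@dof_inj R d Omega T p)) enum_uniq.
by move=> _ /mapP[k /[!(mem_enum, inE)] ki ->]; rewrite owE.
Qed.

(** One [L], with [cell_degree], bounds the cells of an agglomerate; the other bounds the degrees of
    freedom of a box; [kappa + 1] is the overlap. *)
Definition approx_const : R := coarse_const d sigma gamma * p%:R ^+ (2 * d + 4) *
  (L ^+ 2 * cell_degree d sigma gamma * (kappa + 1)).

Lemma cell_degree_ge0 : 0 <= cell_degree d sigma gamma.
Proof.
have r0 := rho0_gt0 d0 sigma1.
have g0 := le_trans ler01 gamma1; have s0 := le_trans ler01 sigma1.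
by rewrite exprn_ge0// divr_ge0 ?(ltW r0)// !mulr_ge0.
Qed.

Lemma coarse_const_ge0 : 0 <= coarse_const d sigma gamma.
Proof.
rewrite mulr_ge0 ?osc_const_ge0// mulr_ge0 ?cell_degree_ge0//.
by rewrite mulr_ge0 ?sqr_ge0// mulr_ge0 ?exprn_ge0.
Qed.

Lemma locally_constant_approx u : fe u -> exists g : 'I_(nbox B) -> R,
  \sum_(k < n) energy T (phi Omega T p (dof k)) (phi Omega T p (dof k)) * (u (dof k) - g (ow k)) ^+ 2
    <= approx_const * energy T u u.
Proof.
(* The constant of a box is the value at its first point. The default of [head] occurs only for a
   box without points, which owns no degree of freedom. *)
move=> fu; pose g i := u (head 0 (owned i : seq _)); exists g.
set K := coarse_const d sigma gamma * p%:R ^+ (2 * d + 4).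
have K0 : 0 <= K by rewrite mulr_ge0 ?exprn_ge0// coarse_const_ge0.
pose S i := \sum_(j in agg_set i) cell_energy u j.
have S0 i : 0 <= S i by apply: sumr_ge0 => j _; exact: cell_energy_ge0.
have D0 x : 0 <= energy T (phi Omega T p x) (phi Omega T p x).
  by apply: leb_int_ge0 => y _; apply: sumr_ge0 => l _; rewrite -expr2 sqr_ge0.
have N0 := cell_degree_ge0.
have L0 : 0 <= L by [].
apply: (@le_trans _ _ (\sum_(k < n) L * cell_degree d sigma gamma * (K * S (ow k)))).
  apply: ler_sum => k _.
  have ho : head 0 (owned (ow k) : seq _) \in owned (ow k).
    have hs (s : seq 'rV[R]_d) z : z \in s -> head 0 s \in s by case: s => //= y s _; rewrite inE eqxx.
    exact: hs (owP k).
  have h := agg_osc (D0 (dof k)) K0 (fun j a b => diag_osc d2 d3 sigma1 gamma1 mesh_ok geo_lin p0 j a b fu (dof_support k))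
    (owP k) ho.
  apply: le_trans h _; apply: ler_wpM2r; first exact: (mulr_ge0 K0 (S0 _)).
  by apply: le_trans (card_agg_set _) _; apply: ler_wpM2r => //; exact: card_owned_le.
rewrite (partition_big ow xpredT)//=.
apply: (@le_trans _ _ (\sum_(i < nbox B) L * (L * cell_degree d sigma gamma * (K * S i)))).
  apply: ler_sum => i _; rewrite (eq_bigr (fun=> L * cell_degree d sigma gamma * (K * S i))); last first.
    by move=> k /eqP ->.
  rewrite sumr_const -[leLHS]mulr_natl; apply: ler_wpM2r.
    by apply: mulr_ge0; exact: mulr_ge0.
  by apply: le_trans (card_owner_le i); rewrite ler_nat subset_leq_card//; apply/fintype.subsetP => k; rewrite !inE.
have e : \sum_(i < nbox B) S i = \sum_(j < ncell T) (\sum_(i < nbox B) (j \in agg_set i))%:R * cell_energy u j.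
  rewrite /S; under eq_bigr do rewrite big_mkcond /=.
  rewrite exchange_big; apply: eq_bigr => j _; rewrite natr_sum mulr_suml; apply: eq_bigr => i _.
  by case: ifP; rewrite ?mul1r ?mul0r.
rewrite (eq_bigr (fun i => (L ^+ 2 * cell_degree d sigma gamma * K) * S i)); last by move=> i _; ring.
rewrite -mulr_sumr e (energy_cells d2 sigma1 mesh_ok geo_lin p0 fu) /approx_const -/K.
rewrite [leRHS](_ : _ = L ^+ 2 * cell_degree d sigma gamma * K * ((kappa + 1) * \sum_(j < ncell T) cell_energy u j)); last by ring.
apply: ler_wpM2l; first by apply: mulr_ge0 => //; apply: mulr_ge0 => //; exact: exprn_ge0.
rewrite mulr_sumr; apply: ler_sum => j _.
by rewrite ler_wpM2r ?cell_energy_ge0// agg_overlap.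
Qed.

Let owned_support i y : y \in owned i -> y \in support_pts T p.
Proof. by have [_ _ own] := own_ok => yo; apply/own; exists i. Qed.

(** Constants have degree at most [p'], and each degree of freedom has exactly one owner, so the
    interpolated constants add up to the vector with entries [g (ow k)]; nodes on the boundary drop
    out in [interpV]. *)
Lemma coarse_mem r (ic : 'M[R]_(n, r)) (g : 'I_(nbox B) -> R) : coarse_inclusion B p' ic ->
  exists y : 'cV[R]_r, ic *m y = \col_k g (ow k).
Proof.
move=> [_ rng].
pose w i := interp_loc Omega T p i (fun=> g i).
have cw : coarse_space Omega T p B p' (fun x => \sum_i interpV Omega T p (w i) x).
  by exists w; split=> // i; exists (fun=> g i) => //; exact: isQ_cst.
have E : (fun x => \sum_i interpV Omega T p (w i) x) = realize (\col_k g (ow k) : 'cV[R]_n).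
  apply/funext => x; rewrite /interpV /realize exchange_big; apply: eq_bigr => k _ /=.
  rewrite -mulr_suml; congr (_ * _); rewrite mxE (bigD1 (ow k))//= big1 ?addr0 => [|i ik].
    rewrite mxE /w /interp_loc (big_rem _ (owP k))/=.
    rewrite (phi_node d0 d3 sigma1 mesh_ok geo_lin p0) ?dof_support// eqxx mulr1 big_seq big1 ?addr0// => y yr.
    have uo : uniq (owned (ow k) : seq _) by exact: fset_uniq.
    have [yk yo] : y != dof k /\ y \in owned (ow k) by apply/andP; move: yr; rewrite mem_rem_uniq// inE.
    by rewrite (phi_node d0 d3 sigma1 mesh_ok geo_lin p0) ?dof_support ?(owned_support yo)// eq_sym (negPf yk) mulr0.
  rewrite mxE /w /interp_loc big_seq big1// => y yo.
  rewrite (phi_node d0 d3 sigma1 mesh_ok geo_lin p0) ?dof_support ?(owned_support yo)//.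
  case: eqVneq => [e|_]; last by rewrite mulr0.
  by move: yo; rewrite -e owE eq_sym (negPf ik).
move: cw; rewrite -rng E => -[y _ /(congr1 (coords Omega T p))].
by rewrite !(coords_realize d0 d3 sigma1 mesh_ok geo_lin p0) => <-; exists y.
Qed.

Lemma coarse_approx r (ic : 'M[R]_(n, r)) (c : 'cV[R]_n) : coarse_inclusion B p' ic ->
  exists y : 'cV[R]_r, \sum_k stiffness Omega T p k k * (c k 0 - (ic *m y) k 0) ^+ 2 <=
    approx_const * (c^T *m stiffness Omega T p *m c) 0 0.
Proof.
move=> hic; have fr := realize_fe d0 d3 sigma1 mesh_ok geo_lin p0 c.
have [g hg] := locally_constant_approx fr; have [y yE] := coarse_mem g hic.
exists y; rewrite -(energy_realize d2 d3 sigma1 mesh_ok geo_lin p0).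
apply: le_trans hg; rewrite le_eqVlt; apply/orP; left; apply/eqP; apply: eq_bigr => k _.
by rewrite yE !mxE (realize_dof d0 d3 sigma1 mesh_ok geo_lin p0).
Qed.

Lemma max_owned_ge1 : (0 < n)%N -> 1 <= L.
Proof.
move=> n0; pose k := Ordinal n0; apply: le_trans (card_owned_le (ow k)).
by rewrite ler1n cardfs_gt0; apply/fset0Pn; exists (dof k); exact: owP.
Qed.

(** An agglomerate contains a whole cell of its core, whose diameter quasi-uniformity compares with
    the mesh size. This bounds [H / h] from below. *)
Lemma mesh_size_le_agg_size : (0 < n)%N -> mesh_size T <= gamma * agg_size T B.
Proof.
move=> n0; have [j [aj _]] := core_nonempty (ow (Ordinal n0)).
apply: le_trans (mesh_size_le_diam mesh_ok j) _; rewrite ler_pM2l; last exact: lt_le_trans gamma1.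
rewrite /agg_size (bigD1 (ow (Ordinal n0)))//= le_max; apply/orP; left.
have [_ [M hM] _ _] := dom.
(* [diam] is a real supremum, so comparing diameters requires a bound on the larger set. *)
have cM x : closure Omega x -> enorm x <= M + d%:R.
  move=> /closure_rVP/(_ 1 ltr01)[y Oy yx].
  have := enormD (x - y) y; rewrite subrK => /le_trans; apply; rewrite addrC lerD ?hM//.
  apply: le_trans (enorm_le_norm _) _; rewrite distrC ler_piMr// ltW//.
have sub : cell j `<=` agg T (ow (Ordinal n0)) by exact: region_cell.
apply: diam_le.
  by exists (geo j 0), 0 => //; exact: ref_cell0.
move=> x y cx cy; apply: (@diam_ge R d _ (M + d%:R)); [|exact: sub|exact: sub].
move=> z /interior_subset[l _]; rewrite closure_cell// => -[xi xr <-]; apply: cM.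
exact: (geo_closure mesh_ok geo_lin).
Qed.

End Agglomeration.

(** * Quadratic forms and the two-level estimate *)

Section QuadraticForms.
Variables (R : realType) (n : nat).
Implicit Types (M N : 'M[R]_n) (u v w : 'cV[R]_n).

Definition bform M u v : R := (u^T *m M *m v) 0 0.

Lemma bformDl M u v w : bform M (u + v) w = bform M u w + bform M v w.
Proof. by rewrite /bform linearD !mulmxDl mxE. Qed.

Lemma bformDr M u v w : bform M w (u + v) = bform M w u + bform M w v.
Proof. by rewrite /bform mulmxDr mxE. Qed.

Lemma bformZl M (a : R) u v : bform M (a *: u) v = a * bform M u v.
Proof. by rewrite /bform linearZ /= -!scalemxAl mxE. Qed.

Lemma bformZr M (a : R) u v : bform M u (a *: v) = a * bform M u v.
Proof. by rewrite /bform -scalemxAr mxE. Qed.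

Lemma bformDm M N u v : bform (M + N) u v = bform M u v + bform N u v.
Proof. by rewrite /bform mulmxDr mulmxDl mxE. Qed.

Lemma bformZm M (a : R) u v : bform (a *: M) u v = a * bform M u v.
Proof. by rewrite /bform -scalemxAr -scalemxAl mxE. Qed.

Lemma bform_tr M u v : bform M u v = bform M^T v u.
Proof. rewrite /bform (_ : v^T *m M^T *m u = (u^T *m M *m v)^T); last by rewrite !trmx_mul trmxK mulmxA.
by rewrite [RHS]mxE. Qed.

Lemma bformC M u v : M^T = M -> bform M u v = bform M v u.
Proof. by move=> Ms; rewrite bform_tr Ms. Qed.

Definition psd M := forall v, 0 <= bform M v v.
Definition spd M := forall v, v != 0 -> 0 < bform M v v.

Lemma spd_psd M : spd M -> psd M.
Proof.
move=> h v; have [->|/h/ltW//] := eqVneq v 0.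
by rewrite /bform mulmx0 mxE.
Qed.

Lemma cauchy_schwarz M u v : M^T = M -> psd M -> bform M u v ^+ 2 <= bform M u u * bform M v v.
Proof.
move=> Ms Mp; set b := bform M u v.
have key t : 0 <= bform M u u + 2 * t * b + t ^+ 2 * bform M v v.
  have := Mp (u + t *: v); rewrite !(bformDl, bformDr, bformZl, bformZr) (bformC v u Ms) -/b.
  by congr (_ <= _); ring.
have [v0|vn] := eqVneq (bform M v v) 0.
  rewrite v0 mulr0; have [->|bn] := eqVneq b 0; first by rewrite expr0n.
  have := key (- (bform M u u + 1) / (2 * b)); rewrite v0 mulr0 addr0.
  rewrite (_ : 2 * _ * b = - (bform M u u + 1)); last by field.
  lra.
have vp : 0 < bform M v v by rewrite lt_neqAle eq_sym vn Mp.
have := key (- b / bform M v v).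
rewrite (_ : _ + _ = bform M u u - b ^+ 2 / bform M v v); last by field.
by rewrite subr_ge0 ler_pdivrMr.
Qed.

Lemma spd_unit M : spd M -> M \in unitmx.
Proof.
move=> h; rewrite -row_free_unit; apply: inj_row_free => v vM.
apply: contrapT => /eqP vn; have := h v^T; rewrite -(inj_eq (@trmx_inj _ _ _)) trmxK trmx0 => /(_ vn).
by rewrite /bform trmxK vM mul0mx mxE ltxx.
Qed.

Lemma bform_diag (a : 'rV[R]_n) v : bform (diag_mx a) v v = \sum_k a 0 k * v k 0 ^+ 2.
Proof.
rewrite /bform mxE; apply: eq_bigr => k _.
by rewrite mul_mx_diag !mxE; ring.
Qed.

Lemma psd_kernel M w : M^T = M -> psd M -> bform M w w = 0 -> M *m w = 0.
Proof.
move=> Ms Mp w0; apply/colP => k; rewrite [RHS]mxE.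
have := cauchy_schwarz (delta_mx k 0) w Ms Mp; rewrite w0 mulr0.
have -> : bform M (delta_mx k 0) w = (M *m w) k 0.
  by rewrite /bform trmx_delta -mulmxA -rowE mxE.
move=> h; apply/eqP; by rewrite -sqrf_eq0 eq_le h sqr_ge0.
Qed.

(* Cauchy-Schwarz for [M] applied to [u] and [M^-1 v]. *)
Lemma cauchy_schwarz_inv M u v : M^T = M -> spd M ->
  ((u^T *m v) 0 0) ^+ 2 <= bform M u u * bform (invmx M) v v.
Proof.
move=> Ms Mp; have Mu := spd_unit Mp.
have := cauchy_schwarz u (invmx M *m v) Ms (spd_psd Mp).
rewrite [in bform M u _]/bform -mulmxA mulKVmx//; move=> /le_trans; apply.
by rewrite [X in _ * X <= _]/bform trmx_mul trmx_inv Ms -!mulmxA mulKVmx// /bform mulmxA.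
Qed.

Lemma diag_mx_spd (a : 'rV[R]_n) : (forall k, 0 < a 0 k) -> spd (diag_mx a).
Proof.
move=> a0 v vn; rewrite bform_diag; have [k vk] : exists k, v k 0 != 0.
  apply: contrapT => h; case/eqP: vn; apply/colP => k; rewrite mxE; apply: contrapT => /eqP vk.
  by apply: h; exists k.
rewrite (bigD1 k)//=; apply: ltr_pwDl.
  by rewrite mulr_gt0// lt_neqAle eq_sym sqrf_eq0 vk sqr_ge0.
by apply: sumr_ge0 => l _; rewrite mulr_ge0 ?sqr_ge0// ltW.
Qed.

Lemma bform_continuous M : continuous (fun x : 'rV[R]_n => bform M x^T x^T).
Proof.
have -> : (fun x : 'rV[R]_n => bform M x^T x^T) = (fun x : 'rV[R]_n => \sum_k \sum_l M l k * (x 0 l * x 0 k)).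
  apply/funext => x; rewrite /bform trmxK mxE; apply: eq_bigr => k _.
  by rewrite !mxE mulr_suml; apply: eq_bigr => l _; ring.
have cm (f g : 'rV[R]_n -> R) : continuous f -> continuous g -> continuous (fun x => f x * g x).
  by move=> cf cg x; exact: (@continuousM R 'rV[R]_n f g x (cf x) (cg x)).
have cs (F : 'I_n -> 'rV[R]_n -> R) : (forall k, continuous (F k)) -> continuous (fun x => \sum_k F k x).
  move=> cF; apply: (@continuous_big R 'I_n +%R 0 xpredT); last by move=> k _; exact: cF.
  exact: add_continuous.
apply: (cs (fun k x => \sum_l M l k * (x 0 l * x 0 k))) => k.
apply: (cs (fun l x => M l k * (x 0 l * x 0 k))) => l.
apply: (cm (fun=> M l k)); first exact: cst_continuous.
by apply: cm; exact: coord_continuous.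
Qed.

(** The maximum is taken over the compact unit sphere of the diagonal form. The matrix [mu D - M] is
    then positive semidefinite with zero form at the maximiser, which [psd_kernel] puts into its
    kernel; no derivative is taken. *)
Lemma rayleigh_max M (a : 'rV[R]_n) : (0 < n)%N -> (forall k, 0 < a 0 k) -> M^T = M ->
  exists mu w, [/\ w != 0, M *m w = mu *: (diag_mx a *m w) &
    forall v, bform M v v <= mu * bform (diag_mx a) v v].
Proof.
move=> n0 a0 Ms; set D := diag_mx a.
have Dpos : spd D := diag_mx_spd a0.
pose K := [set x : 'rV[R]_n | bform D x^T x^T = 1].
have scale v : v != 0 -> K ((Num.sqrt (bform D v v))^-1 *: v)^T.
  move=> vn; have s0 : 0 < Num.sqrt (bform D v v) by rewrite sqrtr_gt0 Dpos.
  rewrite /K /= trmxK bformZl bformZr mulrA -invfM -expr2 sqr_sqrtr ?mulVf ?gt_eqF ?Dpos//.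
  exact/ltW/Dpos.
have cK : compact K.
  have -> : K = [set x : 'rV[R]_n | forall k, - (1 + (a 0 k)^-1) <= x 0 k <= 1 + (a 0 k)^-1] `&` K.
    apply/seteqP; split=> x; last by case.
    move=> Kx; split=> // k; rewrite -ler_norml.
    have ak : 0 < (a 0 k)^-1 by rewrite invr_gt0.
    have : a 0 k * x 0 k ^+ 2 <= 1.
      rewrite -Kx bform_diag (bigD1 k)//= mxE lerDl.
      by apply: sumr_ge0 => l _; rewrite mulr_ge0 ?sqr_ge0// ltW.
    rewrite -ler_pdivlMl// mulr1 -real_normK ?num_real// => h.
    rewrite leNgt; apply/negP => lt; have : `|x 0 k| ^+ 2 >= (1 + (a 0 k)^-1) ^+ 2.
      by rewrite ler_sqr ?nnegrE ?(ltW lt)// addr_ge0// ltW.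
    move: h; set b := (a 0 k)^-1 in ak *; nra.
  apply: compact_closedI; first exact: box_compact.
  have -> : K = (fun x : 'rV[R]_n => bform D x^T x^T) @^-1` [set 1] by [].
  apply: preimage_closed; first by move=> x _; exact: bform_continuous.
  exact: closed_eq.
have K0 : K !=set0.
  exists ((Num.sqrt (bform D (delta_mx (Ordinal n0) 0) (delta_mx (Ordinal n0) 0)))^-1 *: delta_mx (Ordinal n0) 0)^T.
  apply: scale; apply/eqP => /colP/(_ (Ordinal n0)); rewrite !mxE !eqxx/= => /eqP; rewrite oner_eq0//.
have [x Kx xmax] := @EVT_max_rV R n _ K K0 cK (continuous_subspaceT (@bform_continuous M)).
rewrite inE in Kx; pose mu := bform M x^T x^T.
have le v : bform M v v <= mu * bform D v v.
  have [->|vn] := eqVneq v 0; first by rewrite /bform !mulmx0 !mxE mulr0.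
  have := xmax ((Num.sqrt (bform D v v))^-1 *: v)^T; rewrite inE => /(_ (scale v vn)).
  rewrite trmxK bformZl bformZr mulrA -invfM -expr2 sqr_sqrtr; last exact/ltW/Dpos.
  by rewrite mulrC ler_pdivrMr ?Dpos.
exists mu, x^T; split=> //.
  by apply/eqP => x0; move: Kx; rewrite /K/= x0 /bform mulmx0 mxE => /eqP; rewrite eq_sym oner_eq0.
have Ds : D^T = D by exact: tr_diag_mx.
have := @psd_kernel (mu *: D + (-1) *: M) x^T.
have pM : psd (mu *: D + (-1) *: M).
  by move=> v; rewrite bformDm !bformZm; have := le v; lra.
rewrite linearD/= !linearZ/= Ds Ms => /(_ erefl pM).
rewrite bformDm !bformZm.
rewrite Kx -/mu mulr1 mulN1r subrr => /(_ erefl); rewrite mulmxDl -!scalemxAl scaleN1r.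
by move=> /eqP; rewrite subr_eq0 => /eqP.
Qed.

End QuadraticForms.

Lemma bform_mul (R : realType) (n m : nat) (M : 'M[R]_n) (N P : 'M[R]_(n, m)) (u v : 'cV[R]_m) :
  bform (N^T *m M *m P) u v = bform M (N *m u) (P *m v).
Proof. by rewrite /bform trmx_mul !mulmxA. Qed.

(** A real supremum dominates its set only if the set is bounded: eigenvalues are roots of the
    characteristic polynomial, and the sum of the moduli of its roots serves as a bound. *)
Lemma eigenvalue_le_spectral_radius (R : realType) (n : nat) (M : 'M[R]_n) (mu : R) :
  eigenvalue M mu -> mu <= spectral_radius M.
Proof.
move=> ev; apply: le_trans (ler_norm mu) _; apply: ub_le_sup; last first.
  exists (real_complex R mu); first by rewrite /= eigenvalue_map.
  by rewrite /ComplexField.Normc.normc /= expr0n addr0 sqrtr_sqr.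
pose cp := char_poly (map_mx (real_complex R) M).
have [s sE] := closed_field_poly_normal cp.
exists (\sum_(z <- s) ComplexField.Normc.normc z) => _ [z /= zev <-].
have zs : z \in s.
  move: zev; rewrite eigenvalue_root_char -/cp sE rootZ ?root_prod_XsubC// lead_coef_eq0.
  exact/monic_neq0/char_poly_monic.
rewrite (big_rem z)//= lerDl; apply: sumr_ge0 => -[x y] _; exact: sqrtr_ge0.
Qed.

(** * The two-level method for abstract matrices *)

Section TwoLevel.
Variables (R : realType) (n r : nat) (A : 'M[R]_n) (omega cD K : R) (ic : 'M[R]_(n, r)).
Hypothesis As : A^T = A.
Hypothesis Ap : spd A.
Let a : 'rV[R]_n := \row_k A k k.
Let D := diag_mx a.
Hypothesis omega_ok : 0 < omega < 2 / spectral_radius (invmx D *m A).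
Let S := omega *: invmx D.
Let Rbar := symmetrized A S.
Hypothesis ic_rank : \rank ic = r.
Hypothesis cD0 : 0 < cD.
Hypothesis K1 : 1 <= K.
Hypothesis smoothing : forall c, bform (invmx Rbar) c c <= cD * bform D c c.
Hypothesis approx : forall c : 'cV[R]_n, exists y : 'cV[R]_r,
  \sum_k A k k * (c k 0 - (ic *m y) k 0) ^+ 2 <= K * bform A c c.
Implicit Types (u v w : 'cV[R]_n).

(** In dimension 0 there are no eigenvalues, the supremum of the empty set is 0, and [2 / 0 = 0]
    leaves no room for [omega]. *)
Lemma dim_gt0 : (0 < n)%N.
Proof.
rewrite lt0n; apply/eqP => n0; move: omega_ok; rewrite (_ : spectral_radius _ = 0) ?invr0 ?mulr0.
  by move=> /andP[h1 h2]; have := lt_trans h1 h2; rewrite ltxx.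
rewrite /spectral_radius (_ : [set _ | z in _] = set0) ?sup0//.
apply/seteqP; split=> // _ [z /= /eigenvalueP[v _ vn] _]; case/eqP: vn.
by apply/rowP => k; have := ltn_ord k; rewrite {2}n0.
Qed.

Lemma diag_gt0 k : 0 < a 0 k.
Proof.
have := Ap (v := delta_mx k 0); rewrite /bform trmx_delta -mulmxA -colE -rowE !mxE.
apply; apply/eqP => /colP/(_ k); rewrite !mxE !eqxx/= => /eqP; rewrite oner_eq0//.
Qed.

Let diag_spd : spd D := diag_mx_spd diag_gt0.

Let Ds : D^T = D. Proof. exact: tr_diag_mx. Qed.
Let Du : D \in unitmx := spd_unit diag_spd.
Let omega0 : 0 < omega. Proof. by case/andP: omega_ok. Qed.
Let Ss : S^T = S. Proof. by rewrite /S linearZ/= trmx_inv Ds. Qed.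

(** The largest Rayleigh quotient of [A] relative to [D] is an eigenvalue of [invmx D *m A], hence
    at most the spectral radius and less than [2 / omega]. *)
Lemma stiffness_bound v : bform A v v <= 2 / omega * bform D v v /\ (v != 0 -> bform A v v < 2 / omega * bform D v v).
Proof.
have [mu [w [wn we le]]] := rayleigh_max dim_gt0 diag_gt0 As.
have mu0 : 0 < mu.
  have := le w; have := Ap wn; have := diag_spd wn => h1 h2 h3.
  by rewrite -(pmulr_lgt0 _ h1); apply: lt_le_trans h2 h3.
have ev : eigenvalue (invmx D *m A) mu.
  (* [eigenvalue] refers to row vectors, so the left eigenvector is needed. *)
  apply/eigenvalueP; exists (w^T *m D).
    rewrite mulmxA mulmxK//; apply: (can_inj (@trmxK _ _ _)).
    by rewrite trmx_mul trmxK As we linearZ/= trmx_mul trmxK Ds.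
  apply/eqP => h; case/eqP: wn; apply: (can_inj (@trmxK _ _ _)); rewrite trmx0.
  by rewrite -[LHS](mulmxK Du) h mul0mx.
have rho := eigenvalue_le_spectral_radius ev.
have m2 : mu < 2 / omega.
  have rp := lt_le_trans mu0 rho; have /andP[_] := omega_ok; rewrite ltr_pdivlMr// ltr_pdivlMr// => h.
  by apply: le_lt_trans h; rewrite mulrC ler_pM2l.
split=> [|vn]; first by apply: le_trans (le v) _; rewrite ler_wpM2r ?(ltW m2)//; exact: (spd_psd diag_spd).
by apply: le_lt_trans (le v) _; rewrite ltr_pM2r//; exact: diag_spd.
Qed.

Let Rbars : Rbar^T = Rbar.
Proof. by rewrite /Rbar /symmetrized Ss linearB linearD/= !trmx_mul As Ss mulmxA. Qed.

Lemma bform_symmetrized g : bform Rbar g g = 2 * bform S g g - bform A (S *m g) (S *m g).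
Proof.
rewrite /Rbar /symmetrized -scaleN1r bformDm bformDm (bformZm _ (-1)) bform_mul Ss; ring.
Qed.

(** With [z = S x] the form of [Rbar] at [x] is [(2 / omega) |z|_D^2 - |z|_A^2], positive by the
    strict half of [stiffness_bound]. *)
Lemma symmetrized_spd : spd Rbar.
Proof.
move=> x xn; have [z zE] : exists z, z = S *m x by exists (S *m x).
have xE : x = omega^-1 *: (D *m z).
  by rewrite zE /S -scalemxAl -scalemxAr mulKVmx// scalerA mulVf ?scale1r// gt_eqF.
have zn : z != 0.
  by apply/eqP => z0; case/eqP: xn; rewrite xE z0 mulmx0 scaler0.
have e : bform S x x = omega^-1 * bform D z z.
  by rewrite /bform -mulmxA -zE {1}xE linearZ/= trmx_mul Ds -scalemxAl mxE.
rewrite bform_symmetrized -zE e mulrA subr_gt0.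
by have [_] := stiffness_bound z; apply.
Qed.

Lemma smoothing_identity w :
  bform A (w - S *m (A *m w)) (w - S *m (A *m w)) = bform A w w - bform Rbar (A *m w) (A *m w).
Proof.
set g := A *m w.
have e : bform A w (S *m g) = bform S g g by rewrite /bform /g trmx_mul As !mulmxA.
have e' : bform A (S *m g) w = bform S g g by rewrite (bformC _ _ As).
rewrite bform_symmetrized -[- (S *m g)]scaleN1r !(bformDl, bformDr, bformZl, bformZr) e e'; ring.
Qed.

Lemma symmetrized_le w : bform Rbar (A *m w) (A *m w) <= bform A w w.
Proof. by rewrite -subr_ge0 -smoothing_identity; exact: (spd_psd Ap). Qed.

Let pairing w z : (((A *m w)^T *m z) 0 0) = bform A w z.
Proof. by rewrite /bform trmx_mul As. Qed.

(** Since [Rbar] is dominated by the inverse of [A], the form of [A] is at most that of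
    [invmx Rbar]; on a coordinate vector the forms of [A] and [D] coincide. The bound keeps the
    contraction factor nonnegative. *)
Lemma cD_ge1 : 1 <= cD.
Proof.
pose k := Ordinal dim_gt0; pose w : 'cV[R]_n := delta_mx k 0.
have wn : w != 0 by apply/eqP => /colP/(_ k); rewrite !mxE !eqxx/= => /eqP; rewrite oner_eq0.
have wA : 0 < bform A w w by exact: Ap.
have := cauchy_schwarz_inv (A *m w) w Rbars symmetrized_spd; rewrite pairing => h.
have h2 : bform A w w <= bform (invmx Rbar) w w.
  rewrite -(ler_pM2l wA) -expr2; apply: le_trans h _; rewrite ler_wpM2r ?symmetrized_le//.
  have := le_trans (sqr_ge0 _) (cauchy_schwarz_inv w w Rbars symmetrized_spd).
  by rewrite pmulr_rge0//; exact: symmetrized_spd.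
have h3 := le_trans h2 (smoothing w).
have e : bform D w w = bform A w w.
  rewrite bform_diag (bigD1 k)//= big1 ?addr0 => [|l lk]; last by rewrite !mxE (negPf lk) expr0n mulr0.
  by rewrite /bform trmx_delta -mulmxA -colE -rowE !mxE !eqxx expr1n mulr1.
by rewrite e ler_pMl// in h3.
Qed.

Let Ac := ic^T *m A *m ic.

Lemma coarse_unit : Ac \in unitmx.
Proof.
apply: spd_unit => y yn; rewrite bform_mul; apply: Ap; apply/eqP => iy; case/eqP: yn.
apply: (can_inj (@trmxK _ _ _)); rewrite trmx0.
have fr : row_free ic^T by rewrite /row_free mxrank_tr ic_rank.
by apply: (row_free_inj fr); rewrite mul0mx -trmx_mul iy trmx0.
Qed.

Lemma two_level_contraction v :
  bform A (two_level A S ic *m v) (two_level A S ic *m v) <= (1 - (cD * K)^-1) * bform A v v.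
Proof.
pose y := invmx Ac *m (ic^T *m (A *m v)); pose w := v - ic *m y.
have -> : two_level A S ic *m v = w - S *m (A *m w).
  have -> : two_level A S ic = (1%:M - S *m A) *m (1%:M - ic *m invmx Ac *m ic^T *m A) by [].
  rewrite -[LHS]mulmxA (_ : (1%:M - ic *m invmx Ac *m ic^T *m A) *m v = w).
    by rewrite mulmxBl mul1mx mulmxA.
  by rewrite mulmxBl mul1mx /w /y !mulmxA.
have orth z : bform A w (ic *m z) = 0.
  rewrite (bformC _ _ As) /bform trmx_mul -!mulmxA.
  rewrite (_ : ic^T *m (A *m w) = 0) ?mulmx0 ?mxE//.
  by rewrite /w !mulmxBr [in X in _ - X]mulmxA [in X in _ - X]mulmxA -/Ac /y mulKVmx ?subrr// coarse_unit.
(* The factor has to be nonnegative before the energy of [w] may be replaced by the larger energy of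
   [v]. *)
have c1 := cD_ge1; have CK : 0 < cD * K by rewrite mulr_gt0// (lt_le_trans ltr01).
have le1 : 0 <= 1 - (cD * K)^-1.
  by rewrite subr_ge0 invf_le1// (le_trans c1)// ler_peMr// ltW.
have vE : v = w + ic *m y by rewrite /w subrK.
clearbody w; have wv : bform A w w <= bform A v v.
  rewrite vE !(bformDl, bformDr) orth (bformC _ _ As) orth addr0 add0r lerDl; exact: (spd_psd Ap).
apply: le_trans (ler_wpM2l le1 wv); rewrite smoothing_identity.
rewrite mulrBl mul1r lerD2l lerN2 ler_pdivrMl//.
have [->|wn] := eqVneq w 0; first by rewrite /bform !mulmx0 !mxE mulr0.
have wA : 0 < bform A w w by exact: Ap.
have [z hz] := approx w.
have e : bform A w w = ((A *m w)^T *m (w - ic *m z)) 0 0.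
  by rewrite pairing bformDr -scaleN1r bformZr orth mulr0 addr0.
have h := cauchy_schwarz_inv (A *m w) (w - ic *m z) Rbars symmetrized_spd; rewrite -e expr2 in h.
rewrite -(ler_pM2l wA); apply: le_trans h _.
rewrite [leRHS](_ : _ = bform Rbar (A *m w) (A *m w) * (cD * (K * bform A w w))); last by ring.
apply: ler_wpM2l; first exact: (spd_psd symmetrized_spd).
apply: le_trans (smoothing _) _; rewrite ler_pM2l//; apply: le_trans hz.
by rewrite bform_diag le_eqVlt; apply/orP; left; apply/eqP; apply: eq_bigr => k _; rewrite !mxE.
Qed.

End TwoLevel.

(** * From matrices back to finite element functions *)

Section Assembly.
Variables (R : realType) (d : nat) (Omega : set 'rV[R]_d) (sigma gamma : R) (T : mesh R d) (p : nat).
Hypothesis d2 : (2 <= d)%N.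
Hypothesis d3 : (d <= 3)%N.
Hypothesis sigma1 : 1 <= sigma.
Hypothesis gamma1 : 1 <= gamma.
Hypothesis mesh_ok : admissible_mesh Omega sigma gamma T.
Hypothesis geo_lin : multilinear_geo T.
Hypothesis dom : admissible_domain Omega.
Hypothesis p0 : (0 < p)%N.
Let d0 : (0 < d)%N := ltn_trans (ltn0Sn 0) d2.
Local Notation n := (ndof Omega T p).
Local Notation A := (stiffness Omega T p).
Implicit Types (c : 'cV[R]_n).

Lemma realize_V c : V_space Omega T p (realize c).
Proof.
split; first exact: (realize_fe d0 d3 sigma1 mesh_ok geo_lin p0).
move=> y yb; rewrite /realize big1// => k _.
by rewrite (phi_bdry d0 d3 sigma1 mesh_ok geo_lin dom p0 (dof_interior k) yb) mulr0.
Qed.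

Lemma stiffness_sym : A^T = A.
Proof. by apply/matrixP => k l; rewrite !mxE energyC. Qed.

Lemma energy_bform c : energy T (realize c) (realize c) = bform A c c.
Proof. exact: (energy_realize d2 d3 sigma1 mesh_ok geo_lin p0). Qed.

Lemma stiffness_spd : spd A.
Proof.
move=> c cn; rewrite -energy_bform lt_neqAle eq_sym.
have [fc bc] := realize_V c.
apply/andP; split; last first.
  by apply: leb_int_ge0 => y _; apply: sumr_ge0 => k _; rewrite -expr2 sqr_ge0.
apply/eqP => e0; case/eqP: cn; apply/colP => k; rewrite [RHS]mxE.
rewrite -(realize_dof d0 d3 sigma1 mesh_ok geo_lin p0 c).
apply: (energy_definite d2 sigma1 gamma1 mesh_ok geo_lin dom p0 fc bc e0).
exact: (interior_pts_Omega mesh_ok geo_lin dom p0 (dof_interior k)).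
Qed.

Lemma energy_opnorm_le (M : 'M[R]_n) (q : R) : 0 <= q ->
  (forall c, bform A (M *m c) (M *m c) <= q * bform A c c) -> energy_opnorm M ^+ 2 <= q.
Proof.
move=> q0 hM; set E := [set energy_norm T (realize (M *m coords Omega T p v)) | v in
  [set v | V_space Omega T p v /\ energy_norm T v <= 1]].
have ub : ubound E (Num.sqrt q).
  move=> _ [v [Vv v1] <-]; rewrite /energy_norm energy_bform ler_wsqrtr//.
  apply: le_trans (hM _) _; rewrite ler_piMr// -energy_bform.
  rewrite (V_realize d0 d3 sigma1 mesh_ok geo_lin p0 Vv).
  rewrite -[energy _ _ _]sqr_sqrtr ?expr_le1 ?sqrtr_ge0//.
  by apply: leb_int_ge0 => y _; apply: sumr_ge0 => k _; rewrite -expr2 sqr_ge0.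
(* The zero function makes the set nonempty, so that its supremum is a true least upper bound and
   nonnegative. *)
have z0 : E (energy_norm T (realize (M *m coords Omega T p (realize (0 : 'cV[R]_n))))).
  exists (realize (0 : 'cV[R]_n)) => //; split; first exact: realize_V.
  by rewrite /energy_norm energy_bform /bform mulmx0 mxE sqrtr0.
have s0 : 0 <= sup E.
  by apply: le_trans (ub_le_sup _ z0); [exact: sqrtr_ge0|exists (Num.sqrt q)].
rewrite -[leRHS](sqr_sqrtr q0) /energy_opnorm -/E ler_sqr ?nnegrE ?sqrtr_ge0//.
by apply: ge_sup => //; eexists; exact: z0.
Qed.

End Assembly.

Theorem mainTheorem1 (R : realType) (d : nat) (d23 : d = 2%N \/ d = 3%N)
    (Omega : set 'rV[R]_d) (dom : admissible_domain Omega)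
    (sigma gamma kappa : R)
    (sigma1 : 1 <= sigma) (gamma1 : 1 <= gamma) (kappa1 : 1 <= kappa) :
  exists2 C : R, 0 < C &
  forall (T : mesh R d) (p p' : nat) (B : hierarchy R d),
  admissible_mesh Omega sigma gamma T -> multilinear_geo T ->
  (1 <= p' <= p)%N ->
  admissible_hierarchy T p B kappa p' ->
  let A := stiffness Omega T p in
  let D := diag_stiffness Omega T p in
  forall omega : R, 0 < omega < 2 / spectral_radius (invmx D *m A) ->
  let Rj := omega *: invmx D in
  forall (r : nat) (ic : 'M[R]_(ndof Omega T p, r)),
  coarse_inclusion B p' ic ->
  forall cD : R, 0 < cD ->
  (forall v, V_space Omega T p v ->
     qform (invmx (symmetrized A Rj)) v <= cD * qform D v) ->
  let h := mesh_size T in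
  let H := agg_size T B in
  let L : R := (max_owned B)%:R in
  energy_opnorm (two_level A Rj ic) ^+ 2 <=
    1 - C / (p%:R ^+ (2 * d + 8) * (H ^+ 3 / h ^+ 3)
             * (1 + p'%:R ^- 2 + L ^+ 2 * p%:R ^+ d)
             * (1 + L ^+ 2 * (H / h)) * cD).
Proof.
have d2 : (2 <= d)%N by case: d23 => ->.
have d3 : (d <= 3)%N by case: d23 => ->.
have d0 : (0 < d)%N by exact: ltn_trans d2.
have gam0 : 0 < gamma := lt_le_trans ltr01 gamma1.
have kap0 : 0 < kappa := lt_le_trans ltr01 kappa1.
pose K0 := coarse_const d sigma gamma * (cell_degree d sigma gamma * (kappa + 1)).
have K00 : 0 <= K0.
  rewrite mulr_ge0 ?coarse_const_ge0// mulr_ge0 ?(cell_degree_ge0 d2)//.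
  by rewrite addr_ge0// ltW.
(* The summand 1 keeps the denominator positive and will make [K] at least 1; [gamma^-3] pays for
   the lower bound of [(H / h)^3]. *)
exists (gamma ^- 3 / (K0 + 1)).
  by rewrite divr_gt0 ?invr_gt0 ?exprn_gt0// ltr_wpDl.
move=> T p p' B mesh_ok geo_lin /andP[p1 pp] hier A D omega omega_ok Rj r ic hic cD cD0 smooth.
cbv zeta; set h := mesh_size T; set H := agg_size T B; set L : R := (max_owned B)%:R.
have p0 : (0 < p)%N := leq_trans p1 pp.
have As : A^T = A := stiffness_sym _ _ _.
have Ap : spd A := stiffness_spd d2 d3 sigma1 gamma1 mesh_ok geo_lin dom p0.
have n0 := dim_gt0 omega_ok.
set X := (X in _ / (X * cD)).
have h0 : 0 < h.
  have /(support_ptsP T p)[j _] := dof_support (Ordinal n0).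
  exact: (mesh_size_gt0 d2 mesh_ok geo_lin j).
have Hh : gamma^-1 <= H / h.
  rewrite ler_pdivlMr// mulrC ler_pdivrMr// mulrC.
  exact: (mesh_size_le_agg_size d2 sigma1 gamma1 kappa1 mesh_ok geo_lin dom hier n0).
have L1 : 1 <= L := max_owned_ge1 hier n0.
have p1r : 1 <= p%:R :> R by rewrite ler1n.
(* Factor by factor: [p^(2 d + 8) >= p^(2 d + 4)], [(H / h)^3 >= gamma^-3], the third factor is at
   least [L^2], the fourth at least 1. *)
have X0 : gamma ^- 3 * (L ^+ 2 * p%:R ^+ (2 * d + 4)) <= X.
  have Hh0 : 0 <= H / h by apply: le_trans Hh; rewrite invr_ge0 ltW.
  have pp0 m : 0 <= p%:R ^+ m :> R by rewrite exprn_ge0.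
  have g3 : gamma ^- 3 <= H ^+ 3 / h ^+ 3.
    by rewrite -exprVn -expr_div_n lerXn2r ?nnegrE ?invr_ge0// ltW.
  have g30 : 0 <= gamma ^- 3 by rewrite invr_ge0 exprn_ge0// ltW.
  have a1 : p%:R ^+ (2 * d + 4) <= p%:R ^+ (2 * d + 8) :> R by rewrite ler_weXn2l// leq_add2l.
  have a2 : L ^+ 2 <= 1 + p'%:R ^- 2 + L ^+ 2 * p%:R ^+ d.
    have : L ^+ 2 <= L ^+ 2 * p%:R ^+ d by rewrite ler_peMr ?sqr_ge0// exprn_ege1.
    by have : 0 <= p'%:R ^- 2 :> R; [rewrite invr_ge0 exprn_ge0|lra].
  have a3 : 1 <= 1 + L ^+ 2 * (H / h) by rewrite lerDl mulr_ge0 ?sqr_ge0.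
  have b1 := ler_pM (pp0 _) g30 a1 g3.
  have b2 := ler_pM (mulr_ge0 (pp0 _) g30) (sqr_ge0 L) b1 a2.
  have b3 := ler_pM (mulr_ge0 (mulr_ge0 (pp0 _) g30) (sqr_ge0 L)) ler01 b2 a3.
  by apply: le_trans b3; rewrite mulr1 le_eqVlt; apply/orP; left; apply/eqP; ring.
have K01 : 0 < K0 + 1 by rewrite ltr_wpDl.
have g3p : 0 < gamma ^- 3 by rewrite invr_gt0 exprn_gt0.
(* Chosen so that [cD K] is exactly the claimed denominator divided by [C]. *)
pose K := X / (gamma ^- 3 / (K0 + 1)).
have KX : (K0 + 1) * (L ^+ 2 * p%:R ^+ (2 * d + 4)) <= K.
  rewrite /K ler_pdivlMr ?divr_gt0//; apply: le_trans X0.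
  by rewrite le_eqVlt; apply/orP; left; apply/eqP; field; rewrite !gt_eqF.
have Lp1 : 1 <= L ^+ 2 * p%:R ^+ (2 * d + 4).
  by rewrite mulr_ege1// exprn_ege1.
have K1 : 1 <= K by apply: le_trans KX; rewrite mulr_ege1// lerDr.
have approx (c : 'cV[R]_(ndof Omega T p)) : exists y : 'cV[R]_r,
    \sum_k A k k * (c k 0 - (ic *m y) k 0) ^+ 2 <= K * bform A c c.
  have [y hy] := coarse_approx d2 d3 sigma1 gamma1 kappa1 mesh_ok geo_lin p0 hier c hic.
  exists y; apply: le_trans hy _; apply: ler_wpM2r; first exact: (spd_psd Ap).
  apply: le_trans KX; rewrite /approx_const -/L.
  apply: (@le_trans _ _ (K0 * (L ^+ 2 * p%:R ^+ (2 * d + 4)))).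
    by rewrite le_eqVlt; apply/orP; left; apply/eqP; rewrite /K0; ring.
  by rewrite ler_wpM2r ?lerDl// (le_trans ler01).
have smoothing (c : 'cV[R]_(ndof Omega T p)) : bform (invmx (symmetrized A Rj)) c c <= cD * bform D c c.
  have := smooth _ (realize_V d2 d3 sigma1 mesh_ok geo_lin dom p0 c).
  by rewrite /qform (coords_realize d0 d3 sigma1 mesh_ok geo_lin p0).
have cD1 : 1 <= cD := cD_ge1 As Ap omega_ok smoothing.
have CK : 0 < cD * K by rewrite mulr_gt0// (lt_le_trans ltr01).
rewrite (_ : gamma ^- 3 / (K0 + 1) / (X * cD) = (cD * K)^-1); last first.
  have Xp : 0 < X by apply: lt_le_trans X0; rewrite mulr_gt0// (lt_le_trans ltr01).
  by rewrite /K; field; rewrite !gt_eqF.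
apply: (energy_opnorm_le d2 d3 sigma1 mesh_ok geo_lin dom p0).
  by rewrite subr_ge0 invf_le1// mulr_ege1.
move=> c; exact: (two_level_contraction As Ap omega_ok hic.1 cD0 K1 smoothing approx).
Qed.
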